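(* Let $w\in\mathcal W$ and let $d\ge1$ be an integer. If $g\in \mathrm{Bloch}_0(\mathbb C_0)\cap\mathcal D_d$, then $T_g$ is compact on $\mathcal H^2_w$.
   Context: For $\theta\in\mathbb R$, $\mathbb C_\theta=\{s\in\mathbb C:\Re s>\theta\}$, and $s=\sigma+it$. $\mathcal D$ is the class of functions represented by a convergent Dirichlet series in some half-plane; such a function belongs to a space of holomorphic functions on $\mathbb C_\theta$ if it extends holomorphically to $\mathbb C_\theta$ and the extension is in that space. Weights: $w=(w_n)_{n\ge1}$ belongs to $\mathcal W$ if, for some real $\beta>0$, either $w_n=[d(n)]^\beta$ for all $n$ ($d(n)$ the number of divisors of $n$), or $w_n=d_{\beta+1}(n)$ for all $n$, where $\zeta(s)^\gamma=\sum_{n\ge1}d_\gamma(n)n^{-s}$. $\mathcal H^2_w$ is the Hilbert space of Dirichlet series $f(s)=\sum_{n\ge1}a_n n^{-s}$ with $\|f\|_{\mathcal H^2_w}^2=\sum_{n\ge1}|a_n|^2/w_n<\infty$. Volterra operator: $T_gf(s)=-\int_s^{+\infty}f(u)g'(u)\,du$, $\Re s>1/2$; in terms of coefficients, if $f=\sum a_nn^{-s}$ and $g=\sum b_nn^{-s}$, then $T_gf(s)=\sum_{n\ge2}\frac1{\log n}\big(\sum_{k\mid n,\,k<n}a_k b_{n/k}\log(n/k)\big)n^{-s}$. $\mathcal D_d$ is the set of $f\in\mathcal D$ of the form $\sum_n a_nn^{-s}$, the sum being over positive integers $n$ all of whose prime factors are among the first $d$ primes. $\mathrm{Bloch}(\mathbb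 C_\theta)$ is the space of holomorphic $g$ on $\mathbb C_\theta$ with $\sup_{\sigma+it\in\mathbb C_\theta}(\sigma-\theta)|g'(\sigma+it)|<\infty$; $\mathrm{Bloch}_0(\mathbb C_\theta)$ is the subspace of those $g$ with $(\sigma-\theta)|g'(\sigma+it)|\to0$ as $\sigma\to\theta^+$, uniformly in $t\in\mathbb R$. *)

(* Defs.v *)
(* Library: MathComp-Analysis, over an arbitrary R : realType. *)
From HB Require Import structures.
From mathcomp Require Import all_boot all_order all_algebra complex.
From mathcomp Require Import all_classical all_reals all_analysis.

Set Implicit Arguments.
Unset Strict Implicit.
Unset Printing Implicit Defensive.

Import Order.TTheory GRing.Theory Num.Theory.
Import numFieldNormedType.Exports.

Local Open Scope classical_set_scope.
Local Open Scope ring_scope.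

(* The complex numbers as a one-dimensional normed space over R[i]: it is the
   regular copy ^o that carries the topology, and [derivable g s 1] for
   g : CC R -> CC R is complex differentiability at s. *)
Notation CC R := (R[i]^o).

Definition cabs (R : realType) (z : CC R) : R := ComplexField.Normc.normc z.

Definition half_plane (R : realType) (theta : R) : set (CC R) :=
  [set s | theta < complex.Re s].

(** * Dirichlet series *)

(* A Dirichlet series is given by its coefficients a : nat -> CC R, of which
   only the a n with n >= 1 are ever used; a 0 is irrelevant throughout. *)

(* n^{-s} = n^{-sigma} (cos (t log n) - i sin (t log n)), for n >= 1 *)
Definition npow (R : realType) (n : nat) (s : CC R) : CC R :=
  (n%:R `^ (- complex.Re s))%:C%C *
  (cos (complex.Im s * ln n%:R) +i* - sin (complex.Im s * ln n%:R))%C.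

Definition dirichlet_psum (R : realType) (a : nat -> CC R) (s : CC R)
  (N : nat) : CC R := \sum_(1 <= n < N) a n * npow n s.

Definition is_dirichlet (R : realType) (a : nat -> CC R) (s l : CC R) : Prop :=
  dirichlet_psum a s @ \oo --> l.

Definition dirichlet (R : realType) (a : nat -> CC R) (s : CC R) : CC R :=
  limn (dirichlet_psum a s).

(* p is prime and fewer than d primes are smaller than p *)
Definition among_first_primes (d p : nat) : bool :=
  prime p && (count prime (iota 0 p) < d)%N.

(* On some half-plane, g is the sum of a convergent Dirichlet series supported on
   the integers whose prime factors are among the first d primes.  On a larger
   half-plane where g is holomorphic, g is the holomorphic extension of it. *)
Definition in_Dd (R : realType) (d : nat) (g : CC R -> CC R) : Prop :=
  exists (b : nat -> CC R) (theta : R),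
    (forall n p : nat, (0 < n)%N -> b n != 0 -> prime p -> (p %| n)%N ->
       among_first_primes d p) /\
    (forall s, half_plane theta s -> is_dirichlet b s (g s)).

(** * Weights *)

Definition zeta (R : realType) (s : R) : R :=
  limn (fun N => \sum_(1 <= n < N) n%:R `^ (- s)).

(* w n = d_gamma(n) for n >= 1, that is, zeta(s)^gamma = sum_n w_n n^{-s}.  By
   uniqueness of Dirichlet coefficients, this identity for real s > 1, where
   zeta(s) > 0 and no branch of the power has to be chosen, determines w. *)
Definition is_gen_divisor (R : realType) (gamma : R) (w : nat -> R) : Prop :=
  forall s : R, 1 < s ->
    (fun N => \sum_(1 <= n < N) w n * n%:R `^ (- s)) @ \oo
      --> zeta s `^ gamma.

Definition weight_class (R : realType) (w : nat -> R) : Prop :=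
  exists beta : R, 0 < beta /\
    ((forall n, (0 < n)%N -> w n = (size (divisors n))%:R `^ beta) \/
     is_gen_divisor (beta + 1) w).

(** * The space H^2_w *)

Definition H2_sqnorm (R : realType) (w : nat -> R) (a : nat -> CC R) : \bar R :=
  (\sum_(1 <= n <oo) (cabs (a n) ^+ 2 / w n)%:E)%E.

Definition in_H2 (R : realType) (w : nat -> R) (a : nat -> CC R) : Prop :=
  (H2_sqnorm w a < +oo)%E.

Definition H2_norm (R : realType) (w : nat -> R) (a : nat -> CC R) : R :=
  Num.sqrt (fine (H2_sqnorm w a)).

(* T is a compact linear operator on H^2_w: the image of every bounded sequence
   has a convergent subsequence. *)
Definition compact_operator (R : realType) (w : nat -> R)
    (T : (nat -> CC R) -> (nat -> CC R)) : Prop :=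
  [/\ forall a, in_H2 w a -> in_H2 w (T a),
      forall (c : CC R) (a a' : nat -> CC R), in_H2 w a -> in_H2 w a' ->
        forall n, (0 < n)%N ->
          T (fun k => c * a k + a' k) n = c * T a n + T a' n
    & forall F : nat -> nat -> CC R,
        (exists M : R, forall k, in_H2 w (F k) /\ H2_norm w (F k) <= M) ->
        exists (phi : nat -> nat) (h : nat -> CC R),
          [/\ forall i j : nat, (i < j)%N -> (phi i < phi j)%N,
              in_H2 w h
            & H2_norm w (fun n => T (F (phi k)) n - h n) @[k --> \oo]
                --> (0 : R)]].

(** * Bloch spaces *)

Definition holomorphic_on (R : realType) (A : set (CC R)) (g : CC R -> CC R)
  : Prop := forall s, A s -> derivable g s 1.

Definition bloch (R : realType) (theta : R) (g : CC R -> CC R) : Prop :=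
  holomorphic_on (half_plane theta) g /\
  exists M : R, forall s, half_plane theta s ->
    (complex.Re s - theta) * cabs ('D_1 g s) <= M.

Definition bloch0 (R : realType) (theta : R) (g : CC R -> CC R) : Prop :=
  bloch theta g /\
  forall eps : R, 0 < eps -> exists2 delta : R, 0 < delta &
    forall s, theta < complex.Re s < theta + delta ->
      (complex.Re s - theta) * cabs ('D_1 g s) < eps.

(** * The Volterra operator *)

Definition cintegrable (R : realType) (A : set R) (F : R -> CC R) : Prop :=
  (@lebesgue_measure R).-integrable A (EFin \o (fun x => complex.Re (F x))) /\
  (@lebesgue_measure R).-integrable A (EFin \o (fun x => complex.Im (F x))).

Definition cintegral (R : realType) (A : set R) (F : R -> CC R) : CC R :=
  ((\int[@lebesgue_measure R]_(x in A) complex.Re (F x)) +i*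
   (\int[@lebesgue_measure R]_(x in A) complex.Im (F x)))%C.

(* f(u) g'(u) along the horizontal ray u = s + x, x >= 0 *)
Definition volterra_integrand (R : realType) (g f : CC R -> CC R) (s : CC R)
  (x : R) : CC R := f (s + x%:C%C) * 'D_1 g (s + x%:C%C).

(* - int_s^{+oo} f(u) g'(u) du *)
Definition volterra (R : realType) (g f : CC R -> CC R) (s : CC R) : CC R :=
  - cintegral `[0, +oo[ (volterra_integrand g f s).

(* T is the operator T_g on H^2_w.  For every f in H^2_w, the function T_g f on
   the half-plane Re s > 1/2 is the sum of the Dirichlet series with
   coefficients T a, where a are the coefficients of f; this determines
   (T a) n for n >= 1. *)
Definition is_volterra_operator (R : realType) (w : nat -> R)
    (g : CC R -> CC R) (T : (nat -> CC R) -> (nat -> CC R)) : Prop :=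
  forall a, in_H2 w a ->
    in_H2 w (T a) /\
    forall s, half_plane 2^-1 s ->
      cintegrable `[0, +oo[ (volterra_integrand g (dirichlet a) s) /\
      is_dirichlet (T a) s (volterra g (dirichlet a) s).

(* Main.v *)
Require Import Defs.
From HB Require Import structures.
From mathcomp Require Import all_boot all_order all_algebra complex.
From mathcomp Require Import all_classical all_reals all_analysis.
From mathcomp Require Import measurable_realfun.
From mathcomp Require Import ring lra zify.
Import Order.TTheory GRing.Theory Num.Theory.
Import numFieldNormedType.Exports.
Set Implicit Arguments.
Unset Strict Implicit.
Unset Printing Implicit Defensive.
Local Open Scope classical_set_scope.
Local Open Scope ring_scope.

(** Let g = sum b_n n ^ -s and B_n = b_n log n. On coefficients, T_g is the map

      (T a)_n = (log n) ^ -1 * sum_(k | n) a_k B_(n / k),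

    because f g' = - (sum a_n n ^ -s) (sum B_n n ^ -s) is a Dirichlet series and
    the integral of n ^ - (s + x) over x >= 0 is n ^ -s / log n
    ([volterra_identity]). The proof bounds T on blocks of integers, by the
    suprema of |g'| on vertical lines that approach the imaginary axis.

    Continuation. The series of g converges absolutely for Re s > 0, with sum g
    ([summable_everywhere], [extension_identity]). Indeed b_m is the mean of
    g(s) m ^ s over a far vertical line; g is bounded on closed strips in the open
    half-plane, so Cauchy's theorem moves the line to any abscissa e > 0, and
    b_m = O(m ^ e) ([coef_bound]). As b is supported on the integers built from
    finitely many primes, over which sum n ^ -e is finite ([smooth_sum_bounded]),
    the series converges absolutely; a bounded holomorphic function that vanishes
    far to the right vanishes ([vanish_left]), so the sum is g. In particular
    g' = - sum B_n n ^ -s for Re s > 0.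

    Multipliers. Convolution with (B_n n ^ -x)_n has norm at most the supremum of
    |g'| on the line Re s = x, in the space of square-summable sequences on any
    set of indices closed under divisors, by Parseval ([multiplier_bound]). A
    function of n that decreases for divisibility is a positive combination of
    indicators of such sets, so the bound persists with such a function as weight
    ([weighted_multiplier_bound]).

    Blocks. For both families of weights, w (n p) >= w n ((k + 2) / (k + 1)) ^ delta
    for some delta > 0, where p is prime and k is its exponent in n
    ([weight_class_properties]); for d_gamma this rests on multiplicativity, which
    is obtained from a recursion between coefficients. The block l consists of the
    n for which the logarithm of the part of n built from the given primes is about
    2 ^ l. There the abscissa x = 2 ^ -l is the natural one, as n ^ -x is of
    constant size on that part of n. The supremum of |g'| is at most M 2 ^ l, which
    the factor 1 / log n compensates. To sum over the blocks, 1 / w is replaced in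
    the block l by a weight that dominates it on this block, is smaller than it by
    the factor 2 ^ (- delta (l - j)) in the block j < l, and still decreases for
    divisibility by the growth of w. So the estimates of the blocks add up
    geometrically ([tail_bound]), and T is bounded ([volterra_coef_bounded]).

    Compactness. As g is in the little Bloch space, the supremum for the block l is
    o(2 ^ l); in each of the other blocks it is bounded while log n tends to
    infinity. Hence the tails of T a are uniformly small for a in the unit ball
    ([volterra_coef_small_tail]), and a subsequence along which all coordinates
    converge converges in norm ([compact_of_tails]). *)

(** * Finite sums of nonnegative terms *)

Section FiniteSums.
Variable R : realType.

Lemma ler_sum_subset (I : eqType) (s s' : seq I) (F : I -> R) :
  uniq s -> uniq s' -> {subset s <= s'} -> (forall i, i \in s' -> 0 <= F i) ->
  \sum_(i <- s) F i <= \sum_(i <- s') F i.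
Proof.
move=> us us' ss F0; rewrite [leRHS](bigID (mem s))/=.
have -> : \sum_(i <- s' | i \in s) F i = \sum_(i <- s) F i.
  rewrite -big_filter; apply: perm_big; apply: uniq_perm => //.
    exact: filter_uniq.
  by move=> i; rewrite mem_filter; case: (boolP (i \in s)) => // /ss ->.
by rewrite lerDl big_seq_cond sumr_ge0// => i /andP[/F0].
Qed.

Lemma ler_sum_subrange (F : nat -> R) (a b c d : nat) : (c <= a)%N -> (b <= d)%N ->
  (forall n, (c <= n < d)%N -> 0 <= F n) ->
  \sum_(a <= n < b) F n <= \sum_(c <= n < d) F n.
Proof.
move=> ca bd F0; apply: ler_sum_subset; rewrite ?iota_uniq// => n; rewrite !mem_index_iota.
  by move=> /andP[an nb]; rewrite (leq_trans ca an) (leq_trans nb bd).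
exact: F0.
Qed.

Lemma ler_sum_nn (I : Type) (r : seq I) (P Q : pred I) (F : I -> R) :
  (forall i, 0 <= F i) -> (forall i, P i -> Q i) ->
  \sum_(i <- r | P i) F i <= \sum_(i <- r | Q i) F i.
Proof.
move=> F0 PQ; rewrite [leLHS]big_mkcond [leRHS]big_mkcond/=.
apply: ler_sum => i _; case: ifP => [/PQ -> //|_]; by case: ifP.
Qed.

Lemma ler_sum_nat1 (N : nat) (F G : nat -> R) :
  (forall n, (0 < n)%N -> F n <= G n) ->
  \sum_(1 <= n < N) F n <= \sum_(1 <= n < N) G n.
Proof. by move=> h; apply: ler_sum_nat => n /andP[n1 _]; exact: h. Qed.

Lemma geometric_sum_le (q : R) (N : nat) : 0 <= q -> q < 1 ->
  \sum_(0 <= i < N) q ^+ i <= (1 - q)^-1.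
Proof.
move=> q0 q1; rewrite -[leRHS]mul1r ler_pdivlMr ?subr_gt0// mulrC.
have := subrX1 q N; rewrite -[_ - 1]opprB -[X in _ = X * _]opprB mulNr big_mkord.
by move=> /oppr_inj <-; rewrite lerBlDl lerDr exprn_ge0.
Qed.

End FiniteSums.

(** * The modulus and limits of complex sequences *)

Section Cabs.
Variable R : realType.
Implicit Types (z w : CC R) (x : R).

Lemma normCE z : `|z| = (cabs z)%:C%C :> R[i].
Proof. by case: z. Qed.

Lemma cabs_ge0 z : 0 <= cabs z.
Proof. by case: z => a b; rewrite sqrtr_ge0. Qed.

Lemma cabs0 : cabs (0 : CC R) = 0.
Proof. exact: ComplexField.Normc.normc0. Qed.

Lemma cabs1 : cabs (1 : CC R) = 1.
Proof. exact: ComplexField.Normc.normc1. Qed.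

Lemma cabs_eq0 z : cabs z = 0 -> z = 0.
Proof. exact: ComplexField.Normc.eq0_normc. Qed.

Lemma cabsM z w : cabs (z * w) = cabs z * cabs w.
Proof. exact: ComplexField.Normc.normcM. Qed.

Lemma cabsV z : cabs z^-1 = (cabs z)^-1.
Proof. exact: ComplexField.Normc.normcV. Qed.

Lemma cabsD z w : cabs (z + w) <= cabs z + cabs w.
Proof. by have := ler_normD (z : R[i]) w; rewrite !normCE -rmorphD/= lecR. Qed.

Lemma cabsN z : cabs (- z) = cabs z.
Proof. by case: z => a b; rewrite /cabs/= !sqrrN. Qed.

Lemma cabsB z w : cabs (z - w) <= cabs z + cabs w.
Proof. by rewrite -(cabsN w) cabsD. Qed.

Lemma cabsC z w : cabs (z - w) = cabs (w - z).
Proof. by rewrite -opprB cabsN. Qed.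

Lemma cabs_real x : cabs (x%:C%C : CC R) = `|x|.
Proof. by rewrite /cabs/= expr0n addr0 sqrtr_sqr. Qed.

Lemma cabs_sum (I : Type) (r : seq I) (P : pred I) (F : I -> CC R) :
  cabs (\sum_(i <- r | P i) F i) <= \sum_(i <- r | P i) cabs (F i).
Proof.
elim/big_rec2 : _ => [|i y1 y2 _ h]; first by rewrite cabs0.
by rewrite (le_trans (cabsD _ _))// lerD2l.
Qed.

Lemma cabsX z n : cabs (z ^+ n) = cabs z ^+ n.
Proof. by elim: n => [|n ih]; rewrite ?expr0 ?cabs1// !exprS cabsM ih. Qed.

Lemma cabs_sqr z : cabs z ^+ 2 = complex.Re z ^+ 2 + complex.Im z ^+ 2.
Proof. by case: z => a b; rewrite sqr_sqrtr// addr_ge0 ?sqr_ge0. Qed.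

Lemma ReD z w : complex.Re (z + w) = complex.Re z + complex.Re w.
Proof. by case: z w => a b []. Qed.
Lemma ImD z w : complex.Im (z + w) = complex.Im z + complex.Im w.
Proof. by case: z w => a b []. Qed.
Lemma ReN z : complex.Re (- z) = - complex.Re z.
Proof. by case: z. Qed.
Lemma ImN z : complex.Im (- z) = - complex.Im z.
Proof. by case: z. Qed.
Lemma ReB z w : complex.Re (z - w) = complex.Re z - complex.Re w.
Proof. by rewrite ReD ReN. Qed.
Lemma ImB z w : complex.Im (z - w) = complex.Im z - complex.Im w.
Proof. by rewrite ImD ImN. Qed.
Lemma ReM z w : complex.Re (z * w) =
  complex.Re z * complex.Re w - complex.Im z * complex.Im w.
Proof. by case: z w => a b []. Qed.
Lemma ImM z w : complex.Im (z * w) =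
  complex.Re z * complex.Im w + complex.Im z * complex.Re w.
Proof. by case: z w => a b []. Qed.

Lemma Re_sum (I : Type) (r : seq I) (P : pred I) (F : I -> CC R) :
  complex.Re (\sum_(i <- r | P i) F i) = \sum_(i <- r | P i) complex.Re (F i).
Proof. by elim/big_rec2 : _ => [|i y1 y2 _ <-]; rewrite ?ReD. Qed.

Lemma Im_sum (I : Type) (r : seq I) (P : pred I) (F : I -> CC R) :
  complex.Im (\sum_(i <- r | P i) F i) = \sum_(i <- r | P i) complex.Im (F i).
Proof. by elim/big_rec2 : _ => [|i y1 y2 _ <-]; rewrite ?ImD. Qed.

Lemma eq_ReIm z w : complex.Re z = complex.Re w -> complex.Im z = complex.Im w ->
  z = w.
Proof. by case: z w => a b [c e]/= -> ->. Qed.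

Lemma Re_le_cabs z : `|complex.Re z| <= cabs z.
Proof.
by rewrite -(@ler_pXn2r _ 2)// ?nnegrE ?cabs_ge0// cabs_sqr real_normK ?num_real//
  lerDl sqr_ge0.
Qed.

Lemma Im_le_cabs z : `|complex.Im z| <= cabs z.
Proof.
by rewrite -(@ler_pXn2r _ 2)// ?nnegrE ?cabs_ge0// cabs_sqr real_normK ?num_real//
  lerDr sqr_ge0.
Qed.

Lemma cabs_le_ReIm z : cabs z <= `|complex.Re z| + `|complex.Im z|.
Proof.
rewrite -(@ler_pXn2r _ 2)// ?nnegrE ?cabs_ge0 ?addr_ge0// cabs_sqr sqrrD.
rewrite !real_normK ?num_real// lerD2r lerDl.
by rewrite mulrn_wge0// mulr_ge0.
Qed.

(** The factor u reduces the estimate of a complex integral to that of the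
    integral of a real part. *)
Lemma cabs_rot z : exists2 u : CC R, cabs u = 1 & u * z = (cabs z)%:C%C.
Proof.
have [z0|z0] := eqVneq (cabs z) 0.
  by exists 1; rewrite ?cabs1// z0 (cabs_eq0 z0) mulr0.
have zN0 : z != 0 by apply: contra_neq z0 => ->; rewrite cabs0.
exists ((cabs z)%:C%C / z : CC R).
  by rewrite cabsM cabsV cabs_real ger0_norm ?cabs_ge0// divff.
by rewrite -mulrA (mulVf zN0) mulr1.
Qed.

(** The norm that defines the topology takes its values in R[i]; limits are
    handled below through this real-valued form, componentwise when possible. *)
Lemma cvg_cabsP (T : Type) (F : set_system T) {FF : Filter F} (f : T -> CC R) (l : CC R) :
  (f @ F --> l) <->
  (forall e : R, 0 < e -> \forall t \near F, cabs (l - f t) < e).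
Proof.
rewrite cvgrPdist_lt; split=> h e e0.
  have := h (e%:C%C); rewrite ltcR => /(_ e0).
  by apply: filterS => t; rewrite normCE ltcR.
move: e0; rewrite ltcE => /andP[/eqP/= e1 e2].
have := h _ e2; apply: filterS => t.
by rewrite normCE ltcE/= e1 eqxx.
Qed.

Lemma cvg_ReP (T : Type) (F : set_system T) {FF : Filter F} (f : T -> CC R) (l : CC R) :
  f @ F --> l -> complex.Re (f t) @[t --> F] --> complex.Re l.
Proof.
move=> /cvg_cabsP h; apply/cvgrPdist_lt => e e0; have := h e e0.
by apply: filterS => t; apply: le_lt_trans; rewrite -ReB Re_le_cabs.
Qed.

Lemma cvg_ImP (T : Type) (F : set_system T) {FF : Filter F} (f : T -> CC R) (l : CC R) :
  f @ F --> l -> complex.Im (f t) @[t --> F] --> complex.Im l.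
Proof.
move=> /cvg_cabsP h; apply/cvgrPdist_lt => e e0; have := h e e0.
by apply: filterS => t; apply: le_lt_trans; rewrite -ImB Im_le_cabs.
Qed.

Lemma cvg_ReIm (T : Type) (F : set_system T) {FF : Filter F} (f : T -> CC R) (l : CC R) :
  complex.Re (f t) @[t --> F] --> complex.Re l ->
  complex.Im (f t) @[t --> F] --> complex.Im l -> f @ F --> l.
Proof.
move=> /cvgrPdist_lt hr /cvgrPdist_lt hi; apply/cvg_cabsP => e e0.
have e2 : 0 < e / 2 by rewrite divr_gt0.
have := hr _ e2; have := hi _ e2; apply: filterS2 => t h1 h2.
rewrite (le_lt_trans (cabs_le_ReIm _))// ReB ImB [e]splitr ltrD//.
Qed.

Definition psum (V : nmodType) (z : nat -> V) (N : nat) : V :=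
  \sum_(1 <= n < N) z n.

Lemma rsum_cvg (z : nat -> R) (S : R) :
  (forall N, \sum_(1 <= n < N) `|z n| <= S) -> exists l : R, psum z @ \oo --> l.
Proof.
move=> hS; pose z' := fun n => if n == 0%N then 0 else z n.
have hz (g : nat -> R) N :
    \sum_(0 <= n < N) (if n == 0%N then 0 else g n) = \sum_(1 <= n < N) g n.
  case: N => [|N]; first by rewrite !big_geq.
  rewrite big_ltn//= add0r [LHS]big_nat_cond [RHS]big_nat_cond.
  by apply: eq_bigr => i /andP[/andP[]]; case: i.
have : cvgn [normed series z'].
  apply: nondecreasing_is_cvgn.
    move=> m n mn; rewrite /=.
    by rewrite /series/= [leRHS](@big_cat_nat _ _ _ m)//= lerDl sumr_ge0.
  exists S => _ [N _ <-]/=; rewrite /series/=.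
  have -> : \sum_(0 <= k < N) `|z' k| = \sum_(1 <= k < N) `|z k| => //.
  rewrite -(hz (fun n => `|z n|)); apply: eq_bigr => i _.
  by rewrite /z'; case: ifP; rewrite ?normr0.
move/(@normed_cvg R R^o) => /cvg_ex[/= l hl]; exists l.
have -> // : psum z = series z'.
by apply/funext => N; rewrite /series/= hz.
Qed.

Lemma csum_cvg (z : nat -> CC R) (S : R) :
  (forall N, \sum_(1 <= n < N) cabs (z n) <= S) ->
  exists l : CC R, psum z @ \oo --> l.
Proof.
move=> hS.
have [lr hr] : exists l : R, psum (fun n => complex.Re (z n)) @ \oo --> l.
  apply: (@rsum_cvg _ S) => N; apply: le_trans (hS N).
  by apply: ler_sum => i _; exact: Re_le_cabs.
have [li hi] : exists l : R, psum (fun n => complex.Im (z n)) @ \oo --> l.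
  apply: (@rsum_cvg _ S) => N; apply: le_trans (hS N).
  by apply: ler_sum => i _; exact: Im_le_cabs.
exists (lr +i* li)%C; apply: cvg_ReIm => /=.
  by under eq_fun do rewrite /psum Re_sum.
by under eq_fun do rewrite /psum Im_sum.
Qed.

Lemma cvg_cabs (T : Type) (F : set_system T) {FF : ProperFilter F}
    (f : T -> CC R) (l : CC R) : f @ F --> l -> cabs (f t) @[t --> F] --> cabs l.
Proof.
move=> /cvg_cabsP h; apply/cvgrPdist_lt => e e0; have := h e e0.
apply: filterS => t; apply: le_lt_trans.
rewrite ler_norml; apply/andP; split.
  by rewrite lerBrDr addrC lerBlDr cabsC [leRHS]addrC -{1}(subrK l (f t)) cabsD.
by rewrite lerBlDr -{1}(subrK (f t) l) cabsD.
Qed.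

Lemma cabs_lim_le (T : Type) (F : set_system T) {FF : ProperFilter F}
    (f : T -> CC R) (l : CC R) (e : R) : f @ F --> l ->
  (\forall t \near F, cabs (f t) <= e) -> cabs l <= e.
Proof.
move=> fl fe; rewrite -(cvg_lim _ (cvg_cabs fl))//.
by apply: limr_le => //; apply/cvg_ex; exists (cabs l); exact: cvg_cabs.
Qed.

Lemma csum_tail (z : nat -> CC R) (l : CC R) (N : nat) (e : R) :
  psum z @ \oo --> l -> (0 < N)%N ->
  (forall M, \sum_(N <= n < M) cabs (z n) <= e) -> cabs (l - psum z N) <= e.
Proof.
move=> zl N0 h.
have zl' : (psum z M - psum z N) @[M --> \oo] --> l - psum z N.
  apply/cvg_cabsP => d d0; have /cvg_cabsP/(_ _ d0) := zl.
  by apply: filterS => t; rewrite opprB addrA subrK.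
apply: (cabs_lim_le zl'); near=> M.
have NM : (N <= M)%N by near: M; exists N.
rewrite /psum [X in X - _](@big_cat_nat _ _ _ N)//= addrAC subrr add0r.
by rewrite (le_trans (cabs_sum _ _ _)).
Unshelve. all: by end_near. Qed.

Lemma small_tail (u : nat -> R) (S e : R) : (forall n, 0 <= u n) -> 0 < e ->
  (forall N, \sum_(1 <= n < N) u n <= S) ->
  exists2 N, (0 < N)%N & forall M, \sum_(N <= n < M) u n <= e.
Proof.
move=> u0 e0 hS; have [|l hl] := @rsum_cvg u S.
  by move=> N; under eq_bigr do rewrite ger0_norm//.
have /cvgrPdist_lt/(_ (e / 2)) : psum u @ \oo --> l by [].
rewrite divr_gt0// => /(_ isT)[N _ hN]; exists N.+1 => // M.
have [MN|NM] := leqP M N.+1; first by rewrite big_geq// ltW.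
have h1 := hN N.+1 (leqnSn _); have h2 := hN M (leq_trans (leqnSn _) (ltnW NM)).
have -> : \sum_(N.+1 <= n < M) u n = psum u M - psum u N.+1.
  rewrite /psum [X in X - _](@big_cat_nat _ _ _ N.+1)//=; last exact: ltnW.
  by rewrite addrAC subrr add0r.
move: h1 h2; rewrite !ltr_distl /= => /andP[h1 h2] /andP[h3 h4].
by lra.
Qed.

End Cabs.

(** * The complex exponential and the powers n ^ -s *)

Section Npow.
Variable R : realType.
Implicit Types (z w s : CC R) (x y r p : R).

(** The real part of exp (r z) e^(i p), z = x + i y, as a function of r.
    Differentiating again gives such functions, with the phase p moved by pi / 2,
    so that the mean value theorem used twice bounds the second-order remainder;
    p = 0 and p = - pi / 2 give the two parts of exp z. *)
Let F x y p r := expR (r * x) * cos (r * y + p).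

Let is_derive_F x y p r :
  is_derive r 1 (F x y p) (x * F x y p r + y * F x y (p + pi / 2) r).
Proof.
have h1 : is_derive r 1 (fun r : R => r * x) x.
  by apply: is_derive_eq; rewrite /= /GRing.scale/= !mulr1 ?mulr0 ?addr0 ?add0r.
have h2 : is_derive r 1 (fun r : R => r * y + p) y.
  by apply: is_derive_eq; rewrite /= /GRing.scale/= !mulr1 ?mulr0 ?addr0 ?add0r.
have h3 : is_derive r 1 (fun r => expR (r * x)) (expR (r * x) * x).
  exact: is_derive1_comp.
have h4 : is_derive r 1 (fun r => cos (r * y + p)) (- sin (r * y + p) * y).
  exact: is_derive1_comp.
rewrite /F; apply: is_derive_eq.
rewrite /GRing.scale/= addrA cosDpihalf; ring.
Qed.

Let F_le x y p r : 0 <= r <= 1 -> `|F x y p r| <= expR `|x|.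
Proof.
move=> /andP[r0 r1]; rewrite /F normrM (ger0_norm (expR_ge0 _)).
rewrite -[leRHS]mulr1 ler_pM ?expR_ge0// ?ler_expR ?cos_max//.
by rewrite (le_trans (ler_norm _))// normrM ger0_norm// ler_piMl.
Qed.

Let expcos_quad x y p :
  `|expR x * cos (y + p) - cos p - (x * cos p - y * sin p)| <=
  2 * (x ^+ 2 + y ^+ 2) * expR `|x|.
Proof.
have dF (q r : R) := is_derive_F x y q r.
have cF (q r : R) : {for r, continuous (F x y q)}.
  by apply/differentiable_continuous/derivable1_diffP; case: (dF q r).
pose G r := x * F x y p r + y * F x y (p + pi / 2) r.
pose G' r := x * G r + y * (x * F x y (p + pi / 2) r + y * F x y (p + pi / 2 + pi / 2) r).
have dG r : is_derive r 1 G (G' r).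
  have h1 := dF p r; have h2 := dF (p + pi / 2) r.
  rewrite /G; apply: is_derive_eq; rewrite /GRing.scale/= /G' /G; ring.
have cG r : {for r, continuous G}.
  by apply/differentiable_continuous/derivable1_diffP; case: (dG r).
have [c c01 hc] : exists2 c, c \in `]0, 1[ & F x y p 1 - F x y p 0 = G c * (1 - 0).
  apply: (@MVT _ (F x y p) G) => //.
  by apply: continuous_subspaceT => ?; exact: cF.
move: c01; rewrite in_itv/= => /andP[c0 c1].
have [e e01 he] : exists2 e, e \in `]0, c[ & G c - G 0 = G' e * (c - 0).
  apply: (@MVT _ G G') => //.
  by apply: continuous_subspaceT => ?; exact: cG.
move: e01; rewrite in_itv/= => /andP[e0 ec].
have -> : expR x * cos (y + p) - cos p - (x * cos p - y * sin p) = G' e * c.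
  rewrite subr0 in he; rewrite -he.
  move: hc; rewrite subr0 mulr1 => <-; rewrite /F /G /F !mul0r !mul1r !add0r expR0 !mul1r.
  by rewrite cosDpihalf; ring.
have e01 : 0 <= e <= 1 by rewrite (ltW e0) (ltW (lt_trans ec c1)).
have hG' : `|G' e| <= (`|x| + `|y|) ^+ 2 * expR `|x|.
  have -> : G' e = x ^+ 2 * F x y p e + (2 * (x * y)) * F x y (p + pi / 2) e
      + y ^+ 2 * F x y (p + pi / 2 + pi / 2) e.
    by rewrite /G' /G; ring.
  move: (F_le x y p e01) (F_le x y (p + pi / 2) e01).
  move: (F_le x y (p + pi / 2 + pi / 2) e01).
  move: (F x y p e) (F x y (p + pi / 2) e) (F x y (p + pi / 2 + pi / 2) e).
  move: (expR `|x|) => E f1 f2 f3 hf3 hf1 hf2.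
  have -> : (`|x| + `|y|) ^+ 2 * E =
    `|x| ^+ 2 * E + (2 * (`|x| * `|y|)) * E + `|y| ^+ 2 * E by ring.
  apply: (le_trans (ler_normD _ _)); apply: lerD.
    apply: (le_trans (ler_normD _ _)); apply: lerD.
      by rewrite normrM normrX ler_wpM2l.
    rewrite !normrM (ger0_norm (ler0n _ 2)).
    by rewrite ler_wpM2l// ?mulr_ge0.
  by rewrite normrM normrX ler_wpM2l.
rewrite normrM (ger0_norm (ltW c0)) (le_trans (ler_piMr (normr_ge0 _) (ltW c1)))//.
apply: le_trans hG' _; rewrite ler_wpM2r ?expR_ge0//.
rewrite -(real_normK (num_real x)) -(real_normK (num_real y)).
have := sqr_ge0 (`|x| - `|y|); nra.
Qed.

(** The product form is that of [npow], which makes [npowE] immediate. *)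
Definition cexp z : CC R :=
  (expR (complex.Re z))%:C%C * (cos (complex.Im z) +i* sin (complex.Im z))%C.

Lemma Re_cexp z : complex.Re (cexp z) = expR (complex.Re z) * cos (complex.Im z).
Proof. by case: z => a b; rewrite /cexp /= mul0r subr0. Qed.

Lemma Im_cexp z : complex.Im (cexp z) = expR (complex.Re z) * sin (complex.Im z).
Proof. by case: z => a b; rewrite /cexp /= mul0r addr0. Qed.

Lemma cabs_cexp z : cabs (cexp z) = expR (complex.Re z).
Proof.
rewrite /cexp cabsM cabs_real ger0_norm ?expR_ge0//.
by rewrite /cabs/= cos2Dsin2 sqrtr1 mulr1.
Qed.

Lemma cexpD z w : cexp (z + w) = cexp z * cexp w.
Proof.
apply: eq_ReIm; rewrite ?(Re_cexp (z + w)) ?(Im_cexp (z + w)) ?[RHS]ReM ?[RHS]ImM;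
  rewrite ?Re_cexp ?Im_cexp ReD ImD expRD ?cosD ?sinD; ring.
Qed.

Lemma cexp0 : cexp 0 = 1.
Proof. by apply: eq_ReIm; rewrite ?Re_cexp ?Im_cexp/= expR0 ?cos0 ?sin0 mul1r. Qed.

(** The quadratic remainder makes termwise differentiation of a Dirichlet series
    a matter of summing an absolutely convergent series. *)
Lemma cexp_quad z :
  cabs (cexp z - 1 - z) <= 4 * cabs z ^+ 2 * expR `|complex.Re z|.
Proof.
apply: (le_trans (cabs_le_ReIm _)).
rewrite !ReB !ImB Re_cexp Im_cexp /= cabs_sqr.
set x := complex.Re z; set y := complex.Im z.
have h1 := expcos_quad x y 0; have h2 := expcos_quad x y (- (pi / 2)).
rewrite sin0 cos0 addr0 mulr1 mulr0 subr0 in h1.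
rewrite cosN sinN cos_pihalf sin_pihalf in h2.
have e : cos (y - pi / 2) = sin y by rewrite cosB cos_pihalf sin_pihalf mulr0 add0r mulr1.
rewrite e in h2.
have -> : 4 * (x ^+ 2 + y ^+ 2) * expR `|x| =
  2 * (x ^+ 2 + y ^+ 2) * expR `|x| + 2 * (x ^+ 2 + y ^+ 2) * expR `|x| by ring.
apply: lerD => //; apply: le_trans h2.
by rewrite !subr0 mulr0 add0r mulrN1 opprK.
Qed.

Lemma npowE n s : (0 < n)%N -> npow n s = cexp (- (ln n%:R)%:C%C * s).
Proof.
move=> n0; have n0' : (n%:R : R) != 0 by rewrite pnatr_eq0 -lt0n.
case: s => a b; rewrite /npow /cexp /= /powR (negPf n0') oppr0 mul0r !subr0.
rewrite mul0r addr0 !mulNr cosN sinN; congr (_ * _).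
  by rewrite mulrC.
by rewrite (mulrC b).
Qed.

Lemma cabs_npow n s : cabs (npow n s) = n%:R `^ (- complex.Re s).
Proof.
rewrite /npow cabsM cabs_real ger0_norm ?powR_ge0//.
by rewrite /cabs/= sqrrN cos2Dsin2 sqrtr1 mulr1.
Qed.

Lemma npowD n s z : (0 < n)%N -> npow n (s + z) = npow n s * npow n z.
Proof. by move=> n0; rewrite !npowE// mulrDr cexpD. Qed.

Lemma npowM m n s : (0 < m)%N -> (0 < n)%N ->
  npow (m * n) s = npow m s * npow n s.
Proof.
move=> m0 n0; rewrite !npowE ?muln_gt0 ?m0// -cexpD -mulrDl.
by rewrite natrM lnM ?posrE ?ltr0n// rmorphD/= opprD.
Qed.

Lemma npow_quad n z : (0 < n)%N ->
  cabs (npow n z - 1 + (ln n%:R)%:C%C * z) <=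
  4 * (ln n%:R * cabs z) ^+ 2 * n%:R `^ (`|complex.Re z|).
Proof.
move=> n0; have n0' : (n%:R : R) != 0 by rewrite pnatr_eq0 -lt0n.
have l0 : 0 <= ln n%:R :> R by rewrite ln_ge0// ler1n.
have := cexp_quad (- (ln n%:R)%:C%C * z).
rewrite -npowE// mulNr opprK cabsN cabsM cabs_real ger0_norm// ReN ReM /=.
by rewrite mul0r subr0 normrN normrM (ger0_norm l0) /powR (negPf n0') (mulrC `|_|).
Qed.

End Npow.

(** * Complex derivatives and Cauchy's theorem on a rectangle *)

(** The quotient-free form of differentiability: for a series of functions it can
    be checked term by term, and it passes from R[i] to R by taking moduli. *)
Lemma is_derive1P (K : numFieldType) (f : K^o -> K^o) (s D : K^o) :
  is_derive s 1 f D <->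
  (forall e : K, 0 < e -> exists2 r : K, 0 < r &
    forall h : K^o, `|h| < r -> `|f (s + h) - f s - h * D| <= e * `|h|).
Proof.
split=> [[df <-] e e0|h].
  move/cvgrPdist_le: df => /(_ _ e0).
  move=> /nbhs_ballP[r /= r0 hr]; exists r => // h hh.
  have [->|h0] := eqVneq h 0; first by rewrite addr0 subrr mul0r subr0 normr0 mulr0.
  have := hr h; rewrite /ball/= sub0r normrN => /(_ hh h0).
  rewrite /derive/= /GRing.scale/= mulr1 => hl.
  rewrite -(@ler_pM2l _ (`|h|^-1)) ?invr_gt0 ?normr_gt0//.
  rewrite mulrCA mulVf ?mulr1 ?normr_eq0//; apply: le_trans hl.
  rewrite -normfV -normrM mulrBr mulrA mulVf// mul1r [leRHS]distrC.
  by rewrite (addrC h s).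
have cv : h0^-1 *: ((f \o shift s) (h0 *: 1) - f s) @[h0 --> (0 : K^o)^'] --> D.
  apply/cvgrPdist_le => e e0; have [r r0 hr] := h e e0.
  apply/nbhs_ballP; exists r => //= t.
  rewrite /ball/= sub0r normrN => tr t0.
  have := hr _ tr; rewrite /GRing.scale/= mulr1 [t + s]addrC.
  rewrite -(@ler_pM2l _ (`|t|^-1)) ?invr_gt0 ?normr_gt0//.
  rewrite mulrCA mulVf ?mulr1 ?normr_eq0//; apply: le_trans.
  rewrite -normfV -normrM [in leRHS]mulrBr mulrA mulVf// mul1r.
  by rewrite distrC.
apply: DeriveDef; first by apply/cvg_ex; exists D.
exact: cvg_lim cv.
Qed.

Section ComplexDerivative.
Variable R : realType.
Implicit Types (f : CC R -> CC R) (s D : CC R) (x t : R).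

Lemma is_deriveCP f s D :
  is_derive s 1 f D <->
  (forall e : R, 0 < e -> exists2 r : R, 0 < r &
    forall h : CC R, cabs h < r -> cabs (f (s + h) - f s - h * D) <= e * cabs h).
Proof.
split=> [/is_derive1P h e e0|h].
  have [|r] := h (e%:C%C); first by rewrite ltcR.
  rewrite ltcE => /andP[/eqP/= ri r0] hr; exists (complex.Re r) => // u hu.
  have := hr u; rewrite !normCE -rmorphM/= lecR; apply.
  by rewrite ltcE /= ri eqxx.
apply/is_derive1P => e; rewrite ltcE => /andP[/eqP/= ei e0].
have [r r0 hr] := h _ e0; exists (r%:C%C); first by rewrite ltcR.
move=> u; rewrite normCE ltcR => /hr hu.
rewrite [X in _ <= X * _](_ : e = (complex.Re e)%:C%C); last exact: eq_ReIm.
by rewrite !normCE -rmorphM lecR.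
Qed.

Lemma is_deriveRP (g : R -> R) x (d : R) :
  is_derive x 1 g d <->
  (forall e : R, 0 < e -> exists2 r : R, 0 < r &
    forall h : R, `|h| < r -> `|g (x + h) - g x - h * d| <= e * `|h|).
Proof. exact: (@is_derive1P R (g : R^o -> R^o) x d). Qed.

(** The direction u is horizontal or vertical, and the factor c = 1 or c = - i
    selects the real or the imaginary part. *)
Lemma is_derive_line f s D (u c : CC R) x :
  is_derive (s + x%:C%C * u) 1 f D ->
  is_derive x 1 (fun y : R => complex.Re (c * f (s + y%:C%C * u)))
    (complex.Re (c * (D * u))).
Proof.
move=> /is_deriveCP h; apply/is_deriveRP => e e0.
pose m := cabs u + 1; have m0 : 0 < m by rewrite ltr_wpDl ?cabs_ge0.
pose k := cabs c + 1; have k0 : 0 < k by rewrite ltr_wpDl ?cabs_ge0.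
have um : cabs u <= m by rewrite lerDl.
have [r r0 hr] := h (e / (m * k)) (divr_gt0 e0 (mulr_gt0 m0 k0)).
exists (r / m); first exact: divr_gt0.
move=> y yr; have yu : cabs (y%:C%C * u) <= `|y| * m.
  by rewrite cabsM cabs_real ler_wpM2l.
have := hr (y%:C%C * u).
rewrite (le_lt_trans yu) -?ltr_pdivlMr// => /(_ isT) h1.
have -> : complex.Re (c * f (s + (x + y)%:C%C * u)) -
    complex.Re (c * f (s + x%:C%C * u)) - y * complex.Re (c * (D * u)) =
    complex.Re (c * (f (s + x%:C%C * u + y%:C%C * u) - f (s + x%:C%C * u) -
                y%:C%C * u * D)).
  rewrite rmorphD/= mulrDl addrA !mulrBr !ReB; congr (_ - _ - _).
  rewrite (_ : c * (_ * u * D) = y%:C%C * (c * (D * u))); last by ring.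
  by rewrite [in RHS]ReM /= mul0r subr0.
apply: (le_trans (Re_le_cabs _)); rewrite cabsM.
apply: (@le_trans _ _ (k * (e / (m * k) * (`|y| * m)))).
  apply: ler_pM; rewrite ?cabs_ge0 ?lerDl//; apply: (le_trans h1).
  by rewrite ler_wpM2l// ltW// divr_gt0// mulr_gt0.
by rewrite le_eqVlt; apply/orP; left; apply/eqP; field; rewrite !gt_eqF.
Qed.

Definition cpt x t : CC R := (x +i* t)%C.

Lemma cplx_hE x t : cpt x t = cpt 0 t + x%:C%C * 1.
Proof. by apply: eq_ReIm; rewrite ?ReD ?ImD ?ReM ?ImM/=; ring. Qed.

Lemma cplx_vE x t : cpt x t = x%:C%C + t%:C%C * 'i%C.
Proof. by apply: eq_ReIm; rewrite ?ReD ?ImD ?ReM ?ImM/=; ring. Qed.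

Lemma is_derive_hRe f D x t : is_derive (cpt x t) 1 f D ->
  is_derive x 1 (fun y => complex.Re (f (cpt y t))) (complex.Re D).
Proof.
rewrite cplx_hE => /(@is_derive_line _ _ _ _ 1).
rewrite mulr1 mul1r; congr (is_derive _ _ _ _); apply/funext => y.
by rewrite mul1r -cplx_hE.
Qed.

Lemma is_derive_hIm f D x t : is_derive (cpt x t) 1 f D ->
  is_derive x 1 (fun y => complex.Im (f (cpt y t))) (complex.Im D).
Proof.
rewrite cplx_hE => /(@is_derive_line _ _ _ _ (- 'i%C)).
rewrite mulr1 ReM /= mulN1r opprK oppr0 mul0r add0r.
congr (is_derive _ _ _ _); apply/funext => y.
by rewrite ReM /= mulN1r opprK oppr0 mul0r add0r -cplx_hE.
Qed.

Lemma is_derive_vRe f D x t : is_derive (cpt x t) 1 f D ->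
  is_derive t 1 (fun y => complex.Re (f (cpt x y))) (- complex.Im D).
Proof.
rewrite cplx_vE => /(@is_derive_line _ _ _ _ 1).
rewrite mul1r ReM /= mulr0 mulr1 add0r.
by congr (is_derive _ _ _ _); apply/funext => y; rewrite mul1r -cplx_vE.
Qed.

Lemma is_derive_vIm f D x t : is_derive (cpt x t) 1 f D ->
  is_derive t 1 (fun y => complex.Im (f (cpt x y))) (complex.Re D).
Proof.
rewrite cplx_vE => /(@is_derive_line _ _ _ _ (- 'i%C)).
rewrite ReM ImM /= mulr1 mulr0 addr0 oppr0 mul0r add0r mulN1r opprK.
congr (is_derive _ _ _ _); apply/funext => y.
by rewrite ReM /= mulN1r opprK oppr0 mul0r add0r -cplx_vE.
Qed.

Lemma lipschitz_segment (g g' : R -> R) (a b L : R) :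
  (forall y, Num.min a b <= y <= Num.max a b ->
     is_derive y 1 g (g' y) /\ `|g' y| <= L) -> `|g b - g a| <= L * `|b - a|.
Proof.
have H (u v : R) : u <= v ->
    (forall y : R, u <= y <= v -> is_derive y 1 g (g' y) /\ `|g' y| <= L) ->
    `|g v - g u| <= L * `|v - u|.
  move=> uv h.
  have [||c c1 ->] := @MVT_segment _ g g' u v uv.
  - by move=> y; rewrite in_itv/= => /andP[uy yv]; apply: (h y _).1; rewrite !ltW.
  - apply: continuous_in_subspaceT => y; rewrite inE/= in_itv/= => hy.
    apply/differentiable_continuous/derivable1_diffP.
    by have [[]] := h y hy.
  rewrite normrM ler_wpM2r//; apply: (h c _).2.
  by move: c1; rewrite in_itv.
move=> h; case: (leP a b) h => [ab|/ltW ab] h; first exact: H.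
by rewrite distrC (distrC b); exact: H.
Qed.

End ComplexDerivative.

Section ContourShift.
Variable R : realType.
Notation mu := (@lebesgue_measure R).

Lemma derive_continuous (F : R -> R) (x d : R) : is_derive x 1 F d ->
  {for x, continuous F}.
Proof. by case=> + _ => /derivable1_diffP/differentiable_continuous. Qed.

Lemma continuous_integrable (q : R -> R) (a b : R) : continuous q ->
  mu.-integrable `[a, b] (EFin \o q).
Proof.
move=> cq; apply: continuous_compact_integrable; first exact: segment_compact.
exact: continuous_subspaceT.
Qed.

Lemma Rintegral_FTC (F q : R -> R) (a b : R) : a < b -> continuous q ->
  (forall x, a <= x <= b -> is_derive x 1 F (q x)) ->
  \int[mu]_(x in `[a, b]) q x = F b - F a.
Proof.
move=> ab cq dF.
rewrite /Rintegral (@continuous_FTC2 _ q F)//.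
- exact: continuous_subspaceT.
- split.
  + move=> x; rewrite in_itv/= => /andP[ax xb].
    by have [] : is_derive x 1 F (q x) by apply: dF; rewrite !ltW.
  + apply: cvg_at_right_filter.
    by apply: (@derive_continuous _ _ (q a)); apply: dF; rewrite lexx ltW.
  + apply: cvg_at_left_filter.
    by apply: (@derive_continuous _ _ (q b)); apply: dF; rewrite lexx ltW.
- move=> x; rewrite in_itv/= => /andP[ax xb].
  have [_ <-] : is_derive x 1 F (q x) by apply: dF; rewrite !ltW.
  by rewrite derive1E.
Qed.

(** The vertical difference quotient of a holomorphic function, integrated over a
    vertical segment, is the difference quotient of such a window integral. *)
Lemma is_derive_shift_int (q : R -> R) (T : R) : 0 < T -> continuous q ->
  is_derive (0 : R) 1 (fun h => \int[mu]_(t in `[- T, T]) q (t + h)) (q T - q (- T)).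
Proof.
move=> T0 cq; pose a := - (T + 2).
pose G y := \int[mu]_(t in `[a, y]) q t.
have dG y : a < y -> is_derive y 1 G (q y).
  move=> ay; have yy1 : y < y + 1 by rewrite ltrDl.
  have [h1 h2] := continuous_FTC1_closed yy1 (continuous_integrable a (y + 1) cq) ay (cq y).
  apply: DeriveDef; first exact: h1.
  by rewrite -derive1E; exact: h2.
have cqs h : continuous (fun t => q (t + h)).
  move=> t; apply: (@continuous_comp _ _ _ (fun t => t + h) q); last exact: cq.
  by apply: cvgD; [exact: cvg_id|exact: cvg_cst].
have IE h : `|h| < 1 -> \int[mu]_(t in `[- T, T]) q (t + h) = G (T + h) - G (- T + h).
  move=> h1; have [hl hr] : - 1 < h /\ h < 1 by split; move: h1; rewrite ltr_norml => /andP[].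
  have TT : - T < T by lra.
  apply: (Rintegral_FTC TT (cqs h) (F := fun t => G (t + h))) => x /andP[x1 x2].
  have xh : a < x + h by rewrite /a; lra.
  have -> : q (x + h) = q (x + h) * 1 by rewrite mulr1.
  apply: (@is_derive1_comp _ G (fun t => t + h)); first exact: dG.
  by apply: is_derive_eq; rewrite addr0.
have /is_deriveRP d1 : is_derive T 1 G (q T) by apply: dG; rewrite /a; lra.
have /is_deriveRP d2 : is_derive (- T) 1 G (q (- T)) by apply: dG; rewrite /a; lra.
clearbody G; apply/is_deriveRP => e e0; have e2 : 0 < e / 2 by rewrite divr_gt0.
have [r1 r10 h1] := d1 _ e2; have [r2 r20 h2] := d2 _ e2.
exists (Num.min 1 (Num.min r1 r2)); first by rewrite !lt_min ltr01 r10.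
move=> h; rewrite !lt_min => /and3P[hh hr1 hr2].
rewrite add0r IE// IE ?normr0// !addr0.
rewrite (_ : _ - _ = (G (T + h) - G T - h * q T) - (G (- T + h) - G (- T) - h * q (- T)));
  last by ring.
apply: (le_trans (ler_normB _ _)).
rewrite [e]splitr mulrDl; apply: lerD; [exact: h1|exact: h2].
Qed.

Let is_derive_add_error (P H : R -> R) (x d : R) :
  is_derive (0 : R) 1 (fun h => P (x + h) - H h) 0 -> is_derive (0 : R) 1 H d ->
  is_derive x 1 P d.
Proof.
move=> dPH dH; apply/is_deriveRP => e e0; have e2 : 0 < e / 2 by rewrite divr_gt0.
have /is_deriveRP/(_ _ e2)[r1 r10 h1] := dPH.
have /is_deriveRP/(_ _ e2)[r2 r20 h2] := dH.
exists (Num.min r1 r2); first by rewrite lt_min r10.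
move=> h; rewrite lt_min => /andP[/h1 k1 /h2 k2].
rewrite !add0r mulr0 subr0 addr0 in k1; rewrite add0r in k2.
rewrite (_ : _ - _ - _ = (P (x + h) - H h - (P x - H 0)) + (H h - H 0 - h * d));
  last by ring.
apply: (le_trans (ler_normD _ _)).
by rewrite [e]splitr mulrDl; exact: lerD.
Qed.

Variables (f f' : CC R -> CC R) (lo hi T L : R).
Hypothesis T0 : 0 < T.
Hypothesis df : forall x t, lo < x < hi -> is_derive (cpt x t) 1 f (f' (cpt x t)).
Hypothesis bf : forall x t, lo < x < hi -> `|t| <= T + 1 ->
  cabs (f' (cpt x t)) <= L.

Let p x t := complex.Re (f (cpt x t)).
Let q x t := complex.Im (f (cpt x t)).

Let cp x : lo < x < hi -> continuous (p x).
Proof. by move=> hx t; apply: derive_continuous (is_derive_vRe (df t hx)). Qed.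

Let cq x : lo < x < hi -> continuous (q x).
Proof. by move=> hx t; apply: derive_continuous (is_derive_vIm (df t hx)). Qed.

(** The horizontal and vertical difference quotients have the same limit by the
    Cauchy-Riemann equations and are dominated by the bound on the derivative;
    the integrated vertical quotient tends to the boundary terms. *)
Lemma is_derive_vertical_int x : lo < x < hi ->
  is_derive x 1 (fun y => \int[mu]_(t in `[- T, T]) p y t) (q x T - q x (- T)).
Proof.
move=> hx; have /andP[lox xhi] := hx.
pose P y := \int[mu]_(t in `[- T, T]) p y t.
pose H h := \int[mu]_(t in `[- T, T]) q x (t + h).
have dH := is_derive_shift_int T0 (cq hx).
have : is_derive (0 : R) 1 (fun h => P (x + h) - H h) 0.
  have cv : h^-1 *: (((fun h => P (x + h) - H h) \o shift 0) (h *: (1:R)) -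
      (P (x + 0) - H 0)) @[h --> (0 : R)^'] --> (0 : R).
    apply/cvgr_dnbhsP => u [uN0 u0].
    pose r := Num.min 1 (Num.min (x - lo) (hi - x)).
    have r0 : 0 < r by rewrite !lt_min ltr01 !subr_gt0 lox.
    have [N _ hN] : \forall n \near \oo, `|u n| < r.
      have /cvgrPdist_lt/(_ _ r0) := u0.
      by apply: filterS => n; rewrite sub0r normrN.
    rewrite -(cvg_shiftn N); set v := fun n => u (n + N)%N.
    have vN0 n : v n != 0 by exact: uN0.
    have v0 : v @ \oo --> 0 by rewrite /v (cvg_shiftn N).
    have vr n : `|v n| < r by apply: hN; rewrite /= leq_addl.
    have v1 n : `|v n| < 1 by move: (vr n); rewrite !lt_min => /and3P[].
    have xv n : lo < x + v n < hi.
      move: (vr n); rewrite !lt_min => /and3P[_ ].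
      by rewrite !ltr_norml => /andP[? ?] /andP[? ?]; apply/andP; split; lra.
    have cqs h : continuous (fun t => q x (t + h)).
      move=> t; apply: (@continuous_comp _ _ _ (fun t => t + h) (q x)); last exact: cq.
      by apply: cvgD; [exact: cvg_id|exact: cvg_cst].
    pose D n t := (v n)^-1 * ((p (x + v n) t - p x t) - (q x (t + v n) - q x t)).
    have cD n : continuous (D n).
      move=> t; apply: cvgM; first exact: cvg_cst.
      apply: cvgB; apply: cvgB; [exact: cp|exact: cp| |exact: cq].
      exact: (cqs (v n)).
    have DE n : (v n)^-1 *: (((fun h => P (x + h) - H h) \o shift 0) (v n *: (1:R)) -
        (P (x + 0) - H 0)) = \int[mu]_(t in `[- T, T]) D n t.
      rewrite /D RintegralZl//; last first.
        apply: continuous_integrable => t; apply: cvgB; apply: cvgB;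
          [exact: cp|exact: cp|exact: (cqs (v n))|exact: cq].
      rewrite RintegralB//; last 2 first.
      - by apply: continuous_integrable => t; apply: cvgB; exact: cp.
      - by apply: continuous_integrable => t; apply: cvgB; [exact: (cqs (v n))|exact: cq].
      rewrite RintegralB//; last 2 first.
      - by apply: continuous_integrable; exact: cp.
      - by apply: continuous_integrable; exact: cp.
      rewrite RintegralB//; last 2 first.
      - by apply: continuous_integrable; exact: cqs.
      - by apply: continuous_integrable; exact: cq.
      have H0 : H 0 = \int[mu]_(t in `[- T, T]) q x t.
        by apply: eq_Rintegral => t _; rewrite addr0.
      rewrite /GRing.scale/= mulr1 !addr0 H0.
      by congr (_ * _); rewrite /P /H; ring.
    under eq_fun do rewrite DE.
    have : (\int[mu]_(t in `[(- T)%R, T]) (EFin \o D n) t)%E @[n --> \oo] -->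
        (\int[mu]_(t in `[(- T)%R, T]) (cst 0%E : R -> \bar R) t)%E.
      apply: (@dominated_cvg _ _ _ _ _ _ _ _ (cst (L + L)%:E)) => //.
      - by move=> n; case/integrableP: (continuous_integrable (- T) T (cD n)).
      - move=> t _; apply: cvg_EFin; first by near=> n.
        rewrite /=; apply/cvgrPdist_le => e e0.
        have e2 : 0 < e / 2 by rewrite divr_gt0.
        have /is_deriveRP/(_ _ e2)[r1 r10 h1] := is_derive_hRe (df t hx).
        have /is_deriveRP/(_ _ e2)[r2 r20 h2] := is_derive_vIm (df t hx).
        have /cvgrPdist_lt/(_ (Num.min r1 r2)) := v0.
        rewrite lt_min r10 => /(_ r20); apply: filterS => n.
        rewrite sub0r normrN lt_min => /andP[/h1 k1 /h2 k2].
        rewrite sub0r normrN /D normrM normfV -ler_pdivlMl ?invr_gt0 ?normr_gt0// invrK.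
        rewrite (_ : _ - _ - _ = (p (x + v n) t - p x t - v n * complex.Re (f' (cpt x t))) -
          (q x (t + v n) - q x t - v n * complex.Re (f' (cpt x t)))); last by ring.
        apply: (le_trans (ler_normB _ _)); rewrite [leRHS]mulrC [e]splitr mulrDl.
        by apply: lerD.
      - by apply: (@continuous_integrable (cst (L + L))) => ?; exact: cvg_cst.
      - move=> n t /=; rewrite in_itv/= => tT.
        have tT1 : `|t| <= T by rewrite ler_norml.
        rewrite lee_fin /D normrM normfV.
        rewrite -ler_pdivlMl ?invr_gt0 ?normr_gt0// invrK mulrDr.
        apply: (le_trans (ler_normB _ _)).
        rewrite mulrC; apply: lerD.
          have := @lipschitz_segment _ (fun y => p y t)
            (fun y => complex.Re (f' (cpt y t))) x (x + v n) L.
          rewrite [X in _ <= _ * `|X|]addrAC subrr add0r; apply=> y.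
          move=> hy.
          have hy' : lo < y < hi.
            move: (xv n) hy; rewrite minEle maxEle; case: ifP => _ /andP[? ?] /andP[? ?];
            by apply/andP; split; lra.
          split; first exact: is_derive_hRe (df t hy').
          apply: (le_trans (Re_le_cabs _)); apply: bf => //.
          by rewrite (le_trans tT1)// lerDl.
        have := @lipschitz_segment _ (q x)
          (fun y => complex.Re (f' (cpt x y))) t (t + v n) L.
        rewrite (_ : t + v n - t = v n); last by rewrite addrAC subrr add0r.
        apply=> y hy.
        split; first exact: is_derive_vIm (df y hx).
        apply: (le_trans (Re_le_cabs _)); apply: bf => //.
        have := v1 n; rewrite ltr_norml => /andP[? ?].
        move: tT hy; rewrite ler_norml minEle maxEle; case: ifP => _ /andP[? ?] /andP[? ?];
        by apply/andP; split; lra.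
    rewrite integral_cst//= mul0e => /fine_cvgP[_].
    by rewrite /= /Rintegral.
  apply: DeriveDef; first by apply/cvg_ex; exists 0.
  exact: cvg_lim cv.
by move=> dPH; exact: is_derive_add_error dPH dH.
Unshelve. all: by end_near. Qed.

(** Cauchy's theorem for the rectangle with sides on the abscissas x0, x1 and the
    ordinates -T, T: the vertical integrals differ by the horizontal ones. Only
    the bound by the values on the horizontal sides is kept, so no line integral
    along them is needed. *)
Lemma contour_shift (x0 x1 E : R) : lo < x0 < hi -> lo < x1 < hi ->
  (forall x, Num.min x0 x1 <= x <= Num.max x0 x1 ->
     cabs (f (cpt x T)) <= E /\ cabs (f (cpt x (- T))) <= E) ->
  `|\int[mu]_(t in `[- T, T]) complex.Re (f (cpt x1 t)) -
    \int[mu]_(t in `[- T, T]) complex.Re (f (cpt x0 t))| <= (E + E) * `|x1 - x0|.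
Proof.
move=> hx0 hx1 hE.
apply: (@lipschitz_segment _ (fun y => \int[mu]_(t in `[- T, T]) p y t)
  (fun x => q x T - q x (- T))) => y hy; split.
  apply: is_derive_vertical_int.
  move: hy hx0 hx1; rewrite minEle maxEle; case: ifP => _ /andP[y1 y2] /andP[y3 y4] /andP[y5 y6].
    by rewrite (lt_le_trans y3 y1) (le_lt_trans y2 y6).
  by rewrite (lt_le_trans y5 y1) (le_lt_trans y2 y4).
have [h1 h2] := hE y hy.
apply: (le_trans (ler_normB _ _)); apply: lerD.
  exact: le_trans (Im_le_cabs _) h1.
exact: le_trans (Im_le_cabs _) h2.
Qed.

End ContourShift.

(** * Sums over integers with prime factors in a finite set *)

Section SmoothSums.
Variable R : realType.

Definition smooth (P : seq nat) (n : nat) := all (fun p => p \in P) (primes n).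

(** The numbers built from P and one more prime p are those built from P, and p
    times themselves, so the sum over them exceeds the former by the factor
    1 / (1 - p ^- e). *)
Lemma smooth_sum_bounded (P : seq nat) (e : R) : 0 < e -> all prime P ->
  exists S : R, forall N,
    \sum_(1 <= n < N | smooth P n) n%:R `^ (- e) <= S.
Proof.
move=> e0; elim: P => [_|p P ih /andP[pp /ih [S hS]]].
  exists 1 => N.
  have sm1 n : (0 < n)%N -> smooth [::] n -> n = 1%N.
    rewrite /smooth; have [//|n1 _] := leqP n 1; first by case: n => [//|[]].
    move=> /allP/(_ (pdiv n)); rewrite mem_primes pdiv_prime// pdiv_dvd.
    by rewrite (ltnW n1)/= => /(_ isT).
  have [N1|N1] := leqP N 1; first by rewrite big_geq ?ler01.
  rewrite big_ltn_cond//= powR1 big_nat_cond big1 ?addr0 ?lexx//.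
  move=> n /andP[/andP[n2 _] sn]; move: n2.
  have [n0|n0] := posnP n; first by rewrite n0.
  by rewrite (sm1 n n0 sn).
have p1 : (1 < p)%N := prime_gt1 pp.
have p0 : (0 < p)%N := ltnW p1.
pose x N := \sum_(1 <= n < N | smooth (p :: P) n) n%:R `^ (- e) : R.
pose c : R := p%:R `^ (- e).
have c1 : c < 1.
  rewrite /c powRN invf_lt1 ?powR_gt0 ?ltr0n//.
  have := @gt0_ltr_powR _ e e0 1 p%:R; rewrite !nnegrE ler01 ler0n powR1.
  by apply => //; rewrite ltr1n.
(* the n prime to p are built from P, the others are p times an n *)
have key N : x N <= S + c * x N.
  rewrite {1}/x (bigID (fun n => ~~ (p %| n)%N))/=; apply: lerD.
    apply: le_trans (hS N); apply: ler_sum_nn => [n|n /andP[sn pn]].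
      exact: powR_ge0.
    apply/allP => q hq; move/allP: sn => /(_ _ hq).
    rewrite inE => /orP[/eqP qp|//]; move: hq pn.
    by rewrite mem_primes qp => /and3P[_ _ ->].
  rewrite -big_filter mulr_sumr -[leRHS]big_filter.
  set A := [seq _ <- _ | _]; set B := [seq _ <- _ | _].
  have hA n : n \in A -> [/\ (0 < n)%N, (n < N)%N, smooth (p :: P) n & (p %| n)%N].
    by rewrite mem_filter mem_index_iota negbK => /andP[/andP[? ?] /andP[]].
  have -> : \sum_(n <- A) n%:R `^ (- e) =
      \sum_(m <- [seq (n %/ p)%N | n <- A]) c * m%:R `^ (- e) :> R.
    rewrite big_map big_seq [RHS]big_seq; apply: eq_bigr => n /hA[_ _ _ pn].
    by rewrite /c -powRM ?ler0n// -natrM mulnC divnK.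
  apply: ler_sum_subset.
  - rewrite map_inj_in_uniq ?filter_uniq ?iota_uniq//.
    move=> m n /hA[_ _ _ pm] /hA[_ _ _ pn] h.
    by rewrite -(divnK pm) -(divnK pn) h.
  - by rewrite filter_uniq ?iota_uniq.
  - move=> _ /mapP[n /hA[n0 nN sn pn] ->]; rewrite mem_filter mem_index_iota.
    have m0 : (0 < n %/ p)%N by rewrite divn_gt0// dvdn_leq.
    rewrite m0 (leq_ltn_trans (leq_div _ _) nN)/= andbT.
    apply/allP => q; rewrite mem_primes => /and3P[pq _ qm].
    move/allP: sn; apply; rewrite mem_primes pq n0/=.
    by rewrite -(divnK pn) dvdn_mulr.
  - by move=> m _; rewrite mulr_ge0 ?powR_ge0.
exists (S / (1 - c)) => N; rewrite ler_pdivlMr ?subr_gt0//.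
by rewrite mulrBr mulr1 lerBlDr mulrC key.
Qed.

Lemma among_first_primes_bounded d :
  exists B, forall p, among_first_primes d p -> (p < B)%N.
Proof.
have [B hB] : exists B, (d <= count prime (iota 0 B))%N.
  elim: d => [|d [B hB]]; first by exists 0%N.
  have [p Bp pp] := prime_above B; exists p.+1.
  rewrite -(addn1 p) iotaD count_cat /= add0n pp addn0 addn1 ltnS (leq_trans hB)//.
  by rewrite -(subnKC (ltnW Bp)) iotaD count_cat leq_addr.
exists B => p /andP[_ hp]; rewrite ltnNge; apply/negP => Bp.
move: hp; rewrite ltnNge (leq_trans hB)//.
by rewrite -(subnKC Bp) iotaD count_cat leq_addr.
Qed.

End SmoothSums.

(** * Dirichlet series in their half-plane of absolute convergence *)

Section DirichletSeries.
Variable R : realType.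
Implicit Types (f : CC R -> CC R) (s D : CC R) (x t : R) (b : nat -> CC R).

Lemma ccvgD (T : Type) (F : set_system T) {FF : Filter F} (f g : T -> CC R)
    (k l : CC R) : f @ F --> k -> g @ F --> l -> (f x + g x) @[x --> F] --> k + l.
Proof.
move=> /cvg_cabsP hf /cvg_cabsP hg; apply/cvg_cabsP => e e0.
have e2 : 0 < e / 2 by rewrite divr_gt0.
have := hf _ e2; have := hg _ e2; apply: filterS2 => x h1 h2.
rewrite opprD addrACA (le_lt_trans (cabsD _ _))// [e]splitr.
exact: ltrD.
Qed.

Lemma ccvgZ (T : Type) (F : set_system T) {FF : Filter F} (f : T -> CC R)
    (k c : CC R) : f @ F --> k -> (c * f x) @[x --> F] --> c * k.
Proof.
move=> /cvg_cabsP hf; apply/cvg_cabsP => e e0.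
have c0 : 0 < cabs c + 1 by rewrite ltr_wpDl ?cabs_ge0.
have := hf _ (divr_gt0 e0 c0); apply: filterS => x h.
rewrite -mulrBr cabsM; move: h; rewrite ltr_pdivlMr// mulrC; apply: le_lt_trans.
by rewrite ler_wpM2r ?cabs_ge0// lerDl.
Qed.

Arguments ccvgZ {T F FF f k} c.

Lemma ccvg_unique (T : Type) (F : set_system T) {FF : ProperFilter F} (f : T -> CC R)
    (k l : CC R) : f @ F --> k -> f @ F --> l -> k = l.
Proof.
move=> fk fl; apply/eqP; rewrite -subr_eq0; apply/eqP/cabs_eq0/eqP.
rewrite eq_le cabs_ge0 andbT.
have /(_ _ _) h := ccvgD fk (ccvgZ (- 1 : CC R) fl).
rewrite mulN1r in h; apply: (cabs_lim_le h); near=> x.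
by rewrite mulN1r subrr cabs0.
Unshelve. all: by end_near. Qed.

Lemma is_derive_quad f s D (C r : R) : 0 < r ->
  (forall h, cabs h < r -> cabs (f (s + h) - f s - h * D) <= C * cabs h ^+ 2) ->
  is_derive s 1 f D.
Proof.
move=> r0 hC; apply/is_deriveCP => e e0.
have c0 : 0 < `|C| + 1 by rewrite ltr_wpDl.
exists (Num.min r (e / (`|C| + 1))); first by rewrite lt_min r0 divr_gt0.
move=> h; rewrite lt_min => /andP[hr he]; apply: (le_trans (hC h hr)).
rewrite expr2 mulrA ler_wpM2r ?cabs_ge0//.
move: he; rewrite ltr_pdivlMr// mulrC => /ltW; apply: le_trans.
by rewrite ler_wpM2r ?cabs_ge0// (le_trans (ler_norm _))// lerDl.
Qed.

Lemma is_derive_cexp (k s : CC R) :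
  is_derive s 1 (fun s => cexp (k * s)) (k * cexp (k * s)).
Proof.
apply: (@is_derive_quad _ _ _ (cabs (cexp (k * s)) * (4 * cabs k ^+ 2 * expR (cabs k))) 1) => //.
move=> h h1; rewrite mulrDr cexpD.
rewrite (_ : _ - _ - _ = cexp (k * s) * (cexp (k * h) - 1 - k * h)); last by ring.
rewrite cabsM -mulrA ler_wpM2l ?cabs_ge0//; apply: (le_trans (cexp_quad _)).
have -> : 4 * cabs (k * h) ^+ 2 * expR `|complex.Re (k * h)| =
  4 * cabs k ^+ 2 * expR `|complex.Re (k * h)| * cabs h ^+ 2.
  by rewrite cabsM; ring.
apply: ler_wpM2r; first exact: sqr_ge0.
apply: ler_wpM2l; first by rewrite mulr_ge0// sqr_ge0.
rewrite ler_expR; apply: (le_trans (Re_le_cabs _)); rewrite cabsM.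
by rewrite ler_piMr ?cabs_ge0// ltW.
Qed.

(** Absolute convergence at the abscissa x, as a bound on partial sums. *)
Definition dsummable b (x : R) :=
  exists S : R, forall N, \sum_(1 <= n < N) cabs (b n) * n%:R `^ (- x) <= S.

Lemma powR_nat_le n x y : (0 < n)%N -> x <= y -> n%:R `^ x <= n%:R `^ y :> R.
Proof. by move=> n0 xy; rewrite ler_powR// ler1n. Qed.

Lemma dsummable_le b x y : x <= y -> dsummable b x -> dsummable b y.
Proof.
move=> xy [S hS]; exists S => N; apply: le_trans (hS N).
apply: ler_sum_nat1 => n n0; rewrite ler_wpM2l ?cabs_ge0//.
by rewrite powR_nat_le// lerN2.
Qed.

Lemma cabs_dirichlet_term b n s :
  cabs (b n * npow n s) = cabs (b n) * n%:R `^ (- complex.Re s).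
Proof. by rewrite cabsM cabs_npow. Qed.

Lemma dirichlet_unique b s l : is_dirichlet b s l -> dirichlet b s = l.
Proof.
move=> h; apply: (ccvg_unique (F := \oo) _ h).
by apply/cvg_ex; exists l; exact: h.
Qed.

Lemma is_dirichletP b s x : dsummable b x -> x <= complex.Re s ->
  is_dirichlet b s (dirichlet b s).
Proof.
move=> /dsummable_le h /h [S hS].
have [l hl] : exists l : CC R, psum (fun n => b n * npow n s) @ \oo --> l.
  by apply: (@csum_cvg _ _ S) => N; under eq_bigr do rewrite cabs_dirichlet_term.
by rewrite (dirichlet_unique hl).
Qed.

Lemma dirichlet_le b s (S : R) :
  (forall N, \sum_(1 <= n < N) cabs (b n) * n%:R `^ (- complex.Re s) <= S) ->
  cabs (dirichlet b s) <= S.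
Proof.
move=> hS; have h : is_dirichlet b s (dirichlet b s).
  by apply: (@is_dirichletP _ _ (complex.Re s)) => //; exists S.
apply: (cabs_lim_le h); near=> N.
apply: le_trans (hS N); apply: (le_trans (cabs_sum _ _ _)).
by apply: ler_sum_nat1 => n _; rewrite cabs_dirichlet_term.
Unshelve. all: by end_near. Qed.

Lemma powR2_lt1 (x : R) : 0 < x -> 2 `^ (- x) < 1 :> R.
Proof.
move=> x0; rewrite powRN invf_lt1 ?powR_gt0//.
have := gt0_ltr_powR x0; move=> /(_ 1 2); rewrite !nnegrE powR1; apply => //.
by rewrite ltr1n.
Qed.

Lemma ln_le_powR n (e : R) : (0 < n)%N -> 0 < e -> ln n%:R <= n%:R `^ e / e.
Proof.
move=> n0 e0; rewrite ler_pdivlMr// mulrC -ln_powR.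
by rewrite ltW// ln_sublinear// powR_gt0// ltr0n.
Qed.

Lemma ln_nat_ge0 n : (0 : R) <= ln n%:R.
Proof. by case: n => [|n]; [rewrite ln0|rewrite ln_ge0// ler1n]. Qed.

Definition dlog b (n : nat) : CC R := (ln n%:R)%:C%C * b n.

Lemma dsummable_log b x y : x < y -> dsummable b x -> dsummable (dlog b) y.
Proof.
move=> xy [S hS]; have e0 : 0 < y - x by rewrite subr_gt0.
exists (S / (y - x)) => N; rewrite ler_pdivlMr// mulr_suml.
apply: le_trans (hS N); apply: ler_sum_nat1 => n n0.
rewrite /dlog cabsM cabs_real ger0_norm ?ln_nat_ge0//.
have -> : n%:R `^ (- x) = n%:R `^ (- y) * n%:R `^ (y - x) :> R.
  by rewrite -powRD ?addKr// pnatr_eq0 -lt0n n0 implybT.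
have := ln_le_powR n0 e0; rewrite ler_pdivlMr// => h.
rewrite mulrA (_ : _ * (y - x) = cabs (b n) * n%:R `^ (- y) * (ln n%:R * (y - x)));
  last by ring.
by apply: ler_wpM2l h; rewrite mulr_ge0 ?cabs_ge0 ?powR_ge0.
Qed.

(** The room between x and Re s is cut in three: two parts absorb the two factors
    log n of the quadratic remainder of n ^ -h, the third one absorbs h. *)
Lemma is_derive_dirichlet b s x : dsummable b x -> x < complex.Re s ->
  is_derive s 1 (dirichlet b) (- dirichlet (dlog b) s).
Proof.
move=> bx xs; pose e := (complex.Re s - x) / 3.
have e0 : 0 < e by rewrite divr_gt0// subr_gt0.
have [S hS] := bx.
apply: (@is_derive_quad _ _ _ (4 * S / e ^+ 2) e) => // h he.
have hs : x <= complex.Re (s + h).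
  rewrite ReD; have := le_lt_trans (Re_le_cabs h) he.
  rewrite ltr_norml => /andP[h1 _].
  have : complex.Re s - x = 3 * e by rewrite /e; field.
  by lra.
have h1 := is_dirichletP bx hs.
have h2 := is_dirichletP bx (ltW xs).
have h3 : is_dirichlet (dlog b) s (dirichlet (dlog b) s).
  by apply: (@is_dirichletP _ _ (complex.Re s)) => //; exact: dsummable_log bx.
pose z n := b n * npow n s * (npow n h - 1 + (ln n%:R)%:C%C * h).
have zl : psum z @ \oo --> dirichlet b (s + h) - dirichlet b s - h * - dirichlet (dlog b) s.
  rewrite mulrN opprK -(mulN1r (dirichlet b s)).
  have /(_ _ _ _ _) hl := ccvgD (ccvgD h1 (ccvgZ (- 1 : CC R) h2)) (ccvgZ h h3).
  suff -> : psum z = (fun N => dirichlet_psum b (s + h) N + -1 * dirichlet_psum b s N +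
    h * dirichlet_psum (dlog b) s N) by exact: hl.
  apply/funext => N; rewrite /psum /dirichlet_psum !mulr_sumr -!big_split/=.
  apply: eq_big_nat => n /andP[n1 _].
  by rewrite /z npowD// /dlog; ring.
apply: (cabs_lim_le zl); near=> N.
apply: (le_trans (cabs_sum _ _ _)).
apply: (@le_trans _ _ (\sum_(1 <= n < N) cabs (b n) * n%:R `^ (- x) * (4 / e ^+ 2 * cabs h ^+ 2))); last first.
  rewrite -mulr_suml (_ : 4 * S / e ^+ 2 * _ = S * (4 / e ^+ 2 * cabs h ^+ 2)); last by ring.
  by rewrite ler_wpM2r// ?mulr_ge0 ?invr_ge0 ?sqr_ge0 ?exprn_ge0 ?cabs_ge0// ltW.
apply: ler_sum_nat1 => n n0.
rewrite /z cabsM cabs_dirichlet_term -[leLHS]mulrA -[leRHS]mulrA.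
rewrite ler_wpM2l ?cabs_ge0//.
apply: (@le_trans _ _ (n%:R `^ (- complex.Re s) *
    (4 * ((n%:R `^ e / e) * cabs h) ^+ 2 * n%:R `^ e))).
  rewrite ler_wpM2l ?powR_ge0//; apply: (le_trans (npow_quad _ n0)).
  apply: ler_pM; rewrite ?powR_ge0//.
  - by rewrite mulr_ge0// sqr_ge0.
  - apply: ler_wpM2l => //; apply: lerXn2r; rewrite ?nnegrE.
    + by rewrite mulr_ge0 ?ln_nat_ge0 ?cabs_ge0.
    + by rewrite mulr_ge0 ?cabs_ge0// divr_ge0 ?powR_ge0// ltW.
    + by apply: ler_wpM2r; [exact: cabs_ge0|exact: ln_le_powR].
  - by rewrite powR_nat_le// (le_trans (Re_le_cabs _))// ltW.
have n0' : (n%:R : R) != 0 by rewrite pnatr_eq0 -lt0n.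
have -> : n%:R `^ (- x) = n%:R `^ (- complex.Re s) * n%:R `^ e * n%:R `^ e * n%:R `^ e.
  by rewrite -!powRD ?n0' ?implybT//; congr (_ `^ _); rewrite /e; field.
rewrite le_eqVlt; apply/orP; left; apply/eqP; field.
by rewrite gt_eqF.
Unshelve. all: by end_near. Qed.

(** Since sum n ^ -e converges for all e > 0 over the integers built from P, the
    growth of the coefficients alone decides on the abscissa of convergence. *)
Lemma dsummable_smooth (P : seq nat) b (K x y : R) : all prime P ->
  (forall n, (0 < n)%N -> b n != 0 -> smooth P n) ->
  (forall n, (0 < n)%N -> cabs (b n) <= K * n%:R `^ x) -> x < y ->
  dsummable b y.
Proof.
move=> pP bP bK xy; have e0 : 0 < y - x by rewrite subr_gt0.
have [S hS] := smooth_sum_bounded e0 pP.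
exists (`|K| * S) => N.
apply: (@le_trans _ _ (\sum_(1 <= n < N | smooth P n) `|K| * n%:R `^ (- (y - x)))); last first.
  by rewrite -mulr_sumr ler_wpM2l.
rewrite [leRHS]big_mkcond/=; apply: ler_sum_nat1 => n n0.
case: ifP => [sn|/negbT sn]; last first.
  have [->|/(bP n n0)] := eqVneq (b n) 0; first by rewrite cabs0 mul0r.
  by move=> sn'; rewrite sn' in sn.
have n0' : (n%:R : R) != 0 by rewrite pnatr_eq0 -lt0n.
have -> : n%:R `^ (- (y - x)) = n%:R `^ x * n%:R `^ (- y) :> R.
  by rewrite -powRD ?n0' ?implybT// opprB.
rewrite mulrA ler_wpM2r ?powR_ge0//; apply: (le_trans (bK n n0)).
by rewrite ler_wpM2r ?powR_ge0// ler_norm.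
Qed.

End DirichletSeries.

(** * Continuation of the series to the right half-plane *)

Section Extension.
Variable R : realType.
Notation mu := (@lebesgue_measure R).
Implicit Types (f : CC R -> CC R) (s D : CC R) (x t : R) (b : nat -> CC R).

Lemma is_deriveCM f h s D E : is_derive s 1 f D -> is_derive s 1 h E ->
  is_derive s 1 (fun s => f s * h s) (D * h s + f s * E).
Proof.
move=> df dh; have := @is_deriveM _ _ (f : R[i]^o -> R[i]^o) h s 1 D E df dh.
by rewrite addrC [h s *: D]mulrC.
Qed.

Lemma is_deriveCZ f (c s D : CC R) : is_derive s 1 f D ->
  is_derive s 1 (fun s => c * f s) (c * D).
Proof.
move=> /is_deriveCP h; apply/is_deriveCP => e e0.
have c0 : 0 < cabs c + 1 by rewrite ltr_wpDl ?cabs_ge0.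
have [r r0 hr] := h _ (divr_gt0 e0 c0); exists r => // k /hr hk.
rewrite (_ : _ - _ - _ = c * (f (s + k) - f s - k * D)); last by ring.
rewrite cabsM; apply: (@le_trans _ _ ((cabs c + 1) * (e / (cabs c + 1) * cabs k))).
  by apply: ler_pM; rewrite ?cabs_ge0 ?lerDl.
by rewrite mulrA mulrCA divff ?mulr1// gt_eqF.
Qed.

Lemma is_deriveCB f h s D E : is_derive s 1 f D -> is_derive s 1 h E ->
  is_derive s 1 (fun s => f s - h s) (D - E).
Proof.
move=> /is_deriveCP df /is_deriveCP dh; apply/is_deriveCP => e e0.
have e2 : 0 < e / 2 by rewrite divr_gt0.
have [r1 r10 h1] := df _ e2; have [r2 r20 h2] := dh _ e2.
exists (Num.min r1 r2); first by rewrite lt_min r10.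
move=> k; rewrite lt_min => /andP[/h1 k1 /h2 k2].
rewrite (_ : _ - _ - _ = (f (s + k) - f s - k * D) - (h (s + k) - h s - k * E)); last by ring.
by rewrite (le_trans (cabsB _ _))// [e]splitr mulrDl lerD.
Qed.

Lemma lipschitz_horizontal f f' (L x0 x1 t : R) :
  (forall x, Num.min x0 x1 <= x <= Num.max x0 x1 ->
    is_derive (cpt x t) 1 f (f' (cpt x t)) /\ cabs (f' (cpt x t)) <= L) ->
  cabs (f (cpt x1 t) - f (cpt x0 t)) <= (L + L) * `|x1 - x0|.
Proof.
move=> h; apply: (le_trans (cabs_le_ReIm _)); rewrite ReB ImB mulrDl; apply: lerD.
  apply: (@lipschitz_segment _ (fun x => complex.Re (f (cpt x t)))
    (fun x => complex.Re (f' (cpt x t)))) => y /h[h1 h2]; split.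
    exact: is_derive_hRe.
  exact: le_trans (Re_le_cabs _) h2.
apply: (@lipschitz_segment _ (fun x => complex.Im (f (cpt x t)))
  (fun x => complex.Im (f' (cpt x t)))) => y /h[h1 h2]; split.
  exact: is_derive_hIm.
exact: le_trans (Im_le_cabs _) h2.
Qed.

Lemma lipschitz_vertical f f' (L x t0 t1 : R) :
  (forall t, Num.min t0 t1 <= t <= Num.max t0 t1 ->
    is_derive (cpt x t) 1 f (f' (cpt x t)) /\ cabs (f' (cpt x t)) <= L) ->
  cabs (f (cpt x t1) - f (cpt x t0)) <= (L + L) * `|t1 - t0|.
Proof.
move=> h; apply: (le_trans (cabs_le_ReIm _)); rewrite ReB ImB mulrDl; apply: lerD.
  apply: (@lipschitz_segment _ (fun t => complex.Re (f (cpt x t)))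
    (fun t => - complex.Im (f' (cpt x t)))) => y /h[h1 h2]; split.
    exact: is_derive_vRe.
  by rewrite normrN; exact: le_trans (Im_le_cabs _) h2.
apply: (@lipschitz_segment _ (fun t => complex.Im (f (cpt x t)))
  (fun t => complex.Re (f' (cpt x t)))) => y /h[h1 h2]; split.
  exact: is_derive_vIm.
exact: le_trans (Re_le_cabs _) h2.
Qed.

(** On a vertical line, c * exp (l s) has the bounded primitive c * exp (l s) / l. *)
Lemma oscillation (c : CC R) (l x : R) : l != 0 ->
  exists K : R, forall T, 0 < T ->
   `|\int[mu]_(t in `[- T, T]) complex.Re (c * cexp (l%:C%C * cpt x t))| <= K.
Proof.
move=> l0; pose f s := (l^-1)%:C%C * c * cexp (l%:C%C * s) : CC R.
have df s : is_derive s 1 f (c * cexp (l%:C%C * s)).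
  have := is_deriveCZ ((l^-1)%:C%C * c) (is_derive_cexp l%:C%C s).
  congr (is_derive _ _ _ _).
  rewrite [_ * c]mulrC -mulrA; congr (_ * _); rewrite mulrA -rmorphM/= mulVf//.
  by rewrite mul1r.
pose B := cabs ((l^-1)%:C%C * c : CC R) * expR (l * x).
exists (B + B) => T T0.
have TT : - T < T by rewrite (lt_trans _ T0)// oppr_lt0.
have cq : continuous (fun t => complex.Re (c * cexp (l%:C%C * cpt x t))).
  move=> t; have d1 s := is_deriveCZ c (is_derive_cexp l%:C%C s).
  exact: derive_continuous (is_derive_vRe (d1 (cpt x t))).
have -> := Rintegral_FTC TT cq (fun t _ => is_derive_vIm (df (cpt x t))).
apply: (le_trans (ler_normB _ _)); apply: lerD; apply: (le_trans (Im_le_cabs _));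
by rewrite /f cabsM cabs_cexp ReM /= mul0r subr0.
Qed.

Lemma continuous_sum (I : Type) (r : seq I) (Q : pred I) (F : I -> R -> R) :
  (forall i, continuous (F i)) -> continuous (fun t => \sum_(i <- r | Q i) F i t).
Proof.
move=> cF; elim: r => [|i r ih].
  by under eq_fun do rewrite big_nil; move=> t; exact: cvg_cst.
under eq_fun do rewrite big_cons; case: (Q i) => // t.
by apply: cvgD; [exact: cF|exact: ih].
Qed.

Lemma Rintegral_sum (I : Type) (r : seq I) (Q : pred I) (F : I -> R -> R) (a c : R) :
  (forall i, continuous (F i)) ->
  \int[mu]_(t in `[a, c]) (\sum_(i <- r | Q i) F i t) =
  \sum_(i <- r | Q i) \int[mu]_(t in `[a, c]) F i t.
Proof.
move=> cF; elim: r => [|i r ih].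
  by under eq_Rintegral do rewrite big_nil; rewrite big_nil Rintegral_cst// mul0r.
rewrite big_cons; under eq_Rintegral do rewrite big_cons; case: (Q i) => //.
rewrite RintegralD//; first by rewrite ih.
  exact: continuous_integrable.
by apply: continuous_integrable; exact: continuous_sum.
Qed.

Lemma Rintegral_const (a c k : R) : a <= c ->
  \int[mu]_(t in `[a, c]) k = k * (c - a).
Proof.
move=> ac; rewrite Rintegral_cst// /= lebesgue_measure_itv/= lte_fin.
by move: ac; rewrite le_eqVlt => /orP[/eqP ->|->//]; rewrite ltxx subrr.
Qed.

Lemma small_of_linear (a c B : R) : (forall T, 0 < T -> T * a <= T * c + B) -> a <= c.
Proof.
move=> h; rewrite leNgt; apply/negP => ca.
have d0 : 0 < a - c by rewrite subr_gt0.
have T0 : 0 < (`|B| + 1) / (a - c) by rewrite divr_gt0// ltr_wpDl.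
have := h _ T0; rewrite -lerBlDl -mulrBr divfK ?gt_eqF// => h1.
by have := ler_norm B; lra.
Qed.

Lemma dirichlet_terms_bounded b s l : is_dirichlet b s l ->
  exists K : R, forall n, (0 < n)%N -> cabs (b n * npow n s) <= K.
Proof.
move=> /cvg_cabsP/(_ _ ltr01)[N _ hN].
pose B := cabs l + 1; pose S := \sum_(1 <= k < N) cabs (b k * npow k s).
have S0 : 0 <= S by rewrite sumr_ge0// => i _; exact: cabs_ge0.
exists (S + (B + B)) => n n0.
have [nN|Nn] := ltnP n N.
  apply: (@le_trans _ _ S); last by rewrite lerDl !addr_ge0 ?cabs_ge0.
  rewrite /S (bigD1_seq n) ?mem_index_iota ?n0 ?iota_uniq//=.
  by rewrite lerDl sumr_ge0// => i _; exact: cabs_ge0.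
have h k : (N <= k)%N -> cabs (dirichlet_psum b s k) <= B.
  move=> /hN/= h1; rewrite -[X in cabs X](subrK l) (le_trans (cabsD _ _))//.
  by rewrite addrC lerD2l cabsC ltW.
apply: (@le_trans _ _ (B + B)); last by rewrite lerDr.
have -> : b n * npow n s = dirichlet_psum b s n.+1 - dirichlet_psum b s n.
  by rewrite /dirichlet_psum big_nat_recr//= addrAC subrr add0r.
apply: (le_trans (cabsB _ _)); apply: lerD; apply: h => //.
exact: leq_trans Nn _.
Qed.

Section Coefficients.
Variables (P : seq nat) (g : CC R -> CC R) (M theta : R) (b : nat -> CC R).
Hypothesis pP : all prime P.
Hypothesis dg : forall s, 0 < complex.Re s -> derivable g s 1.
Hypothesis bg : forall s, 0 < complex.Re s -> complex.Re s * cabs ('D_1 g s) <= M.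
Hypothesis sb : forall n, (0 < n)%N -> b n != 0 -> smooth P n.
Hypothesis hb : forall s, theta < complex.Re s -> is_dirichlet b s (g s).

Let dgE s : 0 < complex.Re s -> is_derive s 1 g ('D_1 g s).
Proof. by move=> s0; apply: DeriveDef => //; exact: dg. Qed.

(** Convergence somewhere bounds the terms there, hence gives polynomial growth
    of the coefficients. *)
Lemma initial_summable : exists x, [/\ 0 < x, theta < x & dsummable b x].
Proof.
pose x0 := Num.max theta 0 + 1.
have [hx0 hx1] : theta < x0 /\ 0 < x0.
  by split; rewrite /x0 ltr_pwDr// le_max lexx ?orbT.
have [K hK] : exists K : R, forall n, (0 < n)%N -> cabs (b n * npow n (cpt x0 0)) <= K.
  by apply: dirichlet_terms_bounded; exact: hb.
exists (x0 + 1); split; [lra|lra|].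
have xx : x0 < x0 + 1 by rewrite ltrDl.
apply: (@dsummable_smooth _ P b K x0) => // n n0.
have n0' : (n%:R : R) != 0 by rewrite pnatr_eq0 -lt0n.
have := hK n n0; rewrite cabs_dirichlet_term/= powRN ler_pdivrMr//.
by rewrite powR_gt0// ltr0n.
Qed.

Lemma M_ge0 : 0 <= M.
Proof. by apply: le_trans (bg (s := 1) _) => //=; rewrite mulr_ge0 ?cabs_ge0. Qed.

Lemma derive_le (e : R) s : 0 < e -> e <= complex.Re s -> cabs ('D_1 g s) <= M / e.
Proof.
move=> e0 es; have s0 := lt_le_trans e0 es.
rewrite ler_pdivlMr// mulrC; apply: le_trans (bg s0).
by rewrite ler_wpM2r ?cabs_ge0.
Qed.

(** Integrating the Bloch bound horizontally from an abscissa where the series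
    converges absolutely bounds g on closed strips. *)
Lemma strip_bounded (e x1 : R) : 0 < e -> theta < x1 -> 0 < x1 -> dsummable b x1 ->
  exists2 G : R, 0 <= G & forall s, e <= complex.Re s -> complex.Re s <= x1 + 1 ->
    cabs (g s) <= G.
Proof.
move=> e0 tx1 x10 [S hS].
have [e' [e'0 e'e e'x]] : exists e', [/\ 0 < e', e' <= e & e' <= x1].
  by exists (Num.min e x1); split; rewrite ?lt_min ?e0// ge_min lexx ?orbT.
have M0 := M_ge0; have Me0 : 0 <= M / e' by rewrite divr_ge0// ltW.
have S0 : 0 <= S by have := hS 0%N; rewrite big_geq.
pose G := S + (M / e' + M / e') * (x1 + 1).
have G0 : 0 <= G by rewrite addr_ge0// mulr_ge0 ?addr_ge0// ltW.
exists G => // -[x t]/= ex xx1.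
have gx1 : cabs (g (cpt x1 t)) <= S.
  have := hb (s := cpt x1 t) tx1 => /dirichlet_unique <-.
  by apply: dirichlet_le.
rewrite -[X in cabs X](subrK (g (cpt x1 t))) (le_trans (cabsD _ _))// addrC.
apply: lerD => //; apply: (@le_trans _ _ ((M / e' + M / e') * `|x - x1|)).
  apply: (@lipschitz_horizontal g ('D_1 g)) => y /andP[y1 _].
  have ey : e' <= y by apply: le_trans y1; rewrite le_min e'x (le_trans e'e).
  split; first by apply: dgE => /=; exact: lt_le_trans ey.
  exact: derive_le.
rewrite ler_wpM2l ?addr_ge0// ler_norml; apply/andP; split; lra.
Qed.

(** The coefficient of index m is the mean of g(s) m ^ s over a far vertical
    line. Moving the line to the left changes the integral over a segment of
    length 2T by a bounded amount, hence does not change the mean. *)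
Lemma coef_bound (e : R) : 0 < e ->
  exists K : R, forall m, (0 < m)%N -> cabs (b m) <= K * m%:R `^ e.
Proof.
move=> e0; have [x1 [x10 tx1 bx1]] := initial_summable.
have e20 : 0 < e / 2 by rewrite divr_gt0.
have [G G0 hG] := strip_bounded e20 tx1 x10 bx1.
have [xle|elx] := leP x1 e.
  have [S hS] := dsummable_le xle bx1; exists S => m m0.
  have := hS m.+1; rewrite big_nat_recr//= => h.
  rewrite -ler_pdivrMr ?powR_gt0// ?ltr0n// -powRN; apply: le_trans h.
  by rewrite lerDr sumr_ge0// => i _; rewrite mulr_ge0 ?cabs_ge0 ?powR_ge0.
exists G => m m0; have m0' : (m%:R : R) != 0 by rewrite pnatr_eq0 -lt0n.
apply/ler_addgt0Pl => eta eta0.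
have lm0 := ln_nat_ge0 R m.
have [u u1 ub] := cabs_rot (b m).
pose k : CC R := (ln m%:R)%:C%C.
pose f s : CC R := u * (g s * cexp (k * s)).
pose f' s : CC R := u * ('D_1 g s * cexp (k * s) + g s * (k * cexp (k * s))).
have df x t : e / 2 < x < x1 + 1 -> is_derive (cpt x t) 1 f (f' (cpt x t)).
  move=> /andP[h1 h2]; apply: is_deriveCZ; apply: is_deriveCM.
    by apply: dgE => /=; exact: lt_trans h1.
  exact: is_derive_cexp.
have cE s : cabs (cexp (k * s)) = m%:R `^ complex.Re s.
  by rewrite cabs_cexp ReM/= mul0r subr0 /powR (negPf m0') mulrC.
have cEle s : complex.Re s <= x1 + 1 -> cabs (cexp (k * s)) <= m%:R `^ (x1 + 1).
  by move=> hs; rewrite cE powR_nat_le.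
pose W : R := m%:R `^ (x1 + 1).
have W0 : 0 <= W by exact: powR_ge0.
pose L := M / (e / 2) * W + G * (ln m%:R * W).
have bf T x t : e / 2 < x < x1 + 1 -> `|t| <= T + 1 -> cabs (f' (cpt x t)) <= L.
  move=> /andP[/ltW h1 /ltW h2] _; rewrite /f' cabsM u1 mul1r.
  apply: (le_trans (cabsD _ _)); apply: lerD; rewrite cabsM.
    by apply: ler_pM; rewrite ?cabs_ge0//; [exact: derive_le|exact: cEle].
  apply: ler_pM; rewrite ?cabs_ge0//; first exact: hG.
  by rewrite cabsM cabs_real ger0_norm// ler_wpM2l//; exact: cEle.
have fE x t : e / 2 <= x -> x <= x1 + 1 -> cabs (f (cpt x t)) <= G * m%:R `^ x.
  move=> h1 h2; rewrite /f cabsM u1 mul1r cabsM cE.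
  by rewrite ler_wpM2r ?powR_ge0// hG.
have [S hS] := bx1.
have em0 : 0 < eta / m%:R `^ x1 by rewrite divr_gt0// powR_gt0// ltr0n.
have [N N0 hN] := small_tail
  (fun n => mulr_ge0 (cabs_ge0 (b n)) (powR_ge0 n%:R (- x1))) em0 hS.
pose N' := maxn N m.+1.
(* the other frequencies contribute a bounded amount to the integral *)
have osc n : exists K : R, (0 < n)%N && (n != m) -> forall T, 0 < T ->
   `|\int[mu]_(t in `[- T, T])
      complex.Re (u * b n * cexp ((ln m%:R - ln n%:R)%:C%C * cpt x1 t))| <= K.
  have [/andP[n0 nm]|] := boolP ((0 < n)%N && (n != m)); last by exists 0.
  have l0 : ln m%:R - ln n%:R != 0 :> R.
    rewrite subr_eq0; apply: contra nm => /eqP/ln_inj.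
    by rewrite !posrE !ltr0n => /(_ m0 n0)/eqP; rewrite eqr_nat eq_sym.
  by have [K hK] := oscillation (u * b n) x1 l0; exists K.
have [Kn hKn] := choice osc.
pose B := \sum_(1 <= n < N' | n != m) Kn n.
pose Dc := (G * W + G * W) * `|x1 - e|.
apply: (@small_of_linear _ _ ((Dc + B) / 2)) => T T0.
have TT : - T <= T by lra.
have he : e / 2 < e < x1 + 1 by apply/andP; split; lra.
have hx1 : e / 2 < x1 < x1 + 1 by apply/andP; split; lra.
have shift := @contour_shift _ f f' (e / 2) (x1 + 1) T L T0 df (bf T) e x1 (G * W) he hx1.
set I1 := \int[mu]_(t in _) _ in shift; set I0 := \int[mu]_(t in _) _ in shift.
have {}shift : `|I1 - I0| <= Dc.
  apply: shift => x; rewrite minEle maxEle (ltW elx) => /andP[h1 h2].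
  have h3 : e / 2 <= x by lra.
  have h4 : x <= x1 + 1 by lra.
  have h5 : G * m%:R `^ x <= G * W by rewrite ler_wpM2l// powR_nat_le.
  by split; apply: le_trans h5; exact: fE.
have cf x : e / 2 < x < x1 + 1 -> continuous (fun t => complex.Re (f (cpt x t))).
  by move=> hx t; exact: derive_continuous (is_derive_vRe (df x t hx)).
have hI0 : I0 <= G * m%:R `^ e * (T - - T).
  rewrite -Rintegral_const//; apply: le_Rintegral => //.
  - exact: continuous_integrable (cf e he).
  - by apply: continuous_integrable => t; exact: cvg_cst.
  - move=> t _; apply: (le_trans (ler_norm _)); apply: (le_trans (Re_le_cabs _)).
    by apply: fE; lra.
pose q n t := complex.Re (u * b n * cexp ((ln m%:R - ln n%:R)%:C%C * cpt x1 t)).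
have cq n : continuous (q n).
  move=> t; have d1 s := is_deriveCZ (u * b n) (is_derive_cexp (ln m%:R - ln n%:R)%:C%C s).
  exact: derive_continuous (is_derive_vRe (d1 (cpt x1 t))).
have N'0 : (0 < N')%N by rewrite leq_max N0.
have mN' : (m < N')%N by rewrite leq_max leqnn orbT.
have fq t : cabs (b m) - eta + \sum_(1 <= n < N' | n != m) q n t <= complex.Re (f (cpt x1 t)).
  pose s := cpt x1 t.
  have tail : cabs (g s - dirichlet_psum b s N') <= eta / m%:R `^ x1.
    apply: csum_tail => // [|N2]; first exact: hb.
    apply: le_trans (hN N2); under eq_bigr do rewrite cabs_dirichlet_term.
    apply: ler_sum_subrange; rewrite ?leq_maxl// => i _.
    by rewrite mulr_ge0 ?cabs_ge0 ?powR_ge0.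
  have fs : f s = \sum_(1 <= n < N') u * b n * cexp ((ln m%:R - ln n%:R)%:C%C * s) +
      u * ((g s - dirichlet_psum b s N') * cexp (k * s)).
    rewrite /f mulrBl mulrBr addrCA -[LHS]addr0; congr (_ + _).
    rewrite /dirichlet_psum mulr_suml mulr_sumr -sumrB big_nat_cond big1// => n.
    move=> /andP[/andP[n0 _] _]; apply/eqP; rewrite subr_eq0; apply/eqP.
    rewrite npowE// (_ : (ln m%:R - ln n%:R)%:C%C * s = - (ln n%:R)%:C%C * s + k * s).
      by rewrite cexpD; ring.
    by rewrite -mulrDl rmorphB/= addrC.
  rewrite fs ReD Re_sum (bigD1_seq m) ?mem_index_iota ?m0 ?iota_uniq//=.
  rewrite subrr mul0r cexp0 mulr1 ub/= -!addrA lerD2l addrC lerD2l.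
  rewrite lerNl (le_trans _ (_ : cabs (u * ((g s - dirichlet_psum b s N') * cexp (k * s))) <= _))//.
    by rewrite (le_trans (ler_norm _))// normrN Re_le_cabs.
  rewrite cabsM u1 mul1r cabsM cE/=.
  by rewrite -ler_pdivlMr ?powR_gt0// ltr0n.
have hI1 : (cabs (b m) - eta) * (T - - T) - B <= I1.
  apply: (@le_trans _ _ (\int[mu]_(t in `[- T, T])
      (cabs (b m) - eta + \sum_(1 <= n < N' | n != m) q n t))).
    rewrite RintegralD//; last 2 first.
    - by apply: continuous_integrable => t; exact: cvg_cst.
    - by apply: continuous_integrable; exact: continuous_sum.
    rewrite Rintegral_const// lerD2l Rintegral_sum// lerNl -sumrN.
    rewrite /B big_nat_cond [leRHS]big_nat_cond; apply: ler_sum => n /andP[/andP[n0 _] nm].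
    have := hKn n; rewrite n0 nm => /(_ isT T T0); apply: le_trans.
    by rewrite -normrN ler_norm.
  apply: le_Rintegral => //.
  - by apply: continuous_integrable => t; apply: cvgD; [exact: cvg_cst|exact: continuous_sum].
  - exact: continuous_integrable (cf x1 hx1).
have := ler_norm (I1 - I0); lra.
Qed.

Lemma summable_everywhere x : 0 < x -> dsummable b x.
Proof.
move=> x0; have x20 : 0 < x / 2 by rewrite divr_gt0.
have [K hK] := coef_bound x20.
by apply: (dsummable_smooth pP sb hK); lra.
Qed.

Lemma geometric_contra (p q1 q2 K0 K1 K2 : R) : 0 <= q1 < p -> 0 <= q2 < p ->
  0 <= K1 -> 0 <= K2 ->
  (forall N, K0 * p ^+ N <= K1 * q1 ^+ N + K2 * q2 ^+ N) -> K0 <= 0.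
Proof.
move=> /andP[q10 q1p] /andP[q20 q2p] K10 K20 h; rewrite leNgt; apply/negP => K00.
have p0 : 0 < p := le_lt_trans q10 q1p.
pose q := Num.max q1 q2; have q0 : 0 <= q by rewrite le_max q10.
have qp : q < p by rewrite gt_max q1p.
have qp1 : `|q / p| < 1 by rewrite ger0_norm ?divr_ge0 ?(ltW p0)// ltr_pdivrMr// mul1r.
have K12 : 0 < K1 + K2 + 1 by rewrite ltr_wpDl// addr_ge0.
have /cvgrPdist_lt/(_ _ (divr_gt0 K00 K12))[N _ /(_ N (leqnn N))/=] := cvg_expr qp1.
rewrite sub0r normrN normrX ger0_norm ?divr_ge0 ?(ltW p0)// expr_div_n.
rewrite ltr_pdivrMr ?exprn_gt0// mulrAC ltr_pdivlMr// => h1.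
have := h N; rewrite leNgt => /negP; apply.
apply: le_lt_trans h1; rewrite mulrDr mulr1 mulrDr ler_wpDr ?exprn_ge0//.
by rewrite lerD// mulrC ler_wpM2r// lerXn2r ?nnegrE// le_max lexx ?orbT.
Qed.

Lemma Rintegral_split (q : R -> R) (a x c : R) : continuous q -> a <= x <= c ->
  \int[mu]_(t in `[a, c]) q t =
  \int[mu]_(t in `[a, x]) q t + \int[mu]_(t in `[x, c]) q t.
Proof.
move=> cq /andP[ax xc].
rewrite -(@Rintegral_itv_obnd_cbnd _ x); last first.
  by apply: integrableS (continuous_integrable x c cq) => //; exact: subset_itv_oc_cc.
rewrite -(@Rintegral_itvB _ q (BLeft a) (BRight c) x)//.
- by rewrite addrC subrK.
- exact: continuous_integrable.
Qed.

Lemma peak_integral (q : R -> R) (A B r T : R) : continuous q -> 0 < r <= T ->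
  0 <= B -> (forall t, `|t| <= T -> - B <= q t) ->
  (forall t, `|t| <= r -> A <= q t) ->
  A * (r + r) - B * (T + T) <= \int[mu]_(t in `[- T, T]) q t.
Proof.
move=> cq /andP[r0 rT] B0 hB hA.
have low k a c : a <= c -> (forall t, a <= t <= c -> k <= q t) ->
    k * (c - a) <= \int[mu]_(t in `[a, c]) q t.
  move=> ac h; rewrite -Rintegral_const//; apply: le_Rintegral => //.
  - by apply: continuous_integrable => t; exact: cvg_cst.
  - exact: continuous_integrable.
rewrite (@Rintegral_split q (- T) (- r) T)//; last by apply/andP; split; lra.
rewrite (@Rintegral_split q (- r) r T)//; last by apply/andP; split; lra.
have h1 : - B * (- r - - T) <= \int[mu]_(t in `[- T, (- r)]) q t.
  apply: low => [|t /andP[? ?]]; first by lra.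
  by apply: hB; rewrite ler_norml; apply/andP; split; lra.
have h2 : A * (r - - r) <= \int[mu]_(t in `[- r, r]) q t.
  apply: low => [|t ?]; first by lra.
  by apply: hA; rewrite ler_norml.
have h3 : - B * (T - r) <= \int[mu]_(t in `[r, T]) q t.
  apply: low => [|t /andP[? ?]]; first by lra.
  by apply: hB; rewrite ler_norml; apply/andP; split; lra.
nra.
Qed.

(** The integral of f times a high power of a kernel peaked at s0 is moved from
    the vertical line through s0 to the line where f vanishes. This costs only the
    values on the horizontal sides, where the powers of the kernel
    1 + ((s - s0) / (4 (x1 - x0))) ^ 2 are exponentially small. *)
Lemma vanish_left_axis (f f' : CC R -> CC R) (lo x0 x1 G L : R) :
  lo < x0 < x1 ->
  (forall s, lo < complex.Re s -> is_derive s 1 f (f' s)) ->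
  (forall s, lo < complex.Re s -> complex.Re s < x1 + 1 ->
     cabs (f s) <= G /\ cabs (f' s) <= L) ->
  (forall t, f (cpt x1 t) = 0) -> f (cpt x0 0) = 0.
Proof.
move=> /andP[lx0 x01] df bf f0.
pose D := x1 - x0; have D0 : 0 < D by rewrite subr_gt0.
have x1E : x1 = x0 + D by rewrite /D addrC subrK.
pose T := D + D; have T0 : 0 < T by rewrite addr_gt0.
pose d := (4 * D)^-1; have d0 : 0 < d by rewrite invr_gt0 mulr_gt0.
have dD : d * D = 4^-1 by rewrite /d; field; rewrite gt_eqF.
have hx0 : lo < x0 < x1 + 1 by apply/andP; split; lra.
have hx1 : lo < x1 < x1 + 1 by apply/andP; split; lra.
have [G0 L0] : 0 <= G /\ 0 <= L.
  have [h1 h2] : cabs (f (cpt x0 0)) <= G /\ cabs (f' (cpt x0 0)) <= L.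
    by apply: bf => //=; lra.
  by split; [apply: le_trans h1|apply: le_trans h2]; exact: cabs_ge0.
have fG0 t : cabs (f (cpt x0 t)) <= G /\ cabs (f' (cpt x0 t)) <= L.
  by apply: bf => //=; case/andP: hx0.
pose c1 : CC R := 'i%C * d%:C%C.
pose k1 : CC R := 1 - c1 * x0%:C%C; pose k2 : CC R := 1 + c1 * x0%:C%C.
(* 1 + (d (s - x0)) ^ 2, factored into affine functions *)
pose K s : CC R := (c1 * s + k1) * (- c1 * s + k2).
have daff (c k s : CC R) : is_derive s 1 (fun s => c * s + k) c.
  apply/is_deriveCP => e e0; exists 1 => // h _.
  rewrite (_ : _ - _ - _ = 0); last by ring.
  by rewrite cabs0 mulr_ge0 ?cabs_ge0// ltW.
pose K' s : CC R := c1 * (- c1 * s + k2) + (c1 * s + k1) * - c1.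
have dK s : is_derive s 1 K (K' s) by apply: is_deriveCM; exact: daff.
have KE x t : K (cpt x t) =
    cpt (1 + (d * (x - x0)) ^+ 2 - (d * t) ^+ 2) (2 * (d * (x - x0)) * (d * t)).
  by apply: eq_ReIm; rewrite /K /k1 /k2 /c1 !(ReM, ImM, ReD, ImD, ReN, ImN) /=; ring.
have box : exists2 W : R, 1 <= W & forall s, lo < complex.Re s < x1 + 1 ->
    `|complex.Im s| <= T + 1 -> cabs (K s) <= W /\ cabs (K' s) <= W.
  pose S := `|lo| + `|x1 + 1| + (T + 1).
  have T10 : 0 <= T + 1 by rewrite addr_ge0// ltW.
  have S0 : 0 <= S by rewrite /S; do 2! apply: addr_ge0 => //.
  pose V := 1 + cabs c1 * (S + `|x0|).
  have V1 : 1 <= V by rewrite lerDl mulr_ge0 ?cabs_ge0// addr_ge0.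
  have V0 : 0 <= V by rewrite (le_trans _ V1).
  have aff (c k s : CC R) : cabs c = cabs c1 -> cabs k <= 1 + cabs c1 * `|x0| ->
      cabs s <= S -> cabs (c * s + k) <= V.
    move=> h1 h2 h3; apply: (le_trans (cabsD _ _)); rewrite cabsM h1 /V.
    have := ler_wpM2l (cabs_ge0 c1) h3; lra.
  have [kb1 kb2] : cabs k1 <= 1 + cabs c1 * `|x0| /\ cabs k2 <= 1 + cabs c1 * `|x0|.
    by split; [apply: (le_trans (cabsB _ _))|apply: (le_trans (cabsD _ _))];
      rewrite cabs1 cabsM cabs_real.
  exists (V * V + (cabs c1 * V + V * cabs c1)).
    have c0 := mulr_ge0 (cabs_ge0 c1) V0.
    by rewrite ler_wpDr//; [rewrite addr_ge0// mulrC|rewrite -[leLHS]mulr1 ler_pM].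
  move=> s /andP[s1 s2] s3.
  have sS : cabs s <= S.
    apply: (le_trans (cabs_le_ReIm _)); rewrite lerD// ler_norml.
    have := ler_norm (x1 + 1); have := ler_norm (- lo); rewrite normrN => ? ?.
    by have := normr_ge0 lo; have := normr_ge0 (x1 + 1) => ? ?; apply/andP; split; lra.
  have h1 := aff c1 k1 s erefl kb1 sS; have h2 := aff (- c1) k2 s (cabsN _) kb2 sS.
  split.
    rewrite /K cabsM; apply: (@le_trans _ _ (V * V)); first by rewrite ler_pM ?cabs_ge0.
    by rewrite lerDl addr_ge0 ?mulr_ge0 ?cabs_ge0.
  apply: (@le_trans _ _ (cabs c1 * V + V * cabs c1)); last by rewrite lerDr mulr_ge0.
  apply: (le_trans (cabsD _ _)); rewrite (cabsM c1) (cabsM _ (- c1)) cabsN.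
  by apply: lerD; [apply: ler_wpM2l|apply: ler_wpM2r]; rewrite ?cabs_ge0.
have powK N : exists K'N : CC R -> CC R, exists2 W : R, 0 <= W &
    (forall s, is_derive s 1 (fun s => K s ^+ N) (K'N s)) /\
    (forall s, lo < complex.Re s < x1 + 1 -> `|complex.Im s| <= T + 1 ->
      cabs (K s ^+ N) <= W /\ cabs (K'N s) <= W).
  have [W W1 hW] := box; have W0 : 0 <= W by rewrite (le_trans _ W1).
  elim: N => [|N [K'N [WN WN0 [h1 h2]]]].
    exists (fun => 0); exists 1; rewrite ?ler01//; split => [s|s _ _].
      apply/is_deriveCP => e e0; exists 1 => // h _.
      by rewrite !expr0 subrr mulr0 subr0 cabs0 mulr_ge0 ?cabs_ge0// ltW.
    by rewrite expr0 cabs1 cabs0 lexx ler01.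
  exists (fun s => K' s * K s ^+ N + K s * K'N s).
  exists (W * WN + W * WN); first by rewrite addr_ge0 ?mulr_ge0.
  split => [s|s hs1 hs2].
    by under eq_fun do rewrite exprS; exact: is_deriveCM.
  have [k3 k4] := hW s hs1 hs2; have [k5 k6] := h2 s hs1 hs2.
  split; last first.
    by rewrite (le_trans (cabsD _ _))// lerD// cabsM ler_pM ?cabs_ge0.
  rewrite exprS cabsM (@le_trans _ _ (W * WN))// ?ler_pM ?cabs_ge0//.
  by rewrite lerDl mulr_ge0.
have [u u1 ub] := cabs_rot (f (cpt x0 0)).
pose a := cabs (f (cpt x0 0)).
suff a0 : a <= 0 by apply/cabs_eq0/eqP; rewrite eq_le a0 cabs_ge0.
rewrite leNgt; apply/negP => a0.
(* for |t| <= r, the real part of u * f keeps half of its central value *)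
pose r := Num.min D (a / (4 * (L + 1))).
have La0 : 0 < 4 * (L + 1) by rewrite mulr_gt0// ltr_wpDl.
have r0 : 0 < r by rewrite lt_min D0 divr_gt0.
have rD : r <= D by rewrite ge_min lexx.
have rL : r * (L + L) <= a / 2.
  have : r <= a / (4 * (L + 1)) by rewrite ge_min lexx orbT.
  rewrite ler_pdivlMr// => h; nra.
(* p is a lower bound of K for |t| <= r / 2 and q an upper bound for |t| >= r,
   while 9 / 10 bounds |K| on the horizontal sides *)
pose p := 1 - (d * (r / 2)) ^+ 2; pose q := 1 - (d * r) ^+ 2.
have dr0 : 0 < d * r by rewrite mulr_gt0.
have dr1 : d * r <= 4^-1 by rewrite -dD ler_pM2l.
have pq : 0 <= q < p.
  apply/andP; split; rewrite /p /q; nra.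
have p9 : 9 / 10 < p by rewrite /p; nra.
have sgn N t : complex.Re (u * (f (cpt x0 t) * K (cpt x0 t) ^+ N)) =
    (1 - (d * t) ^+ 2) ^+ N * complex.Re (u * f (cpt x0 t)).
  have -> : K (cpt x0 t) = (1 - (d * t) ^+ 2)%:C%C.
    by rewrite KE; apply: eq_ReIm => /=; ring.
  by rewrite -rmorphXn/= mulrA [LHS]ReM/= mulr0 subr0 mulrC.
have near0 t : `|t| <= r -> a / 2 <= complex.Re (u * f (cpt x0 t)).
  move=> tr.
  have h : cabs (f (cpt x0 t) - f (cpt x0 0)) <= (L + L) * `|t - 0|.
    apply: (@lipschitz_vertical f f') => t' _; split; first exact: df.
    exact: (fG0 t').2.
  have -> : u * f (cpt x0 t) = a%:C%C + u * (f (cpt x0 t) - f (cpt x0 0)).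
    by rewrite mulrBr ub addrC subrK.
  rewrite ReD/=.
  rewrite subr0 in h; have h2 : (L + L) * `|t| <= (L + L) * r by rewrite ler_wpM2l// addr_ge0.
  have := Re_le_cabs (u * (f (cpt x0 t) - f (cpt x0 0))); rewrite cabsM u1 mul1r.
  rewrite ler_norml => /andP[h3 _]; lra.
have contra N : a * r / 2 * p ^+ N <= (G * 4 * D) * q ^+ N + (G + G) * D * (9 / 10) ^+ N.
  have [K'N [W W0 [dKN hKN]]] := powK N.
  pose fN s : CC R := u * (f s * K s ^+ N).
  pose f'N s : CC R := u * (f' s * K s ^+ N + f s * K'N s).
  have dfN x t : lo < x < x1 + 1 -> is_derive (cpt x t) 1 fN (f'N (cpt x t)).
    move=> /andP[h1 h2]; apply: is_deriveCZ.
    exact: (is_deriveCM (df (cpt x t) h1) (dKN (cpt x t))).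
  have bfN x t : lo < x < x1 + 1 -> `|t| <= T + 1 ->
      cabs (f'N (cpt x t)) <= L * W + G * W.
    move=> hx ht; have [h1 h2] := hKN (cpt x t) hx ht.
    have [h3 h4] : cabs (f (cpt x t)) <= G /\ cabs (f' (cpt x t)) <= L.
      by case/andP: hx => h5 h6; exact: bf.
    rewrite /f'N cabsM u1 mul1r (le_trans (cabsD _ _))//.
    by rewrite lerD// cabsM ler_pM ?cabs_ge0.
  have corner x t : x0 <= x <= x1 -> `|t| = T -> cabs (fN (cpt x t)) <= G * (9 / 10) ^+ N.
    move=> /andP[h1 h2] tT; rewrite /fN cabsM u1 mul1r cabsM cabsX.
    have h3 : cabs (f (cpt x t)) <= G by apply: (bf _ _ _).1 => /=; lra.
    apply: ler_pM => //; rewrite ?cabs_ge0 ?exprn_ge0 ?cabs_ge0//.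
    apply: lerXn2r; rewrite ?nnegrE ?cabs_ge0//.
    rewrite -(@ler_pXn2r _ 2)// ?nnegrE ?cabs_ge0// cabs_sqr KE /=.
    have -> : (d * t) ^+ 2 = 4^-1.
      rewrite exprMn -(real_normK (num_real t)) tT -exprMn /T mulrDr dD.
      by field.
    have e4 : (2 * (d * (x - x0)) * (d * t)) ^+ 2 = (d * (x - x0)) ^+ 2.
      have -> : (2 * (d * (x - x0)) * (d * t)) ^+ 2 = 4 * (d * t) ^+ 2 * (d * (x - x0)) ^+ 2.
        by ring.
      rewrite exprMn -(real_normK (num_real t)) tT -exprMn /T mulrDr dD.
      by field.
    rewrite e4; set y := d * (x - x0).
    have y0 : 0 <= y by rewrite mulr_ge0 ?subr_ge0// ltW.
    have y1 : y <= 4^-1 by rewrite -dD /y ler_pM2l// /D lerB.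
    have y2 : y ^+ 2 <= 16^-1.
      have -> : 16^-1 = 4^-1 ^+ 2 :> R by field.
      by apply: lerXn2r; rewrite ?nnegrE.
    have y3 := sqr_ge0 y; move: (y ^+ 2) y2 y3 => z z1 z2; nra.
  pose J x := \int[mu]_(t in `[- T, T]) complex.Re (fN (cpt x t)).
  have J1 : J x1 = 0.
    rewrite /J (_ : (fun t => complex.Re (fN (cpt x1 t))) = cst 0).
      by rewrite Rintegral_cst// mul0r.
    by apply/funext => t; rewrite /fN f0 mul0r mulr0.
  have hJ : `|J x1 - J x0| <= (G * (9 / 10) ^+ N + G * (9 / 10) ^+ N) * `|x1 - x0|.
    apply: (contour_shift T0 dfN bfN hx0 hx1) => x.
    rewrite /Num.min /Num.max x01 => hx.
    by split; apply: corner => //; rewrite ?normrN ger0_norm// ltW.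
  have hI : `|J x0| <= (G * (9 / 10) ^+ N + G * (9 / 10) ^+ N) * D.
    by move: hJ; rewrite J1 sub0r normrN -/D (gtr0_norm D0).
  have cq : continuous (fun t => complex.Re (fN (cpt x0 t))).
    by move=> t; exact: derive_continuous (is_derive_vRe (dfN x0 t hx0)).
  have p0 : 0 <= p by apply: le_trans (ltW p9); rewrite divr_ge0.
  have [q0 _] := andP pq.
  have hr2 : 0 < r / 2 <= T by apply/andP; split; [rewrite divr_gt0|rewrite /T; lra].
  have B0 : 0 <= G * q ^+ N by rewrite mulr_ge0// exprn_ge0.
  have peak := @peak_integral _ (a / 2 * p ^+ N) (G * q ^+ N) (r / 2) T cq hr2 B0 _ _.
  have dsq t v : 0 <= v -> `|t| <= v -> (d * t) ^+ 2 <= (d * v) ^+ 2.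
    move=> v0 tv; rewrite -[leLHS]real_normK ?num_real// normrM (gtr0_norm d0).
    have dv0 := ltW d0.
    by apply: lerXn2r; rewrite ?nnegrE ?mulr_ge0// ler_wpM2l.
  have dT : (d * T) ^+ 2 = 4^-1 by rewrite /T mulrDr dD; field.
  have le1 t : `|t| <= T -> 0 <= 1 - (d * t) ^+ 2.
    by move=> /(dsq _ _ (ltW T0)); rewrite dT; lra.
  have /le_trans/(_ (le_trans (ler_norm _) hI)) : a / 2 * p ^+ N * (r / 2 + r / 2) - G * q ^+ N * (T + T) <= J x0.
    apply: peak => t ht.
      rewrite /fN sgn; have [tr|rt] := leP `|t| r.
        apply: (@le_trans _ _ 0); first by rewrite oppr_le0.
        by rewrite mulr_ge0 ?exprn_ge0 ?le1// (le_trans _ (near0 t tr))// divr_ge0 ?ltW.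
      have h1 : (1 - (d * t) ^+ 2) ^+ N <= q ^+ N.
        apply: lerXn2r; rewrite ?nnegrE; [exact: le1|exact: q0|].
        rewrite /q; apply: lerB => //.
        rewrite -[leRHS]real_normK ?num_real// normrM (gtr0_norm d0).
        have rt0 := ltW r0; have dv0 := ltW d0; have rt' := ltW rt.
        by apply: lerXn2r; rewrite ?nnegrE ?mulr_ge0// ler_wpM2l.
      have h2 : `|complex.Re (u * f (cpt x0 t))| <= G.
        apply: (le_trans (Re_le_cabs _)); rewrite cabsM u1 mul1r.
        exact: (fG0 t).1.
      rewrite lerNl (le_trans (ler_norm _))// normrN normrM [leRHS]mulrC.
      by apply: ler_pM => //; rewrite ger0_norm// exprn_ge0// le1.
    rewrite /fN sgn mulrC; apply: ler_pM.
    - by rewrite exprn_ge0.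
    - by rewrite divr_ge0// ltW.
    - have tT : `|t| <= T by rewrite (le_trans ht)// /T; lra.
      apply: lerXn2r; rewrite ?nnegrE; [exact: p0|exact: le1|].
      rewrite /p; apply: lerB => //; apply: dsq => //.
      by rewrite divr_ge0// ltW.
    - by apply: near0; rewrite (le_trans ht)//; lra.
  rewrite /T; lra.
have := geometric_contra pq _ _ _ contra; rewrite p9 andbT.
have -> : 0 <= 9 / 10 :> R by rewrite divr_ge0.
have D0' := ltW D0.
have h1 : 0 <= G * 4 * D by rewrite !mulr_ge0.
have h2 : 0 <= (G + G) * D by rewrite mulr_ge0// addr_ge0.
move=> /(_ isT h1 h2); apply/negP; rewrite -ltNge.
by rewrite divr_gt0// mulr_gt0.
Qed.

Lemma vanish_left (f f' : CC R -> CC R) (lo x0 x1 t0 G L : R) :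
  lo < x0 < x1 ->
  (forall s, lo < complex.Re s -> is_derive s 1 f (f' s)) ->
  (forall s, lo < complex.Re s -> complex.Re s < x1 + 1 ->
     cabs (f s) <= G /\ cabs (f' s) <= L) ->
  (forall t, f (cpt x1 t) = 0) -> f (cpt x0 t0) = 0.
Proof.
move=> hx df bf f0; pose h s := f (s + cpt 0 t0).
have shE x t : cpt x t + cpt 0 t0 = cpt x (t + t0).
  by apply: eq_ReIm; rewrite ?ReD ?ImD/= ?addr0.
have Resh s : complex.Re (s + cpt 0 t0) = complex.Re s by rewrite ReD addr0.
have -> : f (cpt x0 t0) = h (cpt x0 0) by rewrite /h shE add0r.
apply: (@vanish_left_axis h (fun s => f' (s + cpt 0 t0)) lo x0 x1 G L) => //.
- move=> s hs; have := df (s + cpt 0 t0); rewrite Resh => /(_ hs)/is_deriveCP d.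
  apply/is_deriveCP => e e0; have [r r0 hr] := d e e0; exists r => // k hk.
  by rewrite /h (addrAC s k); exact: hr.
- by move=> s h1 h2; apply: bf; rewrite Resh.
- by move=> t; rewrite /h shE.
Qed.

(** The difference of g and its series is bounded on strips and vanishes far to
    the right. *)
Lemma extension_identity s : 0 < complex.Re s -> g s = dirichlet b s.
Proof.
case: s => x0 t0 /= x00; pose lo := x0 / 2.
have lo0 : 0 < lo by rewrite divr_gt0.
pose x1 := Num.max theta x0 + 1.
have [tx1 x01] : theta < x1 /\ x0 < x1.
  by split; rewrite /x1 ltr_pwDr// le_max lexx ?orbT.
have x10 : 0 < x1 := lt_trans x00 x01.
have [G G0 hG] := strip_bounded lo0 tx1 x10 (summable_everywhere x10).
have blo := summable_everywhere lo0; have [S hS] := blo.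
have [S' hS'] : dsummable (dlog b) lo.
  by apply: (@dsummable_log _ _ (lo / 2)); [lra|apply: summable_everywhere; lra].
have bnd (c : nat -> CC R) (V : R) s :
    (forall N, \sum_(1 <= n < N) cabs (c n) * n%:R `^ (- lo) <= V) ->
    lo < complex.Re s -> cabs (dirichlet c s) <= V.
  move=> hV hs; apply: dirichlet_le => N; apply: le_trans (hV N).
  apply: ler_sum_nat1 => n n0; rewrite ler_wpM2l ?cabs_ge0//.
  by rewrite powR_nat_le// lerN2 ltW.
apply/eqP; rewrite -subr_eq0; apply/eqP.
apply: (@vanish_left (fun s => g s - dirichlet b s)
  (fun s => 'D_1 g s - - dirichlet (dlog b) s) lo x0 x1 t0 (G + S) (M / lo + S')).
- by apply/andP; split => //; rewrite /lo; lra.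
- move=> s hs; apply: is_deriveCB; first by apply: dgE; exact: lt_trans hs.
  exact: is_derive_dirichlet blo hs.
- move=> s h1 h2; split; apply: (le_trans (cabsB _ _)); apply: lerD.
  + by apply: hG; exact: ltW.
  + exact: bnd.
  + by apply: derive_le => //; exact: ltW.
  + by rewrite cabsN; exact: bnd.
- by move=> t; rewrite (dirichlet_unique (hb (s := cpt x1 t) tx1)) subrr.
Qed.

Lemma derive_identity s : 0 < complex.Re s -> 'D_1 g s = - dirichlet (dlog b) s.
Proof.
move=> s0; have hs : 0 < complex.Re s / 2 by rewrite divr_gt0.
have hs2 : complex.Re s / 2 < complex.Re s by lra.
have /is_deriveCP d := is_derive_dirichlet (summable_everywhere hs) hs2.
suff [] : is_derive s 1 g (- dirichlet (dlog b) s) by [].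
apply/is_deriveCP => e e0; have [r r0 hr] := d e e0.
exists (Num.min r (complex.Re s)); first by rewrite lt_min r0.
move=> h; rewrite lt_min => /andP[h1 h2]; rewrite !extension_identity//; first exact: hr.
rewrite ReD; have := le_lt_trans (Re_le_cabs h) h2.
by rewrite ltr_norml => /andP[? _]; lra.
Qed.

End Coefficients.

End Extension.

(** * Dirichlet convolution and Parseval's identity *)

(** Dirichlet convolution: these are the coefficients of a product. *)
Definition dconv (K : pzSemiRingType) (a b : nat -> K) (n : nat) : K :=
  \sum_(k <- divisors n) a k * b (n %/ k)%N.

Section Convolution.

Lemma sum_divisors (V : nmodType) (n N : nat) (F : nat -> V) : (0 < n < N)%N ->
  \sum_(k <- divisors n) F k = \sum_(1 <= k < N | (k %| n)%N) F k.
Proof.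
move=> /andP[n0 nN]; rewrite -[RHS]big_filter; apply: perm_big.
apply: uniq_perm; rewrite ?divisors_uniq ?filter_uniq ?iota_uniq// => k.
rewrite -dvdn_divisors// mem_filter mem_index_iota; apply/idP/idP => [kn|/andP[]//].
by rewrite kn (dvdn_gt0 n0 kn) (leq_ltn_trans (dvdn_leq n0 kn)).
Qed.

Lemma sum_multiples (V : nmodType) (k N : nat) (F : nat -> V) : (0 < k)%N ->
  \sum_(1 <= n < N | (k %| n)%N) F (n %/ k)%N =
  \sum_(1 <= m < N | (k * m < N)%N) F m.
Proof.
move=> k0; rewrite -[LHS]big_filter -[RHS]big_filter.
pose A := [seq x <- index_iota 1 N | (k %| x)%N]; rewrite -/A.
have -> : \sum_(i <- A) F (i %/ k)%N = \sum_(i <- [seq (n %/ k)%N | n <- A]) F i.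
  by rewrite big_map.
have hA n : n \in A -> [/\ (0 < n)%N, (n < N)%N & (k %| n)%N].
  by rewrite /A mem_filter mem_index_iota => /and3P[].
apply: perm_big; apply: uniq_perm.
- rewrite map_inj_in_uniq ?/A ?filter_uniq ?iota_uniq// => m n /hA[_ _ km] /hA[_ _ kn] e.
  by rewrite -(divnK km) -(divnK kn) e.
- by rewrite filter_uniq ?iota_uniq.
move=> m; apply/mapP/idP => [[n /hA[n0 nN kn] ->]|].
  rewrite mem_filter mem_index_iota [(k * _)%N]mulnC (divnK kn) nN/=.
  by rewrite divn_gt0// dvdn_leq//= (leq_ltn_trans (leq_div _ _)).
rewrite mem_filter mem_index_iota => /and3P[kmN m0 _].
exists (k * m)%N; last by rewrite mulKn.
by rewrite /A mem_filter mem_index_iota dvdn_mulr// muln_gt0 k0 m0.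
Qed.

Lemma sum_dconv_pairs (V : nmodType) (N : nat) (F : nat -> nat -> V) :
  \sum_(1 <= n < N) \sum_(k <- divisors n) F k (n %/ k)%N =
  \sum_(1 <= k < N) \sum_(1 <= m < N | (k * m < N)%N) F k m.
Proof.
rewrite [LHS]big_nat; under eq_bigr => n hn do rewrite (@sum_divisors _ n N)//.
rewrite -big_nat; under eq_bigr do rewrite big_mkcond/=.
rewrite exchange_big/= [LHS]big_nat [RHS]big_nat; apply: eq_bigr => k /andP[k0 _].
by rewrite -big_mkcond/= sum_multiples.
Qed.

End Convolution.

Section Parseval.
Variable R : realType.
Implicit Types (a b c : nat -> CC R).

Lemma normsqC (z : CC R) : (cabs z ^+ 2)%:C%C = z * (z^*)%C :> CC R.
Proof.
by apply: eq_ReIm; rewrite ?ReM ?ImM /=; case: z => x y;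
  rewrite ?cabs_sqr/=; ring.
Qed.

Lemma conj_cexp (z : CC R) : ((cexp z)^*)%C = cexp (z^*)%C.
Proof.
have ReJ (w : CC R) : complex.Re (w^*)%C = complex.Re w by case: w.
have ImJ (w : CC R) : complex.Im (w^*)%C = - complex.Im w by case: w.
apply: eq_ReIm; rewrite ?ReJ ?ImJ ?Re_cexp ?Im_cexp ReJ ImJ ?cosN//.
by rewrite sinN mulrN.
Qed.

Lemma conjcM (z w : CC R) : ((z * w)^*)%C = (z^*)%C * (w^*)%C :> CC R.
Proof. exact: rmorphM. Qed.

Lemma conjcX (z : CC R) n : ((z ^+ n)^*)%C = (z^*)%C ^+ n :> CC R.
Proof. by elim: n => [|n ih]; rewrite ?expr0 ?conjc1// !exprS conjcM ih. Qed.

Lemma cexp_nat (z : CC R) j : cexp (j%:R * z) = cexp z ^+ j.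
Proof.
by elim: j => [|j ih]; rewrite ?mul0r ?cexp0// -natr1 mulrDl mul1r cexpD ih exprSr.
Qed.

Lemma geometric_bounded (z : CC R) : cabs z = 1 -> z != 1 ->
  forall J, cabs (\sum_(0 <= j < J) z ^+ j) <= 2 / cabs (z - 1).
Proof.
move=> z1 zN1 J; have d0 : 0 < cabs (z - 1).
  rewrite lt_neqAle cabs_ge0 andbT eq_sym; apply: contra zN1 => /eqP/cabs_eq0/eqP.
  by rewrite subr_eq0.
rewrite ler_pdivlMr// -cabsM.
have -> : (\sum_(0 <= j < J) z ^+ j) * (z - 1) = z ^+ J - 1.
  by rewrite subrX1 mulrC big_mkord.
by rewrite (le_trans (cabsB _ _))// cabsX z1 expr1n cabs1.
Qed.

(** With this step, the frequencies log n for n < N turn by less than pi. *)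
Definition sampling_step (N : nat) : R := (ln N%:R + 1)^-1.

Definition sample c N M j : CC R :=
  \sum_(1 <= n < M) c n * npow n (cpt 0 (j%:R * sampling_step N)).

Lemma npow_sample n N j : (0 < n)%N ->
  npow n (cpt 0 (j%:R * sampling_step N)) = cexp (- (sampling_step N * ln n%:R)%:C%C * 'i%C) ^+ j :> CC R.
Proof.
move=> n0; rewrite npowE// -cexp_nat; congr cexp.
apply: eq_ReIm; rewrite ?ReM ?ImM ?ReN ?ImN /=; last first.
  have -> : complex.Im (j%:R : CC R) = 0 by elim: j => // j ih; rewrite -natr1 ImD ih addr0.
  have -> : complex.Re (j%:R : CC R) = j%:R by elim: j => // j ih; rewrite -natr1 ReD/= ih natr1.
  ring.
have -> : complex.Im (j%:R : CC R) = 0 by elim: j => // j ih; rewrite -natr1 ImD ih addr0.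
ring.
Qed.

(** Means over equidistant samples stand for means over long segments: distinct
    frequencies give distinct rotations, whose sums over the samples stay
    bounded. *)
Lemma parseval c N : exists K : R, forall J,
  `|\sum_(0 <= j < J) cabs (sample c N N j) ^+ 2 -
    J%:R * \sum_(1 <= n < N) cabs (c n) ^+ 2| <= K.
Proof.
pose w n : CC R := cexp (- (sampling_step N * ln n%:R)%:C%C * 'i%C).
have w1 n : cabs (w n) = 1.
  by rewrite cabs_cexp ReM/= !mulr0 mulr1 oppr0 subr0 expR0.
pose z n m : CC R := w n * (w m)^*%C.
have zE n m : z n m = cexp ((sampling_step N * (ln m%:R - ln n%:R))%:C%C * 'i%C).
  rewrite /z /w conj_cexp -cexpD; congr cexp.
  by apply: eq_ReIm; rewrite ?ReD ?ImD ?ReM ?ImM /=; ring.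
have zabs n m : cabs (z n m) = 1.
  by rewrite zE cabs_cexp ReM/= mulr0 mul0r subr0 expR0.
have zN1 n m : (0 < n < N)%N -> (0 < m < N)%N -> n != m -> z n m != 1.
  move=> /andP[n0 nN] /andP[m0 mN] nm; apply/eqP => /(congr1 (fun z => complex.Im z)).
  rewrite zE Im_cexp ReM ImM /= !(mulr0, mul0r, mulr1, subr0, addr0) expR0 mul1r.
  apply/eqP.
  have lNn k : (0 < k < N)%N -> 0 <= ln (k%:R : R) <= ln N%:R.
    move=> /andP[k0 kN]; rewrite ln_nat_ge0 ler_ln ?posrE ?ltr0n ?ler_nat ?(ltnW kN)//.
    exact: leq_ltn_trans kN.
  have hn := lNn n; have hm := lNn m.
  rewrite n0 nN m0 mN in hn hm; have {hn}/andP[hn0 hn1] := hn isT.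
  have {hm}/andP[hm0 hm1] := hm isT.
  have lN0 : 0 < ln N%:R + 1 :> R by lra.
  have s0 : 0 < sampling_step N by rewrite invr_gt0.
  have pi1 : 1 < pi :> R by rewrite (lt_le_trans _ (pi_ge2 R))// ltr1n.
  have sl x : x < ln N%:R + 1 -> sampling_step N * x < pi.
    by move=> h; apply: lt_trans pi1; rewrite /sampling_step mulrC ltr_pdivrMr// mul1r.
  case: (ltgtP (ln n%:R) (ln m%:R : R)) => h.
  - rewrite gt_eqF// sin_gt0_pi// mulr_gt0 ?subr_gt0//= sl//; lra.
  - rewrite -opprB mulrN sinN oppr_eq0 gt_eqF// sin_gt0_pi//.
    rewrite mulr_gt0 ?subr_gt0//= sl//; lra.
  - by move: h nm => /ln_inj; rewrite !posrE !ltr0n => /(_ n0 m0)/eqP; rewrite eqr_nat => ->.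
pose K := \sum_(1 <= n < N) \sum_(1 <= m < N | m != n)
   cabs (c n * (c m)^*%C) * (2 / cabs (z n m - 1)).
exists K => J.
have E j : (cabs (sample c N N j) ^+ 2)%:C%C =
    \sum_(1 <= n < N) \sum_(1 <= m < N) c n * (c m)^*%C * z n m ^+ j :> CC R.
  rewrite normsqC /sample rmorph_sum/= mulr_suml; apply: eq_big_nat => n /andP[n0 _].
  rewrite mulr_sumr; apply: eq_big_nat => m /andP[m0 _].
  by rewrite !npow_sample// -/(w n) -/(w m) conjcM conjcX /z (exprMn j (w n)); ring.
pose D : CC R := \sum_(1 <= n < N) \sum_(1 <= m < N | m != n)
    c n * (c m)^*%C * \sum_(0 <= j < J) z n m ^+ j.
have DE : (\sum_(0 <= j < J) cabs (sample c N N j) ^+ 2 -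
    J%:R * \sum_(1 <= n < N) cabs (c n) ^+ 2)%:C%C = D :> CC R.
  rewrite rmorphB rmorph_sum/= rmorphM rmorph_nat rmorph_sum/=.
  under eq_bigr do rewrite E.
  rewrite exchange_big/= mulr_sumr -sumrB; apply: eq_big_nat => n hn.
  rewrite exchange_big/= (bigD1_seq n)/= ?mem_index_iota ?iota_uniq//.
  have znn : z n n = 1 by rewrite /z -(normsqC (w n)) w1 expr1n.
  rewrite [X in X + _ - _](_ : _ = \sum_(0 <= i < J) c n * (c n)^*%C); last first.
    by apply: eq_bigr => i _; rewrite znn expr1n mulr1.
  rewrite sumr_const_nat subn0 -(normsqC (c n)) mulr_natl addrAC subrr add0r.
  by apply: eq_bigr => m _; rewrite mulr_sumr.
rewrite -cabs_real DE /D /K.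
apply: (le_trans (cabs_sum _ _ _)); rewrite big_nat [leRHS]big_nat.
apply: ler_sum => n hn; apply: (le_trans (cabs_sum _ _ _)).
rewrite big_nat_cond [leRHS]big_nat_cond; apply: ler_sum => m /andP[hm mn].
rewrite cabsM ler_wpM2l ?cabs_ge0// geometric_bounded// zN1//.
by rewrite eq_sym.
Qed.

Lemma small_of_linear_nat (p q B : R) :
  (forall J : nat, J%:R * p <= J%:R * q + B) -> p <= q.
Proof.
move=> h; rewrite leNgt; apply/negP => qp; have d0 : 0 < p - q by rewrite subr_gt0.
pose J := (Num.Def.trunc (`|B| / (p - q))).+1.
have := truncnS_gt (`|B| / (p - q)); rewrite -/J ltr_pdivrMr// mulrBr => h1.
by have := h J; have := ler_norm B; lra.
Qed.

Lemma square_squeeze (p q r : R) : 0 <= r -> 0 <= q ->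
  (forall e, 0 < e -> p <= (r + e) ^+ 2 * q) -> p <= r ^+ 2 * q.
Proof.
move=> r0 q0 h; apply/ler_addgt0Pl => e e0.
have k0 : 0 < (2 * r + 1) * q + 1 by rewrite ltr_wpDl// mulr_ge0// addr_ge0// mulr_ge0.
pose t := Num.min 1 (e / ((2 * r + 1) * q + 1)).
have t0 : 0 < t by rewrite lt_min ltr01 divr_gt0.
have t1 : t <= 1 by rewrite ge_min lexx.
have te : t * ((2 * r + 1) * q + 1) <= e by rewrite -ler_pdivlMr// ge_min lexx orbT.
apply: (le_trans (h t t0)); have h1 : t * t <= t by rewrite ler_piMl// ltW.
have h2 : t * t * q <= t * q by rewrite ler_wpM2r.
nra.
Qed.

Definition truncate (K : pzSemiRingType) (N : nat) (a : nat -> K) (n : nat) : K :=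
  if (n < N)%N then a n else 0.

(** Convolution with B is multiplication by the sum of the Dirichlet series of
    B, so by Parseval its norm on square-summable sequences is at most the
    supremum of that sum on the imaginary axis. Since a value of the convolution
    only involves the divisors of its argument, the estimate localizes to every
    set of indices closed under divisors. *)
Lemma multiplier_bound (B : nat -> CC R) (S Nb : R) (Y : nat) (D : pred nat) a :
  (forall N, \sum_(1 <= n < N) cabs (B n) <= S) ->
  (forall t, cabs (dirichlet B (cpt 0 t)) <= Nb) ->
  (forall n k, (0 < n < Y)%N -> D n -> (k %| n)%N -> D k) ->
  \sum_(1 <= n < Y | D n) cabs (dconv a B n) ^+ 2 <=
  Nb ^+ 2 * \sum_(1 <= n < Y | D n) cabs (a n) ^+ 2.
Proof.
move=> hS hNb hD.
have Nb0 : 0 <= Nb by apply: le_trans (hNb 0); exact: cabs_ge0.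
pose A n := if D n && (n < Y)%N then a n else 0.
suff H (eta : R) : 0 < eta ->
    \sum_(1 <= n < Y | D n) cabs (dconv a B n) ^+ 2 <=
    (Nb + eta) ^+ 2 * \sum_(1 <= n < Y | D n) cabs (a n) ^+ 2.
  apply: square_squeeze => //.
  by rewrite sumr_ge0// => n _; exact: sqr_ge0.
move=> eta0.
have [Z0 Z00 hZ0] := small_tail (fun n => cabs_ge0 (B n)) eta0 hS.
(* N exceeds all products k * m of indices, so that nothing is cut off *)
pose Z := maxn Z0 Y; pose N := (Y.+1 * Z).+1.
have ZN : (Z <= N)%N by rewrite /N mulSn leqW// leq_addr.
have YN : (Y <= N)%N by rewrite (leq_trans _ ZN)// leq_maxr.
have sumtrunc (V : nmodType) (M : nat) (P : pred nat) (F : nat -> V) : (M <= N)%N ->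
    \sum_(1 <= n < N | P n) (if (n < M)%N then F n else 0) = \sum_(1 <= n < M | P n) F n.
  move=> MN; rewrite -big_mkcondr/= [LHS]big_nat_cond [RHS](big_nat_widen _ _ _ _ _ MN).
  rewrite [RHS]big_nat_cond; apply: eq_bigl => n; case: (1 <= n < N)%N => //=.
pose c n : CC R := dconv A (truncate Z B) n.
have [K1 hK1] := parseval c N; have [K2 hK2] := parseval A N.
have prod j : sample c N N j = sample A N N j * sample (truncate Z B) N N j.
  pose s : CC R := cpt 0 (j%:R * sampling_step N).
  pose F k m := A k * npow k s * (truncate Z B m * npow m s).
  have -> : sample c N N j = \sum_(1 <= n < N) \sum_(k <- divisors n) F k (n %/ k)%N.
    apply: eq_big_nat => n /andP[n0 nN]; rewrite /c /dconv mulr_suml.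
    rewrite big_seq [RHS]big_seq; apply: eq_bigr => k; rewrite -dvdn_divisors// => kn.
    have k0 := dvdn_gt0 n0 kn.
    have nk0 : (0 < n %/ k)%N by rewrite divn_gt0// dvdn_leq.
    rewrite /F -{2}(divnK kn) mulnC npowM//; ring.
  rewrite sum_dconv_pairs /sample mulr_suml; apply: eq_big_nat => k /andP[k0 kN].
  rewrite mulr_sumr big_mkcond/=; apply: eq_big_nat => m /andP[m0 mN].
  case: ifPn => //; rewrite -leqNgt => kmN; rewrite -/s.
  rewrite /A /truncate; case: ifPn => [/andP[_ kY]|_]; last by rewrite !mul0r.
  case: ifPn => [mZ|_]; last by rewrite mul0r mulr0.
  move: kmN; rewrite leqNgt /N ltnS => /negP; case.
  by rewrite leq_mul// ltnW// ltnS ltnW.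
have bnd j : cabs (sample (truncate Z B) N N j) <= Nb + eta.
  pose s : CC R := cpt 0 (j%:R * sampling_step N).
  have -> : sample (truncate Z B) N N j = dirichlet_psum B s Z.
    rewrite /dirichlet_psum -(sumtrunc _ _ _ _ ZN); apply: eq_bigr => m _.
    by rewrite /truncate; case: ifP => // _; rewrite mul0r.
  have term n : (0 < n)%N -> cabs (B n * npow n s) = cabs (B n).
    by move=> n0; rewrite cabs_dirichlet_term /= oppr0 powRr0 mulr1.
  have hs : is_dirichlet B s (dirichlet B s).
    apply: (@is_dirichletP _ _ _ 0) => //; exists S => M; apply: le_trans (hS M).
    by apply: ler_sum_nat1 => n n0; rewrite oppr0 powRr0 mulr1.
  have tail : cabs (dirichlet B s - dirichlet_psum B s Z) <= eta.
    apply: csum_tail => //; first by rewrite leq_max Z00.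
    move=> M; apply: le_trans (hZ0 M).
    apply: (@le_trans _ _ (\sum_(Z <= n < M) cabs (B n))).
      apply: ler_sum_nat => n /andP[n0 _]; rewrite term//.
      by apply: leq_trans n0; rewrite leq_max Z00.
    by apply: ler_sum_subrange; rewrite ?leq_maxl// => n _; exact: cabs_ge0.
  rewrite -[X in cabs X](subrK (dirichlet B s)) (le_trans (cabsD _ _))// addrC.
  by apply: lerD; [exact: hNb|rewrite cabsC].
have cE n : (0 < n < Y)%N -> D n -> c n = dconv a B n.
  move=> /andP[n0 nY] Dn; rewrite /c /dconv big_seq [RHS]big_seq.
  apply: eq_bigr => k; rewrite -dvdn_divisors// => kn.
  have kY : (k < Y)%N by rewrite (leq_ltn_trans (dvdn_leq n0 kn)).
  rewrite /A (hD n k)// ?n0// kY /truncate ifT//.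
  by rewrite (leq_ltn_trans (leq_div _ _))// (leq_trans nY)// leq_maxr.
have AE : \sum_(1 <= n < N) cabs (A n) ^+ 2 = \sum_(1 <= n < Y | D n) cabs (a n) ^+ 2.
  rewrite -(sumtrunc _ _ _ _ YN) [RHS]big_mkcond/=; apply: eq_bigr => n _.
  have z2 : cabs (0 : CC R) ^+ 2 = 0 by rewrite cabs0 expr0n.
  by rewrite /A; case: (D n); case: (n < Y)%N => //=; exact: z2.
rewrite -AE; apply: (@le_trans _ _ (\sum_(1 <= n < N) cabs (c n) ^+ 2)).
  rewrite -(sumtrunc _ _ _ _ YN) big_mkcond/=; apply: ler_sum_nat => n /andP[n0 nN].
  case: ifP => Dn; last exact: sqr_ge0.
  by case: ifP => [nY|_]; [rewrite cE// n0|exact: sqr_ge0].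
apply: (@small_of_linear_nat _ _ (K1 + (Nb + eta) ^+ 2 * K2)) => J.
have := hK1 J; have := hK2 J; rewrite !ler_norml => /andP[_ h2] /andP[h1 _].
have h3 : \sum_(0 <= j < J) cabs (sample c N N j) ^+ 2 <=
    (Nb + eta) ^+ 2 * \sum_(0 <= j < J) cabs (sample A N N j) ^+ 2.
  rewrite mulr_sumr; apply: ler_sum => j _; rewrite prod cabsM exprMn mulrC.
  rewrite ler_wpM2r ?sqr_ge0// lerXn2r ?nnegrE ?cabs_ge0//.
  by rewrite addr_ge0// ltW.
have := ler_wpM2l (sqr_ge0 (Nb + eta)) h2; lra.
Qed.

End Parseval.

(** * Weights that decrease for divisibility *)

Section LayerCake.
Variable R : realType.

(** A nonnegative function decreasing for divisibility is a positive combination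
    of indicators of divisor-closed sets: subtract the least positive value on
    the support and induct on the size of the support. *)
Lemma layer_cake (Y : nat) (x u : nat -> R) :
  (forall D : pred nat, (forall n k, (0 < n < Y)%N -> D n -> (k %| n)%N -> D k) ->
    0 <= \sum_(1 <= n < Y | D n) x n) ->
  (forall n, (0 < n < Y)%N -> 0 <= u n) ->
  (forall n k, (0 < n < Y)%N -> (k %| n)%N -> u n <= u k) ->
  0 <= \sum_(1 <= n < Y) u n * x n.
Proof.
move=> hx.
pose supp (u : nat -> R) := [pred i : 'I_Y | (0 < i)%N && (0 < u i)].
have [m] := ubnP #|supp u|; elim: m u => // m ih u hm u0 ud.
have [i0 i0s|s0] := pickP [pred i | i \in supp u]; last first.
  rewrite big_nat big1// => n /andP[n0 nY].
  have := s0 (Ordinal nY); rewrite /= /supp inE /= n0/= => /negbT; rewrite -leNgt => un.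
  suff -> : u n = 0 by rewrite mul0r.
  by apply/eqP; rewrite eq_le un u0// n0.
have i0P : (0 < i0)%N && (0 < u i0) by move: i0s; rewrite /= /supp inE.
case: (@arg_minP _ _ _ i0 (fun i : 'I_Y => (0 < i)%N && (0 < u i)) (fun i => u i) i0P).
move=> i /andP[i1 ui] imin.
pose c := u i; pose D n := 0 < u n.
pose u' n := if D n then u n - c else 0.
have cmin n : (0 < n < Y)%N -> D n -> c <= u n.
  by move=> /andP[n0 nY] Dn; apply: (imin (Ordinal nY)); rewrite /= n0.
have hD n k : (0 < n < Y)%N -> D n -> (k %| n)%N -> D k.
  by move=> hn Dn kn; rewrite /D (lt_le_trans Dn)// ud.
have -> : \sum_(1 <= n < Y) u n * x n =
    \sum_(1 <= n < Y) u' n * x n + c * \sum_(1 <= n < Y | D n) x n.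
  rewrite mulr_sumr [X in _ = _ + X]big_mkcond/= -big_split/=.
  apply: eq_big_nat => n /andP[n0 nY]; rewrite /u'; case: ifPn => [_|].
    by rewrite mulrBl subrK.
  rewrite /D -leNgt mul0r addr0 => un.
  suff -> : u n = 0 by rewrite mul0r.
  by apply/eqP; rewrite eq_le un u0// n0.
apply: addr_ge0; last by rewrite mulr_ge0 ?(ltW ui) ?hx.
have u'0 n : (0 < n < Y)%N -> 0 <= u' n.
  by move=> hn; rewrite /u'; case: ifPn => // Dn; rewrite subr_ge0 cmin.
apply: ih => //.
  rewrite ltnS in hm; apply: leq_trans hm; apply: proper_card.
  apply/properP; split.
    apply/fintype.subsetP => j; rewrite /supp !inE => /andP[-> /=]; rewrite /u' /D.
    by case: ifP => //; rewrite ltxx.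
  by exists i; rewrite /supp !inE i1 ?ui//= /u' /D ui /c subrr ltxx.
move=> n k hn kn; have /andP[n0 nY] := hn.
have hk : (0 < k < Y)%N by rewrite (dvdn_gt0 n0 kn) (leq_ltn_trans (dvdn_leq n0 kn)).
rewrite /u'; case: ifPn => [Dn|_]; last by have := u'0 k hk; rewrite /u'.
by rewrite (hD n k)// lerD2r ud.
Qed.

(** This is [multiplier_bound] on all divisor-closed sets, summed by
    [layer_cake]. *)
Lemma weighted_multiplier_bound (B : nat -> CC R) (S Nb : R) (Y : nat)
    (u : nat -> R) (a : nat -> CC R) :
  (forall N, \sum_(1 <= n < N) cabs (B n) <= S) ->
  (forall t, cabs (dirichlet B (cpt 0 t)) <= Nb) ->
  (forall n, (0 < n < Y)%N -> 0 <= u n) ->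
  (forall n k, (0 < n < Y)%N -> (k %| n)%N -> u n <= u k) ->
  \sum_(1 <= n < Y) u n * cabs (dconv a B n) ^+ 2 <=
  Nb ^+ 2 * \sum_(1 <= n < Y) u n * cabs (a n) ^+ 2.
Proof.
move=> hS hNb u0 ud; rewrite -subr_ge0 mulr_sumr -sumrB.
under eq_bigr do rewrite mulrCA -mulrBr.
apply: (layer_cake (x := fun n => Nb ^+ 2 * cabs (a n) ^+ 2 - cabs (dconv a B n) ^+ 2)) => //.
move=> D hD; rewrite sumrB -mulr_sumr subr_ge0.
exact: multiplier_bound hS hNb hD.
Qed.

End LayerCake.

(** * Dyadic blocks and the tail estimate *)

Section Tail.
Variables (R : realType) (P : seq nat) (w : nat -> R) (delta : R).
Hypothesis pP : all prime P.
Hypothesis delta0 : 0 < delta.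
Hypothesis w_gt0 : forall n, (0 < n)%N -> 0 < w n.
Hypothesis w_grows : forall n p, (0 < n)%N -> prime p ->
  w n * ((logn p n).+2%:R / (logn p n).+1%:R) `^ delta <= w (n * p)%N.

Definition smooth_part (n : nat) : nat := (n`_[pred p | p \in P])%N.

Lemma smooth_part_gt0 n : (0 < smooth_part n)%N.
Proof. exact: part_gt0. Qed.

Lemma smooth_partM m n : (0 < m)%N -> (0 < n)%N -> smooth_part (m * n) = (smooth_part m * smooth_part n)%N.
Proof. exact: partnM. Qed.

Lemma smooth_part_smooth n : (0 < n)%N -> smooth P n -> smooth_part n = n.
Proof. by move=> n0 sn; apply: part_pnat_id; rewrite /pnat n0. Qed.

Lemma smooth_part_prime p : prime p -> smooth_part p = if p \in P then p else 1%N.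
Proof.
move=> pp; rewrite /smooth_part; case: ifPn => h.
  by rewrite part_pnat_id// pnatE.
by rewrite part_p'nat// pnatE// inE.
Qed.

Lemma smooth_part_leq n : (0 < n)%N -> (smooth_part n <= n)%N.
Proof. by move=> n0; rewrite dvdn_leq// dvdn_part. Qed.

Lemma smooth_part_dvdn k n : (0 < n)%N -> (k %| n)%N -> (smooth_part k %| smooth_part n)%N.
Proof. by move=> n0 kn; exact: partn_dvd. Qed.

(** The size of log (smooth_part n) on a dyadic scale, see [block_lower] and
    [block_upper]. *)
Definition block (n : nat) : nat := trunc_log 2 (trunc_log 2 (smooth_part n)).

Lemma block_mono k n : (0 < n)%N -> (k %| n)%N -> (block k <= block n)%N.
Proof.
move=> n0 kn; do 2! apply: leq_trunc_log.
by rewrite dvdn_leq ?smooth_part_gt0 ?smooth_part_dvdn.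
Qed.

Lemma block_leq n : (0 < n)%N -> (block n <= n)%N.
Proof.
have tl m : (trunc_log 2 m <= m)%N.
  case: m => [|m]; first by rewrite trunc_log0.
  apply: leq_trans (trunc_logP (isT : (1 < 2)%N) (ltn0Sn m)).
  exact: ltnW (ltn_expl _ _).
by move=> n0; rewrite (leq_trans (tl _))// (leq_trans (tl _))// smooth_part_leq.
Qed.

Lemma ln2_gt0 : 0 < ln 2 :> R.
Proof. by rewrite ln_gt0// ltr1n. Qed.

Lemma ln_pow2 k : ln ((2 ^ k)%N%:R : R) = k%:R * ln 2.
Proof. by rewrite natrX lnXn// mulr_natl. Qed.

Lemma ln_nat_le m n : (0 < m)%N -> (m <= n)%N -> ln m%:R <= ln n%:R :> R.
Proof.
by move=> m0 mn; rewrite ler_ln ?posrE ?ltr0n ?ler_nat// (leq_trans m0).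
Qed.

Lemma block_lower n : (1 < smooth_part n)%N ->
  2 ^+ block n * ln 2 <= ln (smooth_part n)%:R :> R.
Proof.
move=> s1; set r := trunc_log 2 (smooth_part n).
have r0 : (0 < r)%N by rewrite /r trunc_log_gt0.
have h1 : (2 ^ block n <= r)%N by exact: trunc_logP.
have h2 : (2 ^ r <= smooth_part n)%N by apply: trunc_logP => //; exact: smooth_part_gt0.
rewrite -natrX -ln_pow2; apply: ln_nat_le; first by rewrite expn_gt0.
by rewrite (leq_trans _ h2)// leq_exp2l.
Qed.

Lemma block_upper n : ln (smooth_part n)%:R <= 2 ^+ (block n).+1 * ln 2 :> R.
Proof.
set r := trunc_log 2 (smooth_part n).
have h1 : (r < 2 ^ (block n).+1)%N by exact: trunc_log_ltn.
have h2 : (smooth_part n < 2 ^ r.+1)%N by exact: trunc_log_ltn.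
rewrite -natrX -ln_pow2; apply: ln_nat_le; first exact: smooth_part_gt0.
by rewrite ltnW// (leq_trans h2)// leq_exp2l.
Qed.

(** The additive constant bounds log p * (k + 1) by logsize n, where k is the
    exponent of p in n; this is what [logsize_step] needs. *)
Definition logsize (n : nat) : R := ln (smooth_part n)%:R + (1 + \sum_(p <- P) ln p%:R).

Lemma logsize_gt0 n : 0 < logsize n.
Proof.
by rewrite ltr_wpDl ?ln_nat_ge0// ltr_pwDl// sumr_ge0// => p _; rewrite ln_nat_ge0.
Qed.

(** The weight of the estimate for the block l: it majorizes 1 / w on that block
    and gains the factor 2 ^ (delta (block n - l)), up to a constant, over 1 / w
    in the blocks before it. *)
Definition block_weight (l n : nat) : R :=
  (w n)^-1 * (logsize n / (2 ^+ l * ln 2)) `^ delta.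

Lemma logsize_step n p : (0 < n)%N -> prime p -> p \in P ->
  logsize (n * p) <= logsize n * ((logn p n).+2%:R / (logn p n).+1%:R).
Proof.
move=> n0 pp pin; have p0 := prime_gt0 pp.
set k := logn p n.
have -> : logsize (n * p) = logsize n + ln p%:R.
  rewrite /logsize smooth_partM// (smooth_part_prime pp) pin natrM lnM ?posrE ?ltr0n ?smooth_part_gt0//.
  by ring.
have h1 : k%:R * ln p%:R <= ln (smooth_part n)%:R :> R.
  rewrite mulr_natl -lnXn ?ltr0n// -natrX ln_nat_le ?expn_gt0 ?p0//.
  rewrite dvdn_leq ?smooth_part_gt0//.
  have pk : smooth_part (p ^ k) = (p ^ k)%N.
    by rewrite /smooth_part part_pnat_id// pnatX pnatE// inE pin.
  by rewrite -pk smooth_part_dvdn// pfactor_dvdn.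
have h2 : ln p%:R <= \sum_(q <- P) ln q%:R :> R.
  by rewrite (big_rem p)//= lerDl sumr_ge0// => q _; exact: ln_nat_ge0.
have kk : (0 : R) < k.+1%:R by rewrite ltr0n.
rewrite mulrA ler_pdivlMr// -[k.+2%:R]natr1 -[k.+1%:R]natr1.
have h3 : ln p%:R * (k%:R + 1) <= logsize n.
  by rewrite mulrDr mulr1 mulrC /logsize; lra.
lra.
Qed.

Lemma block_weight_ge0 l n : (0 < n)%N -> 0 <= block_weight l n.
Proof. by move=> n0; rewrite mulr_ge0 ?powR_ge0// invr_ge0 ltW// w_gt0. Qed.

(** The factor by which w grows compensates the growth of the logarithm. *)
Lemma block_weight_step l n p : (0 < n)%N -> prime p ->
  block_weight l (n * p) <= block_weight l n.
Proof.
move=> n0 pp; have p0 := prime_gt0 pp.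
have np0 : (0 < n * p)%N by rewrite muln_gt0 n0.
have wn := w_gt0 n0; have wnp := w_gt0 np0.
set r := (logn p n).+2%:R / (logn p n).+1%:R : R.
have r1 : 1 <= r by rewrite ler_pdivlMr ?ltr0n// mul1r ler_nat.
have r0 : 0 <= r by rewrite (le_trans _ r1).
have c0 : 0 < 2 ^+ l * ln 2 :> R by rewrite mulr_gt0 ?exprn_gt0 ?ln2_gt0.
have Lr : logsize (n * p) <= logsize n * r.
  have [pin|pnin] := boolP (p \in P); first exact: logsize_step.
  have -> : logsize (n * p) = logsize n.
    by rewrite /logsize smooth_partM// (smooth_part_prime pp) ifN// muln1.
  by rewrite ler_peMr// ltW// logsize_gt0.
have h : (logsize (n * p) / (2 ^+ l * ln 2)) `^ delta <=
    (logsize n / (2 ^+ l * ln 2)) `^ delta * r `^ delta.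
  have L0 m := ltW (logsize_gt0 m); have c0' := ltW c0; have d0 := ltW delta0.
  rewrite -powRM ?divr_ge0//; apply: ge0_ler_powR; rewrite ?nnegrE ?mulr_ge0 ?invr_ge0//.
  by rewrite mulrAC ler_wpM2r// invr_ge0.
have hr : r `^ delta <= w (n * p)%N / w n.
  by rewrite ler_pdivlMr// mulrC; exact: w_grows.
rewrite /block_weight ler_pdivrMl//; apply: (le_trans h).
rewrite [leRHS](_ : _ = (logsize n / (2 ^+ l * ln 2)) `^ delta * (w (n * p)%N / w n)).
  by rewrite ler_wpM2l ?powR_ge0.
ring.
Qed.

Lemma block_weight_dvdn l n k : (0 < n)%N -> (k %| n)%N ->
  block_weight l n <= block_weight l k.
Proof.
move=> n0 kn; have k0 := dvdn_gt0 n0 kn; rewrite -(divnK kn).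
have : (0 < n %/ k)%N by rewrite divn_gt0// dvdn_leq.
have [m] := ubnP (n %/ k)%N; elim: m (n %/ k)%N => // m ih q qm q0.
have [q1|q1] := leqP q 1.
  have -> : q = 1%N by apply/eqP; rewrite eqn_leq q1.
  by rewrite mul1n.
have pq := pdiv_prime q1; have pdq := pdiv_dvd q.
have q'0 : (0 < q %/ pdiv q)%N by rewrite divn_gt0 ?prime_gt0// dvdn_leq.
rewrite -{1}(divnK pdq) mulnAC; apply: (le_trans (block_weight_step _ _ pq)).
  by rewrite muln_gt0 q'0.
by apply: ih => //; rewrite ltnS in qm; rewrite (leq_trans _ qm)// ltn_Pdiv// prime_gt1.
Qed.

(** block_const comes from a geometric series with ratio gain. *)
Definition gain : R := 2 `^ (- delta).
Definition block_const : R :=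
  ((2 * ln 2 + (1 + \sum_(p <- P) ln p%:R)) / ln 2) `^ delta / (1 - gain).

Lemma gain_lt1 : gain < 1.
Proof. exact: powR2_lt1. Qed.

Lemma block_const_ge0 : 0 <= block_const.
Proof. by rewrite divr_ge0 ?powR_ge0// subr_ge0 ltW// gain_lt1. Qed.

Lemma sum_block_weight k (L : nat) : (0 < k)%N ->
  \sum_(0 <= l < L | (block k <= l)%N) block_weight l k <= block_const * (w k)^-1.
Proof.
move=> k0; rewrite mulrC /block_weight -mulr_sumr ler_wpM2l ?invr_ge0 ?(ltW (w_gt0 k0))//.
have l20 := ln2_gt0.
have C0 : 0 <= 1 + \sum_(p <- P) ln p%:R :> R.
  by rewrite addr_ge0// sumr_ge0// => p _; exact: ln_nat_ge0.
set C := 1 + _ in C0.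
have g0 : 0 <= gain by exact: powR_ge0.
pose A := (2 * ln 2 + C) / ln 2 : R.
have l20' := ltW l20.
have A0 : 0 <= A by rewrite /A divr_ge0// addr_ge0// mulr_ge0.
have term l : (block k <= l)%N ->
    (logsize k / (2 ^+ l * ln 2)) `^ delta <= A `^ delta * gain ^+ (l - block k).
  move=> kl; have -> : gain ^+ (l - block k) = (2 ^- (l - block k)) `^ delta.
    rewrite /gain -powR_mulrn ?powR_ge0// -powRrM mulNr mulrC -mulrN powRrM.
    by rewrite powR_mulrn// -[_^-1]powR_inv1 ?exprn_ge0// -powRrM mulN1r.
  have i0 : 0 <= (2 : R) ^- (l - block k) by rewrite invr_ge0 exprn_ge0.
  have c0 : 0 < 2 ^+ l * ln 2 :> R by rewrite mulr_gt0 ?exprn_gt0.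
  rewrite -powRM//; apply: ge0_ler_powR; rewrite ?nnegrE ?(ltW delta0)//.
  - by rewrite divr_ge0 ?(ltW c0) ?(ltW (logsize_gt0 _)).
  - exact: mulr_ge0.
  rewrite ler_pdivrMr// /logsize -/C.
  have -> : A * 2 ^- (l - block k) * (2 ^+ l * ln 2) = 2 ^+ (block k) * (2 * ln 2 + C).
    rewrite -{2}(subnK kl) exprD /A; field.
    by rewrite (gt_eqF l20) expf_neq0// pnatr_eq0.
  have := block_upper k; rewrite exprS.
  have h1 : 1 <= 2 ^+ block k :> R by rewrite exprn_ege1// ler1n.
  have := ler_wpM2r C0 h1; lra.
apply: (@le_trans _ _ (\sum_(0 <= l < L | (block k <= l)%N) A `^ delta * gain ^+ (l - block k))).
  by rewrite big_nat_cond [leRHS]big_nat_cond; apply: ler_sum => l /andP[_]; exact: term.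
rewrite -mulr_sumr /block_const -/C -/A ler_wpM2l ?powR_ge0//.
have -> : \sum_(0 <= l < L | (block k <= l)%N) gain ^+ (l - block k) =
    \sum_(0 <= i < L - block k) gain ^+ i.
  have := big_nat_widenl (block k) 0 L xpredT (fun l => gain ^+ (l - block k)) (leq0n _).
  move=> /= <-; rewrite -{1}[block k]add0n big_addn.
  by apply: eq_bigr => i _; rewrite addnK.
exact: geometric_sum_le _ g0 gain_lt1.
Qed.

Variable B : nat -> CC R.
Hypothesis B_smooth : forall n, (0 < n)%N -> B n != 0 -> smooth P n.
Hypothesis B1 : B 1 = 0.
Hypothesis B_summable : forall x, 0 < x -> dsummable B x.

(** The Volterra operator on coefficients, where B lists the numbers b_n log n. *)
Definition volterra_coef (a : nat -> CC R) (n : nat) : CC R :=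
  ((ln n%:R)^-1)%:C%C * dconv a B n.

(** For x = abscissa l, smooth_part n ^ x is at most 4 in the block l. *)
Let abscissa (l : nat) : R := (2 ^+ l)^-1.

Let abscissa_gt0 l : 0 < abscissa l.
Proof. by rewrite invr_gt0 exprn_gt0. Qed.

Let Bshift l n : CC R := (n%:R `^ (- abscissa l))%:C%C * B n.

Lemma dirichlet_shift l t :
  dirichlet (Bshift l) (cpt 0 t) = dirichlet B (cpt (abscissa l) t).
Proof.
rewrite /dirichlet (_ : dirichlet_psum (Bshift l) _ =
  dirichlet_psum B (cpt (abscissa l) t))//; apply/funext => N.
by apply: eq_bigr => n _; rewrite /npow /= oppr0 powRr0 mul1r /Bshift; ring.
Qed.

Lemma dconv_smooth_part1 a n : (0 < n)%N -> smooth_part n = 1%N -> dconv a B n = 0.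
Proof.
move=> n0 s1; rewrite /dconv big_seq big1// => k; rewrite -dvdn_divisors// => kn.
have nk0 : (0 < n %/ k)%N by rewrite divn_gt0 ?(dvdn_gt0 n0 kn)// dvdn_leq.
have [->|Bn] := eqVneq (B (n %/ k)%N) 0; first by rewrite mulr0.
have := smooth_part_dvdn n0 (dvdn_div kn); rewrite smooth_part_smooth ?B_smooth// s1 dvdn1.
by move=> /eqP ->; rewrite B1 mulr0.
Qed.

(** Convolution values in a block only see the input in the blocks up to it.
    There the rescaling by smooth_part n ^ -x with x = 2 ^ -l costs a factor at most 4
    and replaces B by the coefficients of its sum on the line of abscissa x. *)
Lemma block_bound l (Nl : R) (Y : nat) a :
  (forall t, cabs (dirichlet B (cpt (abscissa l) t)) <= Nl) ->
  \sum_(1 <= n < Y | (block n == l) && (1 < smooth_part n)%N)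
     (w n)^-1 * cabs (dconv a B n) ^+ 2 <=
  16 * Nl ^+ 2 * \sum_(1 <= k < Y | (block k <= l)%N)
     block_weight l k * cabs (a k) ^+ 2.
Proof.
move=> hN; set x := abscissa l; have x0 : 0 < x := abscissa_gt0 l.
pose A k : CC R := if (block k <= l)%N then ((smooth_part k)%:R `^ (- x))%:C%C * a k else 0.
have [S hS] := B_summable x0.
have sumB N : \sum_(1 <= n < N) cabs (Bshift l n) <= S.
  apply: le_trans (hS N); apply: ler_sum_nat1 => n n0.
  by rewrite /Bshift cabsM cabs_real ger0_norm ?powR_ge0// mulrC.
have bndB t : cabs (dirichlet (Bshift l) (cpt 0 t)) <= Nl by rewrite dirichlet_shift.
have u0 n : (0 < n < Y)%N -> 0 <= block_weight l n.
  by case/andP => n0 _; exact: block_weight_ge0.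
have ud n k : (0 < n < Y)%N -> (k %| n)%N -> block_weight l n <= block_weight l k.
  by case/andP => n0 _; exact: block_weight_dvdn.
have main := weighted_multiplier_bound A sumB bndB u0 ud.
have AE n : (0 < n)%N -> block n = l ->
    dconv A (Bshift l) n = ((smooth_part n)%:R `^ (- x))%:C%C * dconv a B n.
  move=> n0 nl; rewrite /dconv mulr_sumr big_seq [RHS]big_seq.
  apply: eq_bigr => k; rewrite -dvdn_divisors// => kn.
  have nk0 : (0 < n %/ k)%N by rewrite divn_gt0 ?(dvdn_gt0 n0 kn)// dvdn_leq.
  have [Bz|Bn] := eqVneq (B (n %/ k)%N) 0; first by rewrite /Bshift Bz !mulr0.
  rewrite /A -nl block_mono// /Bshift.
  have -> : smooth_part n = (smooth_part k * (n %/ k))%N.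
    have sk : smooth_part (n %/ k)%N = (n %/ k)%N by apply: smooth_part_smooth => //; exact: B_smooth.
    by rewrite -{1}(divnK kn) smooth_partM ?(dvdn_gt0 n0 kn)// sk mulnC.
  rewrite nl natrM powRM// rmorphM/= -/x; ring.
apply: (@le_trans _ _ (16 * \sum_(1 <= n < Y) block_weight l n * cabs (dconv A (Bshift l) n) ^+ 2)); last first.
  rewrite -mulrA ler_wpM2l//; apply: (le_trans main).
  rewrite ler_wpM2l ?sqr_ge0// [leRHS]big_mkcond/=.
  apply: ler_sum_nat1 => k k0; rewrite /A; case: ifP => _; last first.
    by have -> : cabs (0 : CC R) ^+ 2 = 0 by [rewrite cabs0 expr0n]; rewrite mulr0.
  rewrite ler_wpM2l ?block_weight_ge0// lerXn2r ?nnegrE ?cabs_ge0//.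
  rewrite cabsM cabs_real ger0_norm ?powR_ge0// ler_piMl ?cabs_ge0//.
  have := @powR_nat_le R (smooth_part k) (- x) 0 (smooth_part_gt0 k).
  by rewrite powRr0; apply; rewrite oppr_le0 ltW.
rewrite mulr_sumr big_mkcond/=; apply: ler_sum_nat1 => n n0.
have sw : 0 <= block_weight l n * cabs (dconv A (Bshift l) n) ^+ 2.
  by rewrite mulr_ge0 ?sqr_ge0 ?block_weight_ge0.
case: ifPn => [/andP[/eqP nl s1]|_]; last by rewrite mulr_ge0.
rewrite AE// cabsM cabs_real ger0_norm ?powR_ge0// exprMn.
have l20 := ln2_gt0.
have h4 : (smooth_part n)%:R `^ x <= 4 :> R.
  have -> : 4 = expR (2 * ln 2) :> R.
    by rewrite mulr_natl -lnXn// lnK ?posrE ?exprn_gt0//; ring.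
  rewrite /powR gt_eqF ?ltr0n ?smooth_part_gt0// ler_expR.
  have := block_upper n; rewrite nl exprS /x /abscissa => h.
  by rewrite mulrC ler_pdivrMr ?exprn_gt0//; apply: (le_trans h); rewrite mulrAC.
have p0 : 0 < (smooth_part n)%:R `^ (- x) :> R by rewrite powR_gt0// ltr0n smooth_part_gt0.
have h16 : 1 <= 16 * ((smooth_part n)%:R `^ (- x)) ^+ 2 :> R.
  have : 4^-1 <= (smooth_part n)%:R `^ (- x) :> R.
    by rewrite powRN lef_pV2 ?posrE ?powR_gt0 ?ltr0n ?smooth_part_gt0.
  move: ((smooth_part n)%:R `^ (- x)) p0 => q q0 q4; nra.
have hv : (w n)^-1 <= block_weight l n.
  rewrite /block_weight ler_peMr ?invr_ge0 ?(ltW (w_gt0 n0))//.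
  have e1 : 1 `^ delta = 1 :> R by rewrite powR1.
  rewrite -[leLHS]e1; apply: ge0_ler_powR; rewrite ?nnegrE ?(ltW delta0)//.
    by rewrite divr_ge0 ?(ltW (logsize_gt0 _))// mulr_ge0 ?exprn_ge0// ltW.
  rewrite ler_pdivlMr ?mulr_gt0 ?exprn_gt0// mul1r /logsize -nl.
  apply: (le_trans (block_lower s1)); rewrite lerDl addr_ge0//.
  by rewrite sumr_ge0// => p _; exact: ln_nat_ge0.
have c0 : 0 <= cabs (dconv a B n) ^+ 2 := sqr_ge0 _.
rewrite [leRHS](_ : _ = (16 * ((smooth_part n)%:R `^ (- x)) ^+ 2) *
  (block_weight l n * cabs (dconv a B n) ^+ 2)); last by ring.
apply: (@le_trans _ _ (block_weight l n * cabs (dconv a B n) ^+ 2)).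
  by rewrite ler_wpM2r.
by rewrite ler_peMl// mulr_ge0// block_weight_ge0.
Qed.

(** If the supremum N_l on the line of abscissa 2 ^ -l is small compared with
    log n for the n >= X of the block l, then the part of the output beyond X is
    small compared with the input: the gain of the block weights makes the sum
    over the blocks converge. *)
Lemma tail_bound (eta : R) (X : nat) :
  0 <= eta -> (0 < X)%N ->
  (forall l, exists Nl : R, [/\ 0 < Nl,
     forall t, cabs (dirichlet B (cpt (abscissa l) t)) <= Nl &
     forall n, (X <= n)%N -> block n = l -> (1 < smooth_part n)%N ->
       Nl ^+ 2 <= eta * ln n%:R ^+ 2]) ->
  forall (a : nat -> CC R) (Y : nat),
  \sum_(X <= n < Y) cabs (volterra_coef a n) ^+ 2 / w n <=
  16 * block_const * eta * \sum_(1 <= k < Y) cabs (a k) ^+ 2 / w k.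
Proof.
move=> eta0 X0 hN a Y.
pose F n := cabs (volterra_coef a n) ^+ 2 / w n.
have F0 n : (0 < n)%N -> 0 <= F n.
  by move=> n0; rewrite mulr_ge0 ?sqr_ge0// invr_ge0 ltW// w_gt0.
have [XY|YX] := ltnP X Y; last first.
  rewrite big_geq//; apply: mulr_ge0; first by rewrite mulr_ge0// mulr_ge0 ?block_const_ge0.
  rewrite big_nat sumr_ge0// => k /andP[k0 _].
  by rewrite mulr_ge0 ?sqr_ge0// invr_ge0 ltW// w_gt0.
have -> : \sum_(X <= n < Y) F n = \sum_(0 <= l < Y) \sum_(X <= n < Y | block n == l) F n.
  rewrite (exchange_big_dep xpredT)//= [LHS]big_nat [RHS]big_nat; apply: eq_bigr => n /andP[Xn nY].
  have n0 := leq_trans X0 Xn.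
  rewrite (big_rem (block n))/=; last first.
    by rewrite mem_index_iota/= (leq_ltn_trans (block_leq n0)).
  rewrite eqxx big1_seq ?addr0// => l /andP[/eqP <-].
  by rewrite mem_rem_uniq ?iota_uniq// !inE eqxx.
apply: (@le_trans _ _ (\sum_(0 <= l < Y) 16 * eta *
    \sum_(1 <= k < Y | (block k <= l)%N) block_weight l k * cabs (a k) ^+ 2)).
  apply: ler_sum => l _; have [Nl [N0 Nb Nln]] := hN l.
  have N20 : 0 < Nl ^+ 2 by rewrite exprn_gt0.
  apply: (@le_trans _ _ (eta / Nl ^+ 2 *
    \sum_(1 <= n < Y | (block n == l) && (1 < smooth_part n)%N) (w n)^-1 * cabs (dconv a B n) ^+ 2)).
    rewrite mulr_sumr big_mkcond [leRHS]big_mkcond/=.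
    rewrite [leRHS](@big_cat_nat _ _ _ X)//=; last exact: ltnW.
    have G0 n : (0 < n)%N -> 0 <= if (block n == l) && (1 < smooth_part n)%N then
        eta / Nl ^+ 2 * ((w n)^-1 * cabs (dconv a B n) ^+ 2) else 0.
      move=> n0; case: ifP => // _.
      have wn := ltW (w_gt0 n0); have N2 := ltW N20.
      by rewrite mulr_ge0 ?divr_ge0// mulr_ge0 ?invr_ge0 ?sqr_ge0.
    apply: ler_wpDl; first by rewrite big_nat sumr_ge0// => n /andP[n0 _]; exact: G0.
    apply: ler_sum_nat => n /andP[Xn nY]; have n0 := leq_trans X0 Xn.
    case: (eqVneq (block n) l) => [nl|nl] //=.
    case: ltnP => s1; last first.
      have s1' : smooth_part n = 1%N by apply/eqP; rewrite eqn_leq s1 smooth_part_gt0.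
      rewrite /F /volterra_coef (dconv_smooth_part1 a n0 s1') mulr0.
      by have -> : cabs (0 : CC R) ^+ 2 = 0 by [rewrite cabs0 expr0n]; rewrite mul0r.
    have h := Nln n Xn nl s1.
    rewrite /F /volterra_coef cabsM cabs_real exprMn normfV exprVn real_normK ?num_real//.
    have ln0 : 0 < ln n%:R :> R.
      by rewrite ln_gt0// ltr1n (leq_trans s1)// smooth_part_leq.
    have hk : (ln n%:R ^+ 2)^-1 <= eta / Nl ^+ 2.
      rewrite ler_pdivlMr// mulrC ler_pdivrMr ?exprn_gt0//.
    rewrite [leLHS](_ : _ = (ln n%:R ^+ 2)^-1 * ((w n)^-1 * cabs (dconv a B n) ^+ 2)); last by ring.
    by rewrite ler_wpM2r// mulr_ge0 ?sqr_ge0// invr_ge0 ltW// w_gt0.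
  rewrite [leRHS](_ : _ = eta / Nl ^+ 2 * (16 * Nl ^+ 2 *
    \sum_(1 <= k < Y | (block k <= l)%N) block_weight l k * cabs (a k) ^+ 2)).
    by rewrite ler_wpM2l ?block_bound// divr_ge0// ltW.
  by field; rewrite gt_eqF.
rewrite -mulr_sumr.
have -> : 16 * block_const * eta = 16 * eta * block_const by ring.
rewrite -[leRHS]mulrA ler_wpM2l ?mulr_ge0//.
under eq_bigr do rewrite big_mkcond/=.
rewrite exchange_big/= mulr_sumr; apply: ler_sum_nat1 => k k0.
rewrite -big_mkcond/= -mulr_suml [leRHS](_ : _ = block_const * (w k)^-1 * cabs (a k) ^+ 2).
  by rewrite ler_wpM2r ?sqr_ge0// sum_block_weight.
ring.
Qed.

End Tail.

(** * Products of Dirichlet series *)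

Section Product.
Variable R : realType.
Implicit Types (a b : nat -> CC R).

Lemma dconv_abs_le a b (N : nat) :
  \sum_(1 <= n < N) cabs (dconv a b n) <=
  (\sum_(1 <= n < N) cabs (a n)) * (\sum_(1 <= n < N) cabs (b n)).
Proof.
apply: (@le_trans _ _ (\sum_(1 <= n < N) \sum_(k <- divisors n) cabs (a k) * cabs (b (n %/ k)%N))).
  apply: ler_sum => n _; apply: (le_trans (cabs_sum _ _ _)).
  by apply: ler_sum => k _; rewrite cabsM.
rewrite (sum_dconv_pairs N (fun k m => cabs (a k) * cabs (b m))) mulr_suml.
apply: ler_sum => k _; rewrite mulr_sumr [leLHS]big_mkcond/=.
by apply: ler_sum => m _; case: ifP => // _; rewrite mulr_ge0 ?cabs_ge0.
Qed.

(** Mertens: the difference between the product of the partial sums and the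
    partial sum of the convolution only contains pairs with k * m >= N, in which
    one index is at least the square root of N. *)
Lemma dconv_cvg a b (S : R) (la lb : CC R) :
  (forall N, \sum_(1 <= n < N) cabs (a n) <= S) ->
  (forall N, \sum_(1 <= n < N) cabs (b n) <= S) ->
  psum a @ \oo --> la -> psum b @ \oo --> lb ->
  psum (dconv a b) @ \oo --> la * lb.
Proof.
move=> ha hb al bl; apply/cvg_cabsP => e e0.
have S0 : 0 <= S by have := ha 0%N; rewrite big_geq.
pose d := e / (5 * (S + 1)).
have S1 : 0 < S + 1 by rewrite ltr_wpDl.
have d0 : 0 < d by rewrite divr_gt0// mulr_gt0.
have [r1 r10 h1] := small_tail (fun n => cabs_ge0 (a n)) d0 ha.
have [r2 r20 h2] := small_tail (fun n => cabs_ge0 (b n)) d0 hb.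
pose r := maxn r1 r2.
have tail (c : nat -> CC R) r' M : (0 < r')%N -> (r' <= r)%N -> (forall M, \sum_(r' <= n < M) cabs (c n) <= d) ->
    \sum_(1 <= n < M | (r <= n)%N) cabs (c n) <= d.
  move=> r'0 r'r hc; apply: le_trans (hc M).
  rewrite [leRHS](@big_nat_widenl _ _ _ _ 1)//=.
  rewrite [leLHS]big_nat_cond [leRHS]big_nat_cond; apply: ler_sum_nn => [n|n].
    exact: cabs_ge0.
  by move=> /andP[-> rn]/=; rewrite (leq_trans r'r).
have sum0 (c : nat -> CC R) M (Q : pred nat) : 0 <= \sum_(1 <= n < M | Q n) cabs (c n).
  by apply: sumr_ge0 => n _; exact: cabs_ge0.
near=> N.
have rN : (r * r <= N)%N by near: N; exists (r * r)%N.
have r1N : (r1 <= N)%N.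
  by rewrite (leq_trans _ rN)// (leq_trans (leq_maxl r1 r2))// leq_pmulr// leq_max r10.
have r2N : (r2 <= N)%N.
  by rewrite (leq_trans _ rN)// (leq_trans (leq_maxr r1 r2))// leq_pmulr// leq_max r10.
have pa : cabs (psum a N) <= S by apply: (le_trans (cabs_sum _ _ _)); exact: ha.
have lbS : cabs lb <= S.
  by apply: (cabs_lim_le bl); near=> M; apply: (le_trans (cabs_sum _ _ _)); exact: hb.
have tl (c : nat -> CC R) (l : CC R) r' : (0 < r')%N -> (r' <= N)%N -> psum c @ \oo --> l ->
    (forall M, \sum_(r' <= n < M) cabs (c n) <= d) -> cabs (l - psum c N) <= d.
  move=> r'0 r'N cl hc; apply: csum_tail => //; first by rewrite (leq_trans r'0).
  move=> M; apply: le_trans (hc M); apply: ler_sum_subrange => // n _.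
  exact: cabs_ge0.
have da : cabs (la - psum a N) <= d by exact: (tl _ _ r1).
have db : cabs (lb - psum b N) <= d by exact: (tl _ _ r2).
have E : psum a N * psum b N - psum (dconv a b) N =
    \sum_(1 <= k < N) \sum_(1 <= m < N | (N <= k * m)%N) a k * b m.
  rewrite /psum (sum_dconv_pairs N (fun k m => a k * b m)) mulr_suml -sumrB.
  apply: eq_bigr => k _; rewrite mulr_sumr (bigID (fun m => (k * m < N)%N))/= addrAC subrr add0r.
  by apply: eq_bigl => m; rewrite -leqNgt.
have hE : cabs (psum a N * psum b N - psum (dconv a b) N) <= d * S + S * d.
  rewrite E; apply: (le_trans (cabs_sum _ _ _)).
  apply: (@le_trans _ _ (\sum_(1 <= k < N) \sum_(1 <= m < N)
      ((if (r <= k)%N then cabs (a k) else 0) * cabs (b m) +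
       cabs (a k) * (if (r <= m)%N then cabs (b m) else 0)))).
    apply: ler_sum => k _; apply: (le_trans (cabs_sum _ _ _)).
    rewrite [leLHS]big_mkcond/=; apply: ler_sum => m _.
    have c1 := cabs_ge0 (a k); have c2 := cabs_ge0 (b m).
    case: ifPn => [Nkm|_]; last by apply: addr_ge0; apply: mulr_ge0 => //; case: ifP.
    rewrite cabsM; case: leqP => rk; first by rewrite lerDl mulr_ge0//; case: ifP.
    case: leqP => rm; first by rewrite mul0r add0r.
    have : (k * m < r * r)%N by exact: ltn_mul.
    by rewrite ltnNge (leq_trans rN Nkm).
  under eq_bigr do rewrite big_split/= -mulr_sumr -mulr_sumr.
  rewrite big_split/= -mulr_suml -mulr_suml -!big_mkcond/=; apply: lerD.
    apply: ler_pM; [exact: sum0|exact: sum0| |exact: hb].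
    by apply: (tail _ r1) => //; rewrite leq_maxl.
  apply: ler_pM; [exact: sum0|exact: sum0|exact: ha|].
  by apply: (tail _ r2) => //; rewrite leq_maxr.
have -> : la * lb - psum (dconv a b) N = (la - psum a N) * lb +
    psum a N * (lb - psum b N) + (psum a N * psum b N - psum (dconv a b) N) by ring.
apply: (@le_lt_trans _ _ (d * S + S * d + (d * S + S * d))).
  rewrite (le_trans (cabsD _ _))// lerD// (le_trans (cabsD _ _))// lerD// cabsM.
    by rewrite ler_pM ?cabs_ge0.
  by rewrite ler_pM ?cabs_ge0.
have -> : e = 5 * d * (S + 1) by rewrite /d; field; rewrite gt_eqF.
have := mulr_ge0 (ltW d0) S0; nra.
Unshelve. all: by end_near. Qed.

Lemma dconv_npow a b s n : (0 < n)%N ->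
  dconv (fun k => a k * npow k s) (fun k => b k * npow k s) n = dconv a b n * npow n s.
Proof.
move=> n0; rewrite /dconv mulr_suml big_seq [RHS]big_seq.
apply: eq_bigr => k; rewrite -dvdn_divisors// => kn.
have nk0 : (0 < n %/ k)%N by rewrite divn_gt0 ?(dvdn_gt0 n0 kn)// dvdn_leq.
by rewrite -{4}(divnK kn) mulnC npowM ?(dvdn_gt0 n0 kn)//; ring.
Qed.

Lemma dsummable_terms a s (N : nat) :
  \sum_(1 <= n < N) cabs (a n * npow n s) =
  \sum_(1 <= n < N) cabs (a n) * n%:R `^ (- complex.Re s).
Proof. by apply: eq_bigr => n _; rewrite cabs_dirichlet_term. Qed.

Lemma dsummable_dconv a b x : dsummable a x -> dsummable b x ->
  dsummable (dconv a b) x.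
Proof.
move=> [S hS] [S' hS']; exists (S * S') => N.
pose s : CC R := cpt x 0.
rewrite -(dsummable_terms _ s).
rewrite (_ : \sum_(1 <= n < N) _ = \sum_(1 <= n < N)
   cabs (dconv (fun k => a k * npow k s) (fun k => b k * npow k s) n)); last first.
  by apply: eq_big_nat => n /andP[n0 _]; rewrite dconv_npow.
apply: (le_trans (dconv_abs_le _ _ _)); rewrite !dsummable_terms.
by apply: ler_pM; rewrite // sumr_ge0// => n _; rewrite mulr_ge0 ?cabs_ge0 ?powR_ge0.
Qed.

Lemma dirichlet_dconv a b s x : dsummable a x -> dsummable b x ->
  x <= complex.Re s ->
  dirichlet (dconv a b) s = dirichlet a s * dirichlet b s.
Proof.
move=> ax bx xs; have [S hS] := dsummable_le xs ax; have [S' hS'] := dsummable_le xs bx.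
apply: dirichlet_unique; rewrite /is_dirichlet.
pose S2 := Num.max S S'.
have h1 N : \sum_(1 <= n < N) cabs (a n * npow n s) <= S2.
  by rewrite dsummable_terms (le_trans (hS N))// le_max lexx.
have h2 N : \sum_(1 <= n < N) cabs (b n * npow n s) <= S2.
  by rewrite dsummable_terms (le_trans (hS' N))// le_max lexx orbT.
have := dconv_cvg h1 h2 (is_dirichletP ax xs) (is_dirichletP bx xs).
suff -> : dirichlet_psum (dconv a b) s =
  psum (dconv (fun k => a k * npow k s) (fun k => b k * npow k s)) by [].
apply/funext => N; apply: eq_big_nat => n /andP[n0 _].
by rewrite dconv_npow.
Qed.

End Product.

(** * Divisor sums and moments of the divisor function *)

Section Divisors.

Lemma sum_divisors_pfactor (V : nmodType) (p k m : nat) (F : nat -> V) :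
  prime p -> (0 < m)%N -> coprime p m ->
  \sum_(j <- divisors (p ^ k * m)) F j =
  \sum_(0 <= i < k.+1) \sum_(j <- divisors m) F (p ^ i * j)%N.
Proof.
move=> pp m0 pm; have p0 := prime_gt0 pp.
have n0 : (0 < p ^ k * m)%N by rewrite muln_gt0 expn_gt0 p0 m0.
pose A := [seq (p ^ i * j)%N | i <- index_iota 0 k.+1, j <- divisors m].
have -> : \sum_(0 <= i < k.+1) \sum_(j <- divisors m) F (p ^ i * j)%N = \sum_(j <- A) F j.
  by rewrite /A big_allpairs_dep.
have cpj j : (j %| m)%N -> coprime p j by move=> jm; exact: coprime_dvdr jm pm.
apply: perm_big; apply: uniq_perm; first exact: divisors_uniq.
  apply: allpairs_uniq; [exact: iota_uniq|exact: divisors_uniq|].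
  move=> u v /allpairsP hu /allpairsP hv.
  case: hu => -[x y] /= [_ ym ->]; case: hv => -[x' y'] /= [_ ym' ->] e.
  rewrite -!dvdn_divisors// in ym ym'.
  have y0 := dvdn_gt0 m0 ym; have y'0 := dvdn_gt0 m0 ym'.
  have := congr1 (logn p) e; rewrite /uncurry/= !lognM ?expn_gt0 ?p0// !pfactorK//.
  rewrite !logn_coprime ?cpj// !addn0 => xx; move: e; rewrite /uncurry/= xx => /eqP.
  by rewrite eqn_pmul2l ?expn_gt0 ?p0// => /eqP ->.
move=> j; rewrite -dvdn_divisors//; apply/idP/allpairsP => [jn|]; last first.
  case=> -[i j'] /= [ik j'm ->]; rewrite mem_index_iota ltnS /= in ik.
  by rewrite -dvdn_divisors// in j'm; rewrite dvdn_mul// dvdn_exp2l.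
have j0 := dvdn_gt0 n0 jn; have [j' pj' jE] := pfactor_coprime pp j0.
  have : (p ^ logn p j %| p ^ k * m)%N by rewrite (dvdn_trans _ jn)// {2}jE dvdn_mull.
  rewrite Gauss_dvdl ?coprimeXl// dvdn_Pexp2l ?prime_gt1// => ik.
  exists (logn p j, j') => /=; split; [by rewrite mem_index_iota ltnS| |by rewrite mulnC].
  rewrite -dvdn_divisors//; have : (j' %| p ^ k * m)%N by rewrite (dvdn_trans _ jn)// jE dvdn_mulr.
  by rewrite Gauss_dvdr// coprimeXr// coprime_sym.
Qed.

Lemma size_divisors_pfactor (p k m : nat) : prime p -> (0 < m)%N -> coprime p m ->
  size (divisors (p ^ k * m)) = (k.+1 * size (divisors m))%N.
Proof.
move=> pp m0 pm.
have sz n : size (divisors n) = (\sum_(j <- divisors n) 1)%N by rewrite sum1_size.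
rewrite !sz (@sum_divisors_pfactor nat _ _ _ (fun=> 1%N))//.
by rewrite sum_nat_const_nat subn0.
Qed.

Lemma size_divisors_gt0 n : (0 < size (divisors n))%N.
Proof. by have := divisor1 n; case: (divisors n). Qed.

Lemma size_divisors_mul k l : (0 < k)%N -> (0 < l)%N ->
  (size (divisors (k * l)) <= size (divisors k) * size (divisors l))%N.
Proof.
move=> k0 l0; rewrite -(size_allpairs muln); apply: uniq_leq_size.
  exact: divisors_uniq.
move=> j; rewrite -dvdn_divisors ?muln_gt0 ?k0// => jkl.
have j0 : (0 < j)%N by apply: dvdn_gt0 jkl; rewrite muln_gt0 k0.
apply/allpairsP; exists (gcdn j k, (j %/ gcdn j k)%N) => /=.
have g0 : (0 < gcdn j k)%N by rewrite gcdn_gt0 j0.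
rewrite -!dvdn_divisors// dvdn_gcdr; split => //; last by rewrite mulnC divnK// dvdn_gcdl.
have : (j %/ gcdn j k %| (k %/ gcdn j k) * l)%N.
  rewrite -(dvdn_pmul2r g0) divnK ?dvdn_gcdl// -mulnA [(l * _)%N]mulnC mulnA.
  by rewrite divnK// dvdn_gcdr.
rewrite Gauss_dvdr//; rewrite /coprime -(eqn_pmul2r g0) mul1n muln_gcdl.
by rewrite !divnK ?dvdn_gcdl ?dvdn_gcdr.
Qed.

End Divisors.

Section RealSums.
Variable R : realType.

(** Dyadic condensation. *)
Lemma zeta_bounded (x : R) : 1 < x ->
  exists S : R, forall N, \sum_(1 <= n < N) n%:R `^ (- x) <= S.
Proof.
move=> x1; pose g : R := 2 `^ (1 - x).
have g0 : 0 <= g by exact: powR_ge0.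
have g1 : g < 1 by rewrite /g -opprB powR2_lt1// subr_gt0.
exists (1 - g)^-1 => N.
have dyadic J : \sum_(1 <= n < 2 ^ J) n%:R `^ (- x) <= \sum_(0 <= j < J) g ^+ j.
  elim: J => [|J ih]; first by rewrite !big_geq.
  have J0 : (0 < 2 ^ J)%N by rewrite expn_gt0.
  rewrite big_nat_recr//= (@big_cat_nat _ _ _ (2 ^ J))//=; last by rewrite leq_exp2l.
  apply: lerD => //.
  apply: (@le_trans _ _ (\sum_(2 ^ J <= n < 2 ^ J.+1) (2 ^ J)%N%:R `^ (- x))).
    apply: ler_sum_nat => n /andP[n1 _]; have n0 := leq_trans J0 n1.
    rewrite !powRN lef_pV2 ?posrE ?powR_gt0 ?ltr0n//.
    have x0 : 0 <= x by rewrite ltW// (lt_trans ltr01).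
    by apply: ge0_ler_powR; rewrite ?nnegrE ?ler_nat.
  rewrite sumr_const_nat expnS mul2n -addnn addnK.
  rewrite -[_ *+ _]mulr_natl natrX /g powRD ?pnatr_eq0 ?implybT// powRr1// exprMn.
  rewrite ler_wpM2l ?exprn_ge0//.
  by rewrite -powR_mulrn// -[X in _ <= X]powR_mulrn ?powR_ge0// -!powRrM mulrC.
apply: (@le_trans _ _ (\sum_(1 <= n < 2 ^ N) n%:R `^ (- x))).
  by apply: ler_sum_subrange => [//||n _]; [exact/ltnW/ltn_expl|exact: powR_ge0].
exact: le_trans (dyadic N) (geometric_sum_le N g0 g1).
Qed.

(** As d(k l) <= d(k) d(l), the convolution square of d(n) ^ r * n ^ -x dominates
    d(n) ^ (r + 1) * n ^ -x. *)
Lemma size_divisors_pow_summable (r : nat) (x : R) : 1 < x ->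
  exists S : R, forall N,
    \sum_(1 <= n < N) (size (divisors n))%:R ^+ r * n%:R `^ (- x) <= S.
Proof.
move=> x1; elim: r => [|r [S hS]].
  have [S hS] := zeta_bounded x1; exists S => N.
  by under eq_bigr do rewrite expr0 mul1r; exact: hS.
pose f n : R := (size (divisors n))%:R ^+ r * n%:R `^ (- x).
have f0 n : 0 <= f n by rewrite mulr_ge0 ?exprn_ge0 ?powR_ge0.
exists (S * S) => N.
apply: (@le_trans _ _ (\sum_(1 <= n < N) \sum_(k <- divisors n) f k * f (n %/ k)%N)).
  apply: ler_sum_nat1 => n n0.
  rewrite exprS -mulrA mulr_natl.
  have -> : (f n) *+ size (divisors n) = \sum_(k <- divisors n) f n.
    by rewrite big_const_seq count_predT iter_addr_0.
  rewrite big_seq [leRHS]big_seq; apply: ler_sum => k; rewrite -dvdn_divisors// => kn.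
  have k0 := dvdn_gt0 n0 kn.
  have nk0 : (0 < n %/ k)%N by rewrite divn_gt0// dvdn_leq.
  rewrite /f mulrACA -powRM// -natrM mulnC divnK// -exprMn ler_wpM2r ?powR_ge0//.
  rewrite lerXn2r ?nnegrE// -natrM ler_nat.
  by rewrite -{1}(divnK kn) mulnC size_divisors_mul.
rewrite (sum_dconv_pairs N (fun k m => f k * f m)).
apply: (@le_trans _ _ ((\sum_(1 <= n < N) f n) * (\sum_(1 <= n < N) f n))); last first.
  have fs M : 0 <= \sum_(1 <= n < M) f n by rewrite sumr_ge0.
  by apply: ler_pM; rewrite ?fs ?hS.
rewrite mulr_suml; apply: ler_sum => k _; rewrite mulr_sumr [leLHS]big_mkcond/=.
by apply: ler_sum => m _; case: ifP => // _; rewrite mulr_ge0.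
Qed.

(** For the exponent d = c / (1 + c), the bounds exp (d y) <= 1 / (1 - d y) and
    1 / (1 - d y) <= 1 + c y hold up to y = 1. *)
Lemma bernoulli_powR (c y : R) : 0 < c -> 0 <= y <= 1 ->
  (1 + y) `^ (c / (1 + c)) <= 1 + c * y.
Proof.
move=> c0 /andP[y0 y1]; pose d := c / (1 + c).
have c1 : 0 < 1 + c by rewrite addr_gt0.
have d0 : 0 < d by rewrite divr_gt0.
have dE : d * (1 + c) = c by rewrite /d divfK// gt_eqF.
have d1 : d < 1 by rewrite /d ltr_pdivrMr// mul1r ltrDr.
have dy : d * y < 1 by rewrite (le_lt_trans _ d1)// ler_piMr// ltW.
have l1 : ln (1 + y) <= y by rewrite le_ln1Dx// (lt_le_trans _ y0)// ltrN10.
have y10 : 0 < 1 + y by rewrite ltr_wpDr.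
rewrite /powR gt_eqF//; apply: (@le_trans _ _ (expR (d * y))).
  by rewrite ler_expR ler_wpM2l// ltW.
apply: (@le_trans _ _ (1 - d * y)^-1).
  rewrite -[leLHS]invrK -expRN lef_pV2 ?posrE ?expR_gt0 ?subr_gt0//.
  exact: expR_ge1Dx.
have k0 : 0 < 1 - d * y by rewrite subr_gt0.
rewrite -[leLHS]mul1r ler_pdivrMr//.
have h1 : d * y * (1 + c) = c * y by rewrite mulrAC dE.
have h2 : d * y * (c * y) <= d * y * c.
  have c0' := ltW c0; have d0' := ltW d0.
  by apply: ler_wpM2l; [exact: mulr_ge0|rewrite ler_piMr].
nra.
Qed.

End RealSums.

(** * Generalized divisor functions *)

Section Uniqueness.
Variable R : realType.

(** If the first nonzero coefficient has index n, it dominates for large x. *)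
Lemma leading_term (e : nat -> CC R) (S x0 x : R) (n : nat) : (0 < n)%N ->
  (forall N, \sum_(1 <= k < N) cabs (e k) * k%:R `^ (- x0) <= S) -> x0 <= x ->
  (forall k, (0 < k < n)%N -> e k = 0) ->
  cabs (dirichlet e (cpt x 0) - e n * npow n (cpt x 0)) <=
  S * n.+1%:R `^ (x0 - x).
Proof.
move=> n0 hS x0x hk; pose s : CC R := cpt x 0.
have -> : e n * npow n s = dirichlet_psum e s n.+1.
  rewrite /dirichlet_psum big_nat_recr//= big_nat big1 ?add0r// => k hkn.
  by rewrite hk ?mul0r.
apply: csum_tail => //.
  by apply: (@is_dirichletP _ _ _ x0) => //; exists S.
move=> M; apply: (@le_trans _ _ ((\sum_(n.+1 <= k < M) cabs (e k) * k%:R `^ (- x0)) * n.+1%:R `^ (x0 - x))).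
  rewrite mulr_suml; apply: ler_sum_nat => k /andP[nk _].
  have k0 : (0 < k)%N := leq_trans (ltn0Sn n) nk.
  rewrite cabs_dirichlet_term -mulrA ler_wpM2l ?cabs_ge0//=.
  have -> : k%:R `^ (- x) = k%:R `^ (- x0) * k%:R `^ (x0 - x) :> R.
    by rewrite -powRD ?pnatr_eq0 -?lt0n ?k0 ?implybT// addrA addNr add0r.
  rewrite ler_wpM2l ?powR_ge0// -opprB !powRN lef_pV2 ?posrE ?powR_gt0 ?ltr0n//.
  by apply: ge0_ler_powR; rewrite ?nnegrE ?subr_ge0 ?ler_nat.
rewrite ler_wpM2r ?powR_ge0//; apply: le_trans (hS M).
by apply: ler_sum_subrange => // k _; rewrite mulr_ge0 ?cabs_ge0 ?powR_ge0.
Qed.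

(** Compare the decay n ^ -x of the leading term with the decay (n + 1) ^ -x of
    the remainder. *)
Lemma dirichlet_coef_unique (e : nat -> CC R) (x0 : R) : dsummable e x0 ->
  (forall x, x0 < x -> dirichlet e (cpt x 0) = 0) ->
  forall n, (0 < n)%N -> e n = 0.
Proof.
move=> [S hS] h n; have [m] := ubnP n; elim: m n => // m ih n nm n0.
have S0 : 0 <= S by have := hS 0%N; rewrite big_geq.
have hk k : (0 < k < n)%N -> e k = 0.
  by move=> /andP[k0 kn]; apply: ih => //; rewrite (leq_trans kn).
apply: cabs_eq0; apply/eqP; rewrite eq_le cabs_ge0 andbT.
have nn : 0 < n%:R :> R by rewrite ltr0n.
have nn1 : 0 < n.+1%:R :> R by rewrite ltr0n.
have q1 : 0 <= (n%:R / n.+1%:R : R) < 1.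
  by rewrite divr_ge0//= ltr_pdivrMr// mul1r ltr_nat.
have z1 : 0 <= (0 : R) < 1 by rewrite lexx ltr01.
apply: (geometric_contra q1 z1 (K1 := S * n%:R `^ (x0 + 1)) (K2 := 0)) => //.
  by rewrite mulr_ge0 ?powR_ge0.
move=> N; rewrite mul0r addr0 expr1n mulr1.
have xx : x0 < x0 + N.+1%:R by rewrite ltrDl ltr0n.
have := leading_term n0 hS (ltW xx) hk; rewrite h// sub0r cabsN cabs_dirichlet_term /=.
rewrite (powRN n%:R) ler_pdivrMr ?powR_gt0//.
rewrite (_ : x0 - (x0 + N.+1%:R) = - N.+1%:R); last by rewrite opprD addrA subrr add0r.
move=> hh.
apply: (le_trans hh).
have -> : n%:R `^ (x0 + N.+1%:R) = n%:R `^ (x0 + 1) * n%:R ^+ N :> R.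
  rewrite -natr1 (_ : x0 + (N%:R + 1) = x0 + 1 + N%:R); last by ring.
  by rewrite powRD ?(gt_eqF nn) ?implybT// powR_mulrn.
rewrite powR_invn// expr_div_n.
have i1 : (n.+1%:R ^+ N.+1)^-1 <= (n.+1%:R ^+ N)^-1 :> R.
  by rewrite lef_pV2 ?posrE ?exprn_gt0// exprS ler_peMl ?exprn_ge0// ler1n.
rewrite [leLHS](_ : _ = S * n%:R `^ (x0 + 1) * n%:R ^+ N * (n.+1%:R ^+ N.+1)^-1); last by ring.
by rewrite [leRHS]mulrA ler_wpM2l// !mulr_ge0 ?powR_ge0 ?exprn_ge0.
Qed.

End Uniqueness.

Section GeneralizedDivisor.
Variables (R : realType) (beta : R) (w : nat -> R).
Hypothesis beta0 : 0 < beta.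
Hypothesis hw : is_gen_divisor (beta + 1) w.
Let gamma := beta + 1.

Let b (n : nat) : CC R := (w n)%:C%C.
Let one (n : nat) : CC R := 1.

Let s2 (x : R) : CC R := cpt x 0.

Let npow_real n x : npow n (s2 x) = (n%:R `^ (- x))%:C%C.
Proof. by rewrite /npow /= mul0r cos0 sin0 oppr0 mulr1. Qed.

Let one_summable x : 1 < x -> dsummable one x.
Proof.
move=> x1; have [S hS] := zeta_bounded x1; exists S => N.
by under eq_bigr do rewrite cabs1 mul1r; exact: hS.
Qed.

Let zetaE x : 1 < x -> dirichlet one (s2 x) = (zeta x)%:C%C.
Proof.
move=> x1; have h := is_dirichletP (one_summable x1) (lexx (complex.Re (s2 x))).
have hr : (fun N => \sum_(1 <= n < N) n%:R `^ (- x)) @ \oo --> complex.Re (dirichlet one (s2 x)).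
  apply: cvg_trans (cvg_ReP h); apply: near_eq_cvg; near=> N.
  rewrite Re_sum; apply: eq_bigr => n _.
  by rewrite mul1r npow_real.
have hi : (fun N : nat => 0 : R) @ \oo --> complex.Im (dirichlet one (s2 x)).
  apply: cvg_trans (cvg_ImP h); apply: near_eq_cvg; near=> N.
  by rewrite Im_sum big1// => n _; rewrite mul1r npow_real.
apply: eq_ReIm => /=; first by rewrite /zeta (cvg_lim _ hr).
by rewrite -(cvg_lim (@Rhausdorff R) hi) lim_cst.
Unshelve. all: by end_near. Qed.

Let b_is_dirichlet x : 1 < x -> is_dirichlet b (s2 x) (zeta x `^ gamma)%:C%C.
Proof.
move=> x1; apply: cvg_ReIm => /=.
  apply: cvg_trans (hw x1); apply: near_eq_cvg; near=> N.
  by rewrite Re_sum; apply: eq_bigr => n _; rewrite npow_real /= mulr0 subr0.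
rewrite (_ : (fun N => complex.Im (dirichlet_psum b (s2 x) N)) = cst 0).
  exact: cvg_cst.
by apply/funext => N; rewrite Im_sum big1// => n _; rewrite npow_real /= mulr0 mul0r addr0.
Unshelve. all: by end_near. Qed.

Let b_summable : dsummable b 4.
Proof.
have h12 : (1:R) < 2 by rewrite ltr1n.
have [K hK] := dirichlet_terms_bounded (b_is_dirichlet h12).
have [|S hS] := @zeta_bounded R 2; first by rewrite ltr1n.
exists (K * S) => N; apply: (@le_trans _ _ (\sum_(1 <= n < N) K * n%:R `^ (- 2))); last first.
  have K0 : 0 <= K by apply: le_trans (hK 1%N isT); exact: cabs_ge0.
  by rewrite -mulr_sumr ler_wpM2l.
apply: ler_sum_nat1 => n n0; have := hK n n0; rewrite cabs_dirichlet_term /= => h.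
have -> : n%:R `^ (- 4) = n%:R `^ (- 2) * n%:R `^ (- 2) :> R.
  rewrite -powRD ?pnatr_eq0 -?lt0n ?n0 ?implybT//; congr (_ `^ _); ring.
by rewrite mulrA ler_wpM2r ?powR_ge0.
Qed.

Let one4 : dsummable one 4.
Proof. by apply: one_summable; rewrite ltr1n. Qed.

Let is_derive_real (c : nat -> CC R) (x : R) : dsummable c 4 -> 4 < x ->
  is_derive x (1 : R) (fun y => complex.Re (dirichlet c (s2 y)))
    (- complex.Re (dirichlet (dlog c) (s2 x))).
Proof.
by move=> c4 x4; have := is_derive_hRe (is_derive_dirichlet (s := s2 x) c4 x4); rewrite ReN.
Qed.

Let real_dirichlet (c : nat -> CC R) y x : dsummable c y -> y <= x ->
  (forall n, complex.Im (c n) = 0) ->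
  dirichlet c (s2 x) = (complex.Re (dirichlet c (s2 x)))%:C%C.
Proof.
move=> cy yx c0; have h := is_dirichletP cy (yx : y <= complex.Re (s2 x)).
have hi : (fun N : nat => 0 : R) @ \oo --> complex.Im (dirichlet c (s2 x)).
  apply: cvg_trans (cvg_ImP h); apply: near_eq_cvg; near=> N.
  by rewrite Im_sum big1// => n _; rewrite npow_real ImM c0 /= mulr0 mul0r addr0.
by apply: eq_ReIm => //=; rewrite -(cvg_lim (@Rhausdorff R) hi) lim_cst.
Unshelve. all: by end_near. Qed.

Let zeta_ge1 (x : R) : 1 < x -> 1 <= zeta x.
Proof.
move=> x1; have [S hS] := zeta_bounded x1.
have cv : cvgn (fun N => \sum_(1 <= n < N) n%:R `^ (- x) : R).
  have [|l hl] := @rsum_cvg _ (fun n => n%:R `^ (- x) : R) S.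
    by move=> N; under eq_bigr do rewrite ger0_norm ?powR_ge0//.
  by apply/cvg_ex; exists l.
have nd : {homo (fun N => \sum_(1 <= n < N) n%:R `^ (- x) : R) : m n / (m <= n)%N >-> m <= n}.
  by move=> m n mn; apply: ler_sum_subrange => // k _; exact: powR_ge0.
apply: le_trans (nondecreasing_cvgn_le nd cv 2).
by rewrite big_nat1 powR1.
Qed.

(** Differentiating W = zeta ^ gamma gives W' zeta = gamma W zeta'; comparing
    coefficients yields a linear recursion for w. *)
Lemma gen_divisor_recursion n : (0 < n)%N ->
  \sum_(k <- divisors n) w k * ((1 + gamma) * ln k%:R - gamma * ln n%:R) = 0.
Proof.
move=> n0.
pose gc : CC R := gamma%:C%C.
pose e n : CC R := dconv (dlog b) one n - gc * dconv b (dlog one) n.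
have log4 (c : nat -> CC R) : dsummable c 4 -> dsummable (dlog c) 5.
  by apply: dsummable_log; rewrite ltr_nat.
have le45 : (4 : R) <= 5 by rewrite ler_nat.
have b5 := dsummable_le le45 b_summable; have o5 := dsummable_le le45 one4.
have lb5 := log4 _ b_summable; have lo5 := log4 _ one4.
have d1 := dsummable_dconv lb5 o5; have d2 := dsummable_dconv b5 lo5.
have [S1 hS1] := d1; have [S2 hS2] := d2.
have e5 : dsummable e 5.
  exists (S1 + `|gamma| * S2) => N.
  apply: (@le_trans _ _ (\sum_(1 <= n < N) (cabs (dconv (dlog b) one n) * n%:R `^ (- 5) +
     `|gamma| * (cabs (dconv b (dlog one) n) * n%:R `^ (- 5))))).
    apply: ler_sum_nat1 => m m0; rewrite mulrA -mulrDl ler_wpM2r ?powR_ge0//.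
    by rewrite (le_trans (cabsB _ _))// cabsM /gc cabs_real.
  by rewrite big_split/= -mulr_sumr lerD// ler_wpM2l.
have e0 (x : R) : 5 < x -> dirichlet e (s2 x) = 0.
  move=> x5; have x4 : 4 < x by rewrite (lt_trans _ x5)// ltr_nat.
  have x1 : 1 < x by rewrite (lt_trans _ x4)// ltr1n.
  have x5' : 5 <= complex.Re (s2 x) by exact: ltW.
  have -> : dirichlet e (s2 x) = dirichlet (dlog b) (s2 x) * dirichlet one (s2 x) -
     gc * (dirichlet b (s2 x) * dirichlet (dlog one) (s2 x)).
    rewrite -(dirichlet_dconv lb5 o5 x5') -(dirichlet_dconv b5 lo5 x5').
    apply: dirichlet_unique.
    have /(_ _ _ _) hl := ccvgD (is_dirichletP d1 x5') (ccvgZ (c := - gc) (is_dirichletP d2 x5')).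
    rewrite mulNr in hl; rewrite /is_dirichlet.
    suff -> : dirichlet_psum e (s2 x) = (fun N => dirichlet_psum (dconv (dlog b) one) (s2 x) N +
      - gc * dirichlet_psum (dconv b (dlog one)) (s2 x) N) by exact: hl.
    apply/funext => N; rewrite /dirichlet_psum mulr_sumr -big_split/=.
    by apply: eq_bigr => m _; rewrite /e; ring.
  pose W y := complex.Re (dirichlet b (s2 y)); pose Z y := complex.Re (dirichlet one (s2 y)).
  have WE y : 1 < y -> W y = zeta y `^ gamma.
    by move=> y1; rewrite /W (dirichlet_unique (b_is_dirichlet y1)).
  have ZE y : 1 < y -> Z y = zeta y by move=> y1; rewrite /Z zetaE.
  have Z1 : 1 <= Z x by rewrite ZE// zeta_ge1.
  have Z0 : 0 < Z x by rewrite (lt_le_trans _ Z1).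
  have dW := is_derive_real b_summable x4; have dZ := is_derive_real one4 x4.
  set W' := complex.Re (dirichlet (dlog b) (s2 x)) in dW.
  set Z' := complex.Re (dirichlet (dlog one) (s2 x)) in dZ.
  have dP : is_derive x 1 (fun y => Z y `^ gamma) (gamma * Z x `^ (gamma - 1) * - Z').
    have dp : is_derive (Z x) 1 (fun z => z `^ gamma) (gamma * Z x `^ (gamma - 1)).
      have zin : Z x \in `]0, +oo[%R by rewrite in_itv/= Z0.
      apply: DeriveDef; first exact: derivable_powR.
      by rewrite -derive1E powR_derive1.
    exact: (is_derive1_comp dp dZ).
  have dP2 : is_derive x 1 (fun y => Z y `^ gamma) (- W').
    move: dW => /is_deriveRP dW; apply/is_deriveRP => ep ep0; have [r r0 hr] := dW ep ep0.
    exists (Num.min r (x - 1)); first by rewrite lt_min r0 subr_gt0.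
    move=> h; rewrite lt_min => /andP[h1 h2].
    have xh : 1 < x + h by move: h2; rewrite ltr_norml => /andP[? _]; lra.
    by rewrite !ZE// -!WE//; exact: hr.
  have key : W' * Z x = gamma * W x * Z'.
    have : gamma * Z x `^ (gamma - 1) * - Z' = - W'.
      by case: dP => _ <-; case: dP2 => _ <-.
    rewrite mulrN => /oppr_inj <-.
    rewrite WE// -ZE// -[in RHS](mulr_powRB1 (ltW Z0) (_ : 0 < gamma)); first ring.
    by rewrite /gamma addr_gt0.
  have lb0 m : complex.Im (dlog b m) = 0 by rewrite /= mulr0 mul0r addr0.
  have lo0 m : complex.Im (dlog one m) = 0 by rewrite /= mulr0 mul0r addr0.
  rewrite (real_dirichlet lb5 (ltW x5) lb0) (real_dirichlet lo5 (ltW x5) lo0).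
  rewrite (real_dirichlet b5 (ltW x5))// (real_dirichlet o5 (ltW x5))//.
  rewrite -/W' -/Z' -[complex.Re (dirichlet b _)]/(W x) -[complex.Re (dirichlet one _)]/(Z x).
  apply: eq_ReIm; rewrite /gc /= ?(mul0r, mulr0, subr0, addr0, oppr0)//.
  by rewrite key; ring.
have := dirichlet_coef_unique e5 e0 n0.
move=> /(congr1 (@complex.Re R)); rewrite /e /dconv ReB ReM !Re_sum [complex.Im gc]/= mul0r subr0 [complex.Re 0]/=.
rewrite mulr_sumr -sumrB => h; rewrite -[RHS]h; apply: eq_big_seq => k.
rewrite -dvdn_divisors// => kn; have k0 := dvdn_gt0 n0 kn.
have q0 : (0 < n %/ k)%N by rewrite divn_gt0// dvdn_leq.
have -> : ln n%:R = ln k%:R + ln (n %/ k)%:R :> R.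
  by rewrite -lnM ?posrE ?ltr0n// -natrM mulnC divnK.
by rewrite /=; ring.
Qed.

(** w 1 is the limit at infinity of zeta ^ gamma, which is at least 1. *)
Lemma gen_divisor_1_gt0 : 0 < w 1.
Proof.
have [S hS] := b_summable.
have S0 : 0 <= S by have := hS 0%N; rewrite big_geq.
pose k := (Num.truncn S).+1.
have Sk : S < 2 ^+ k.
  rewrite (lt_trans (truncnS_gt S))// -natrX ltr_nat; exact: ltn_expl.
pose x : R := 4 + k%:R.
have x1 : 1 < x by rewrite ltr_wpDr// ltr1n.
have x4 : 4 <= x by rewrite lerDl.
have := @leading_term _ b S 4 x 1 isT hS x4.
rewrite (dirichlet_unique (b_is_dirichlet x1)).
have h k' : (0 < k' < 1)%N -> b k' = 0 by case: k'.
move=> /(_ h); rewrite npow_real powR1 mulr1 => hh.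
have := le_trans (Re_le_cabs _) hh.
rewrite /= ler_norml (_ : 4 - x = - k%:R); last by rewrite /x; ring.
rewrite powR_invn// => /andP[_].
have : S / 2 ^+ k < 1 by rewrite ltr_pdivrMr ?exprn_gt0// mul1r.
have : 1 <= zeta x `^ gamma by rewrite -(powRr0 (zeta x)) ler_powR ?zeta_ge1// addr_ge0 ?ltW.
rewrite /=; lra.
Qed.

Lemma gen_divisor_summable x : 1 < x -> (forall n, (0 < n)%N -> 0 <= w n) ->
  exists S, forall N, \sum_(1 <= n < N) w n * n%:R `^ (- x) <= S.
Proof.
move=> x1 w0; exists (zeta x `^ gamma) => N.
have nd : {homo (fun N => \sum_(1 <= n < N) w n * n%:R `^ (- x) : R) : m n / (m <= n)%N >-> m <= n}.
  move=> m n mn; apply: ler_sum_subrange => // k /andP[k0 _].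
  by rewrite mulr_ge0 ?w0 ?powR_ge0.
have cv : cvgn (fun N => \sum_(1 <= n < N) w n * n%:R `^ (- x) : R).
  by apply/cvg_ex; exists (zeta x `^ gamma); exact: hw.
by have := nondecreasing_cvgn_le nd cv N; rewrite (cvg_lim _ (hw x1)).
Qed.

End GeneralizedDivisor.

Section Multiplicative.
Variables (R : realType) (beta : R) (w : nat -> R).
Hypothesis beta0 : 0 < beta.
Let gamma := beta + 1.
Hypothesis w1_gt0 : 0 < w 1.
Hypothesis w_rec : forall n, (0 < n)%N ->
  \sum_(k <- divisors n) w k * ((1 + gamma) * ln k%:R - gamma * ln n%:R) = 0.

Let gamma0 : 0 < gamma. Proof. by rewrite addr_gt0. Qed.

(** d_gamma(p ^ k), the coefficient of x ^ k in (1 - x) ^ - gamma. *)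
Fixpoint rho (k : nat) : R :=
  if k is k'.+1 then rho k' * ((k'%:R + gamma) / k'.+1%:R) else 1.
Arguments rho : simpl never.

Let rho0 : rho 0 = 1. Proof. by []. Qed.

Let rhoS k : rho k.+1 = rho k * ((k%:R + gamma) / k.+1%:R). Proof. by []. Qed.

Let rho_sum k : \sum_(0 <= i < k.+1) rho i = k.+1%:R / gamma * rho k.+1.
Proof.
elim: k => [|k ih].
  by rewrite big_nat1 rhoS rho0 add0r divr1 mul1r mul1r mulVf// gt_eqF.
rewrite big_nat_recr// [LHS]/= ih.
rewrite (rhoS k.+1).
have := ltr0Sn R k; rewrite -[k.+2%:R]natr1; move: k.+1%:R (rho k.+1) => K r K0.
by field; rewrite !gt_eqF// addr_gt0.
Qed.

(** The recursion for w at the index p ^ k, divided by log p. *)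
Lemma rho_identity k :
  \sum_(0 <= i < k.+1) rho i * ((1 + gamma) * i%:R - gamma * k%:R) = 0.
Proof.
elim: k => [|k ih]; first by rewrite big_nat1 !mulr0 subr0 mulr0.
rewrite big_nat_recr//=.
rewrite (eq_bigr (fun i => rho i * ((1 + gamma) * i%:R - gamma * k%:R) - gamma * rho i)); last first.
  by move=> i _; rewrite -natr1; ring.
rewrite big_split/= ih add0r sumrN -mulr_sumr rho_sum /= -natr1.
have := ler0n R k; move: k%:R (rho _) => K r K0.
by field; rewrite !gt_eqF// ltr_wpDl.
Qed.

(** By [rho_identity] and the recursion at m, the numbers rho i * w j satisfy the
    recursion at p ^ k * m too. By induction they agree with w (p ^ i * j) but for
    the last term, whose factor log n is not zero. *)
Lemma multiplicative_pfactor p k m : prime p -> (0 < m)%N -> coprime p m ->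
  w (p ^ k * m) = rho k * w m.
Proof.
move=> pp; have [N] := ubnP (p ^ k * m)%N; elim: N k m => // N ih k m kmN m0 pm.
case: k kmN => [|k kmN]; first by rewrite expn0 mul1n mul1r.
have p0 := prime_gt0 pp; have p1 := prime_gt1 pp.
set n := (p ^ k.+1 * m)%N.
have n0 : (0 < n)%N by rewrite muln_gt0 expn_gt0 p0.
have n1 : (1 < n)%N.
  by apply: leq_trans p1 _; rewrite /n expnS -mulnA leq_pmulr// muln_gt0 expn_gt0 p0.
have ln_n : ln n%:R != 0 :> R by rewrite gt_eqF// ln_gt0// ltr1n.
pose c i j : R := (1 + gamma) * ln (p ^ i * j)%:R - gamma * ln n%:R.
have cE i j : (0 < j)%N -> c i j = ((1 + gamma) * i%:R - gamma * k.+1%:R) * ln p%:R +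
    ((1 + gamma) * ln j%:R - gamma * ln m%:R).
  move=> j0; rewrite /c /n !natrM !natrX !lnM ?posrE ?exprn_gt0 ?ltr0n//.
  have lX e : ln (p%:R ^+ e) = e%:R * ln p%:R :> R by rewrite lnXn ?ltr0n// mulr_natl.
  by rewrite !lX; ring.
have model : \sum_(0 <= i < k.+2) \sum_(j <- divisors m) rho i * w j * c i j = 0.
  under eq_bigr => i _.
    rewrite (eq_big_seq (fun j => (rho i * ((1 + gamma) * i%:R - gamma * k.+1%:R)) * (w j * ln p%:R)
      + rho i * (w j * ((1 + gamma) * ln j%:R - gamma * ln m%:R)))); last first.
      move=> j; rewrite -dvdn_divisors// => jm; rewrite cE; first ring.
      exact: dvdn_gt0 jm.
    rewrite big_split/= -!mulr_sumr w_rec// mulr0 addr0.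
    over.
  by rewrite /= -mulr_suml rho_identity mul0r.
have := w_rec n0; rewrite {1}/n sum_divisors_pfactor// => rec.
have diff : \sum_(0 <= i < k.+2) \sum_(j <- divisors m)
    (w (p ^ i * j) - rho i * w j) * c i j = 0.
  apply: etrans (etrans (congr2 (fun x y => x - y) rec model) (subrr 0)).
  rewrite /= -sumrB; apply: eq_bigr => i _.
  by rewrite -sumrB; apply: eq_bigr => j _; rewrite mulrBl.
have mm : m \in divisors m by rewrite -dvdn_divisors.
have small i j : (i <= k.+1)%N -> (j %| m)%N -> (p ^ i * j < n)%N ->
    w (p ^ i * j) - rho i * w j = 0.
  move=> ik jm h; rewrite ih ?subrr//.
  - by rewrite (leq_trans h).
  - exact: dvdn_gt0 jm.
  - exact: coprime_dvdr jm pm.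
have pk : (0 < p ^ k.+1)%N by rewrite expn_gt0 p0.
have last_eq : (w n - rho k.+1 * w m) * ln n%:R = 0.
  rewrite -[RHS]diff big_nat_recr//= big_nat big1 ?add0r; last first.
    move=> i /andP[_ ik]; rewrite big_seq big1// => j; rewrite -dvdn_divisors// => jm.
    rewrite small ?mul0r// ?(ltnW ik)//.
    by rewrite /n (@leq_ltn_trans (p ^ i * m))// ?leq_mul2l ?(dvdn_leq m0 jm) ?orbT// ltn_pmul2r// ltn_exp2l.
  rewrite (bigD1_seq m) ?divisors_uniq//= big_seq_cond big1 ?addr0.
    rewrite -/n; congr (_ * _); rewrite /c -/n; ring.
  move=> j /andP[]; rewrite -dvdn_divisors// => jm jnm.
  by rewrite small ?mul0r// /n ltn_pmul2l// ltn_neqAle jnm dvdn_leq.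
by move/eqP: last_eq; rewrite mulf_eq0 (negbTE ln_n) orbF subr_eq0 => /eqP.
Qed.

Lemma multiplicative_gt0 n : (0 < n)%N -> 0 < w n.
Proof.
have [N] := ubnP n; elim: N n => // N ih n nN n0.
have [n1|n1] := leqP n 1; first by have -> : n = 1%N by apply/eqP; rewrite eqn_leq n1.
have pp := pdiv_prime n1; set p := pdiv n in pp.
have [m pm E] := pfactor_coprime pp n0.
have m0 : (0 < m)%N by move: n0; rewrite E muln_gt0 => /andP[].
have k0 : (0 < logn p n)%N by rewrite logn_gt0 pi_pdiv.
rewrite E mulnC multiplicative_pfactor//.
rewrite mulr_gt0//; last first.
  apply: ih => //; rewrite -ltnS (leq_trans _ nN)// ltnS E ltn_Pmulr//.
  by rewrite -(expn0 p) ltn_exp2l// prime_gt1.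
elim: (logn p n) => [|k r0]; rewrite ?rho0 ?ltr01// rhoS mulr_gt0// divr_gt0 ?ltr0n//.
by rewrite ltr_wpDl.
Qed.

(** The quotient w (n * p) / w n is 1 + beta / (k + 1), where k is the exponent of
    p in n. *)
Lemma multiplicative_grows n p : (0 < n)%N -> prime p ->
  w n * ((logn p n).+2%:R / (logn p n).+1%:R) `^ (beta / (1 + beta)) <= w (n * p)%N.
Proof.
move=> n0 pp; have [m pm E] := pfactor_coprime pp n0; set k := logn p n in E *.
have m0 : (0 < m)%N by move: n0; rewrite E muln_gt0 => /andP[].
have wn := ltW (multiplicative_gt0 n0).
have -> : w (n * p)%N = w n * ((k%:R + gamma) / k.+1%:R).
  rewrite {1}E -mulnA -expnSr mulnC multiplicative_pfactor// {1}E mulnC.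
  by rewrite multiplicative_pfactor// rhoS; ring.
rewrite ler_wpM2l//.
have k1 : 0 < k.+1%:R :> R by rewrite ltr0n.
have -> : k.+2%:R / k.+1%:R = 1 + k.+1%:R^-1 :> R by rewrite -natr1; field; rewrite gt_eqF.
have -> : (k%:R + gamma) / k.+1%:R = 1 + beta * k.+1%:R^-1.
  by rewrite /gamma -natr1; field; rewrite natr1 gt_eqF.
apply: bernoulli_powR => //; rewrite invr_ge0 ltW//=.
by rewrite invf_le1// ler1n.
Qed.

End Multiplicative.

(** What the estimates of the operator use of the weight. *)
Lemma weight_class_properties (R : realType) (w : nat -> R) : weight_class w ->
  [/\ forall n, (0 < n)%N -> 0 < w n,
      exists2 delta : R, 0 < delta &
        forall n p, (0 < n)%N -> prime p ->
          w n * ((logn p n).+2%:R / (logn p n).+1%:R) `^ delta <= w (n * p)%N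
    & forall x : R, 1 < x -> exists S : R,
        forall N, \sum_(1 <= n < N) w n * n%:R `^ (- x) <= S].
Proof.
move=> [beta [beta0 [wE|wE]]].
  split.
  - by move=> n n0; rewrite wE// powR_gt0// ltr0n size_divisors_gt0.
  - exists beta => // n p n0 pp; have [m pm E] := pfactor_coprime pp n0.
    set k := logn p n in E *.
    have m0 : (0 < m)%N by move: n0; rewrite E muln_gt0 => /andP[].
    rewrite !wE ?muln_gt0 ?n0 ?prime_gt0//.
    have -> : (n * p = p ^ k.+1 * m)%N by rewrite {1}E -mulnA -expnSr mulnC.
    have -> : n = (p ^ k * m)%N by rewrite {1}E mulnC.
    rewrite !size_divisors_pfactor// -powRM ?divr_ge0//.
    rewrite (_ : _ * _ = (k.+2 * size (divisors m))%:R)//.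
    have := ltr0Sn R k; rewrite !natrM; move: k.+1%:R k.+2%:R => K K2 K0.
    by field; rewrite gt_eqF.
  - move=> x x1; pose r := (Num.truncn beta).+1.
    have [S hS] := size_divisors_pow_summable r x1; exists S => N.
    apply: le_trans (hS N); apply: ler_sum_nat1 => n n0.
    rewrite wE// ler_wpM2r ?powR_ge0// -powR_mulrn// ler_powR//.
      by rewrite ler1n size_divisors_gt0.
    by rewrite ltW// truncnS_gt.
have w1 := gen_divisor_1_gt0 beta0 wE.
have wr := gen_divisor_recursion beta0 wE.
have w0 := multiplicative_gt0 beta0 w1 wr.
split => //.
  exists (beta / (1 + beta)); first by rewrite divr_gt0// addr_gt0.
  exact: multiplicative_grows w1 wr.
move=> x x1; apply: (gen_divisor_summable wE x1) => n n0; exact/ltW/w0.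
Qed.

(** * The Volterra operator on coefficients *)

Section Laplace.
Variable R : realType.
Local Notation mu := (@lebesgue_measure R).
Local Notation ray := (`[0%R, +oo[%classic : set R).

Lemma powR_nat_integral (n : nat) : (1 < n)%N ->
  mu.-integrable ray (EFin \o (fun x : R => n%:R `^ (- x))) /\
  (\int[mu]_(x in ray) (n%:R `^ (- x))%:E = ((ln n%:R)^-1)%:E)%E.
Proof.
move=> n1; have l0 : 0 < ln n%:R :> R by rewrite ln_gt0// ltr1n.
pose f : R -> \bar R := EFin \o exponential_pdf (ln n%:R).
have fE x : ray x -> (n%:R `^ (- x))%:E = (((ln n%:R)^-1)%:E * f x)%E.
  rewrite /= in_itv/= andbT => x0.
  rewrite /f /= exponential_pdfE// -EFinM mulKf ?gt_eqF// /powR pnatr_eq0.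
  rewrite (negbTE (_ : n != 0%N)); last by rewrite -lt0n ltnW.
  by congr (expR _)%:E; ring.
have mray : measurable ray by exact: measurable_itv.
have fi : mu.-integrable ray f.
  apply: (@integrableS _ _ _ mu setT) => //; exact: integrable_exponential_pdf.
have f1 : (\int[mu]_(x in ray) f x = 1)%E.
  rewrite integral_mkcond -[RHS](integral_exponential_pdf l0).
  apply: eq_integral => x _.
  rewrite /f patchE; case: ifPn => // /negP xr.
  by rewrite /exponential_pdf patchE ifF//; apply/negP.
split.
  apply: (@eq_integrable _ _ _ mu _ mray (fun x => ((ln n%:R)^-1)%:E * f x)%E).
    by move=> x /set_mem xr; rewrite /comp fE.
  exact: integrableZl.
under eq_integral => x /set_mem xr do rewrite fE//.
by rewrite integralZl// f1 mule1.
Qed.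

(** Termwise integration of sum_n c_n n ^ -x; the domination 2 ^ -x is available
    because the constant terms vanish. *)
Lemma series_integral (c : nat -> R) (F : R -> R) (S : R) :
  (forall n, (n <= 1)%N -> c n = 0) ->
  (forall N, \sum_(1 <= n < N) `|c n| <= S) ->
  (forall x, 0 <= x -> (fun N => \sum_(1 <= n < N) c n * n%:R `^ (- x)) @ \oo --> F x) ->
  mu.-integrable ray (EFin \o F) /\
  (fun N => \sum_(1 <= n < N) c n / ln n%:R) @ \oo --> \int[mu]_(x in ray) F x.
Proof.
move=> c0 hS hF; have mray : measurable ray by exact: measurable_itv.
pose h n (x : R) : \bar R := (c n * n%:R `^ (- x))%:E.
have hh n : mu.-integrable ray (h n) /\ (\int[mu]_(x in ray) h n x = (c n / ln n%:R)%:E)%E.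
  have [n1|n1] := leqP n 1.
    have h0 x : h n x = 0%E by rewrite /h c0// mul0r.
    split; last by rewrite c0// mul0r integral0_eq.
    by rewrite (_ : h n = cst 0%E); [exact: integrable0|apply/funext].
  have [i1 i2] := powR_nat_integral n1.
  split; first by apply: (@eq_integrable _ _ _ mu _ mray (fun x => (c n)%:E * (n%:R `^ (- x))%:E)%E) => //; exact: integrableZl.
  have hE x : h n x = ((c n)%:E * (n%:R `^ (- x))%:E)%E by [].
  by under eq_integral do rewrite hE; rewrite integralZl// i2.
pose f N (x : R) : \bar R := (\sum_(1 <= n < N) h n x)%E.
have fE N x : f N x = (\sum_(1 <= n < N) c n * n%:R `^ (- x))%:E by rewrite /f sumEFin.
have fi N : mu.-integrable ray (f N) by apply: integrable_sum => // n _; case: (hh n).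
have fcv x : ray x -> f ^~ x @ \oo --> (F x)%:E.
  rewrite /= in_itv/= andbT => x0.
  rewrite (_ : f ^~ x = EFin \o (fun N => \sum_(1 <= n < N) c n * n%:R `^ (- x))); last first.
    by apply/funext => N; rewrite fE.
  by apply: cvg_EFin; [near=> N|exact: hF].
have mf N := measurable_int _ (fi N).
have mF := emeasurable_fun_cvg f (EFin \o F) mf fcv.
pose G (x : R) : \bar R := (S%:E * (2%:R `^ (- x))%:E)%E.
have Gi : mu.-integrable ray G by apply: integrableZl => //; case: (powR_nat_integral (isT : (1 < 2)%N)).
have fG x N : ray x -> (`|f N x| <= G x)%E.
  rewrite /= in_itv/= andbT => x0; rewrite fE /= lee_fin.
  apply: (le_trans (ler_norm_sum _ _ _)).
  apply: (@le_trans _ _ (\sum_(1 <= n < N) `|c n| * 2 `^ (- x))); last first.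
    by rewrite -mulr_suml ler_wpM2r ?powR_ge0.
  apply: ler_sum_nat => n _; have [n1|n1] := leqP n 1.
    by rewrite c0// mul0r normr0 mul0r.
  rewrite normrM (ger0_norm (powR_ge0 _ _)) ler_wpM2l//.
  rewrite !powRN lef_pV2 ?posrE ?powR_gt0//; last by rewrite ltr0n ltnW.
  by apply: ge0_ler_powR; rewrite ?nnegrE ?ler_nat.
have [||h1 _ h3] := @dominated_convergence _ _ _ mu ray mray f (EFin \o F) G mf mF _ Gi.
- by apply: aeW => x xr; exact: fcv.
- by apply: aeW => x N xr; exact: fG.
split=> //; rewrite /Rintegral.
have /fine_cvgP[_] : (fun N => (\sum_(1 <= n < N) c n / ln n%:R)%:E) @ \oo -->
    (fine (\int[mu]_(x in ray) (F x)%:E))%:E.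
  rewrite fineK; last exact: integrable_fin_num.
  apply: cvg_trans h3; apply: near_eq_cvg; near=> N.
  rewrite /= /f integral_sum//; last by move=> n; case: (hh n).
  by rewrite -sumEFin; apply: eq_bigr => n _; case: (hh n).
by [].
Unshelve. all: by end_near. Qed.

End Laplace.

Section VolterraIdentity.
Variables (R : realType) (g : CC R -> CC R) (a B : nat -> CC R) (s : CC R).
Hypothesis a_summable : dsummable a (complex.Re s).
Hypothesis B_summable : dsummable B (complex.Re s).
Hypothesis B0 : forall n, (n <= 1)%N -> B n = 0.
Hypothesis gE : forall z, complex.Re s <= complex.Re z -> 'D_1 g z = - dirichlet B z.

Let z n : CC R := dconv a B n * npow n s.

Let ReZ (r : R) (u : CC R) : complex.Re ((r%:C)%C * u) = r * complex.Re u.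
Proof. by rewrite ReM /= mul0r subr0. Qed.

Let ImZ (r : R) (u : CC R) : complex.Im ((r%:C)%C * u) = r * complex.Im u.
Proof. by rewrite ImM /= mul0r addr0. Qed.

Let z0 n : (n <= 1)%N -> z n = 0.
Proof.
move=> n1; rewrite /z /dconv big1 ?mul0r// => k _.
by rewrite B0 ?mulr0// (leq_trans (leq_div _ _)).
Qed.

Let integrand_cvg x : 0 <= x ->
  (fun N => \sum_(1 <= n < N) - z n * (n%:R `^ (- x))%:C%C) @ \oo -->
  volterra_integrand g (dirichlet a) s x.
Proof.
move=> x0; have sx : complex.Re s <= complex.Re (s + x%:C%C) by rewrite ReD lerDl.
rewrite /volterra_integrand gE// mulrN -(dirichlet_dconv a_summable B_summable sx).
have h := is_dirichletP (dsummable_dconv a_summable B_summable) sx.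
rewrite -mulN1r; apply: cvg_trans (ccvgZ (c := (- 1 : CC R)) h).
apply: near_eq_cvg; near=> N; rewrite /dirichlet_psum mulr_sumr.
apply: eq_big_nat => n /andP[n0 _]; rewrite npowD /z.
have -> : npow n (x%:C%C) = (n%:R `^ (- x))%:C%C :> CC R.
  by rewrite /npow /= mul0r cos0 sin0 oppr0 mulr1.
by ring.
Unshelve. all: by end_near. Qed.

(** On the ray, f g' is minus the series with coefficients dconv a B; it is
    integrated term by term. *)
Lemma volterra_identity :
  cintegrable `[0, +oo[ (volterra_integrand g (dirichlet a) s) /\
  is_dirichlet (volterra_coef B a) s (volterra g (dirichlet a) s).
Proof.
have [S hS] := dsummable_dconv a_summable B_summable.
have bound (f : CC R -> R) : (forall u, `|f u| <= cabs u) ->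
    forall N, \sum_(1 <= n < N) `|- f (z n)| <= S.
  move=> hf N; apply: le_trans (hS N); apply: ler_sum_nat1 => n n0.
  by rewrite normrN (le_trans (hf _))// cabs_dirichlet_term.
have [i1 c1] : (@lebesgue_measure R).-integrable `[0, +oo[
     (EFin \o (fun x => complex.Re (volterra_integrand g (dirichlet a) s x))) /\
   (fun N => \sum_(1 <= n < N) - complex.Re (z n) / ln n%:R) @ \oo -->
   \int[lebesgue_measure]_(x in `[0, +oo[) complex.Re (volterra_integrand g (dirichlet a) s x).
  apply: (series_integral (S := S)).
  - by move=> n n1; rewrite z0// oppr0.
  - exact: bound (@Re_le_cabs R).
  - move=> x x0; apply: cvg_trans (cvg_ReP (integrand_cvg x0)).
    apply: near_eq_cvg; near=> N; rewrite Re_sum; apply: eq_bigr => n _.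
    by rewrite ReM ReN [complex.Im _%:C%C]/= mulr0 subr0.
have [i2 c2] : (@lebesgue_measure R).-integrable `[0, +oo[
     (EFin \o (fun x => complex.Im (volterra_integrand g (dirichlet a) s x))) /\
   (fun N => \sum_(1 <= n < N) - complex.Im (z n) / ln n%:R) @ \oo -->
   \int[lebesgue_measure]_(x in `[0, +oo[) complex.Im (volterra_integrand g (dirichlet a) s x).
  apply: (series_integral (S := S)).
  - by move=> n n1; rewrite z0// oppr0.
  - exact: bound (@Im_le_cabs R).
  - move=> x x0; apply: cvg_trans (cvg_ImP (integrand_cvg x0)).
    apply: near_eq_cvg; near=> N; rewrite Im_sum; apply: eq_bigr => n _.
    by rewrite ImM ImN [complex.Im _%:C%C]/= mulr0 add0r.
split; first by split.
apply: cvg_ReIm.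
  apply: cvg_trans (cvgN c1); apply: near_eq_cvg; near=> N.
  rewrite Re_sum.
  have -> : (- (fun N => \sum_(1 <= n < N) - complex.Re (z n) / ln n%:R)) N =
    - (\sum_(1 <= n < N) - complex.Re (z n) / ln n%:R) by [].
  rewrite -sumrN; apply: eq_bigr => n _.
  by rewrite mulNr opprK /volterra_coef -mulrA -/(z n) ReZ mulrC.
apply: cvg_trans (cvgN c2); apply: near_eq_cvg; near=> N.
rewrite Im_sum.
have -> : (- (fun N => \sum_(1 <= n < N) - complex.Im (z n) / ln n%:R)) N =
    - (\sum_(1 <= n < N) - complex.Im (z n) / ln n%:R) by [].
rewrite -sumrN; apply: eq_bigr => n _.
by rewrite mulNr opprK /volterra_coef -mulrA -/(z n) ImZ mulrC.
Unshelve. all: by end_near. Qed.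

End VolterraIdentity.

(** * Compactness from small tails *)

Section Diagonal.
Variable R : realType.

Lemma ultra_bounded_limit (U : set_system nat) (u : nat -> R) (K : R) :
  UltraFilter U -> (forall k, `|u k| <= K) ->
  exists l : R, forall e, 0 < e -> U [set k | `|u k - l| < e].
Proof.
move=> UU uK; have [] := @segment_compact R (- K) K (u @ U).
  rewrite (_ : (u @ U) _ = U (u @^-1` `[- K, K]))//.
  by apply: (@filterS _ U _ setT) filterT => k _ /=; rewrite in_itv/= -ler_norml.
move=> l [_ cl]; exists l => e e0.
have [//|h] := in_ultra_setVsetC [set k | `|u k - l| < e] UU.
have [] := cl [set x | ~ (`|x - l| < e)] (ball l e) h (nbhsx_ballx l e e0).
by move=> x [/= xe]; rewrite /ball /= distrC.
Qed.

(** An ultrafilter finer than the one of cofinite sets makes all coordinates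
    converge at once, which replaces a diagonal extraction. *)
Lemma bounded_coordinates_subsequence (u : nat -> nat -> CC R) (K : nat -> R) :
  (forall k n, cabs (u k n) <= K n) ->
  exists (phi : nat -> nat) (h : nat -> CC R),
    (forall i j : nat, (i < j)%N -> (phi i < phi j)%N) /\
    (forall j n, (n <= j)%N -> cabs (u (phi j) n - h n) < j.+1%:R^-1).
Proof.
move=> uK; have [U [UU sU]] := @ultraFilterLemma nat \oo _.
have hre n : exists l : R, forall e, 0 < e -> U [set k | `|complex.Re (u k n) - l| < e].
  by apply: (@ultra_bounded_limit _ _ (K n)) => k; apply: le_trans (uK k n); exact: Re_le_cabs.
have him n : exists l : R, forall e, 0 < e -> U [set k | `|complex.Im (u k n) - l| < e].
  by apply: (@ultra_bounded_limit _ _ (K n)) => k; apply: le_trans (uK k n); exact: Im_le_cabs.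
have [x hx] := choice hre; have [y hy] := choice him.
pose h n : CC R := (x n +i* y n)%C.
have one n e : 0 < e -> U [set k | cabs (u k n - h n) < e].
  move=> e0; have e2 : 0 < e / 2 by rewrite divr_gt0.
  apply: filterS (filterI (hx n _ e2) (hy n _ e2)) => k /= [h1 h2].
  apply: (le_lt_trans (cabs_le_ReIm _)); rewrite ReB ImB [ltRHS]splitr; exact: ltrD.
have many j : U [set k | forall n, (n <= j)%N -> cabs (u k n - h n) < j.+1%:R^-1].
  suff hi i : U [set k | forall n, (n < i)%N -> cabs (u k n - h n) < j.+1%:R^-1] by exact: hi j.+1.
  elim: i => [|i ih]; first by apply: (@filterS _ U _ setT) filterT => k _ n.
  have p0 : 0 < j.+1%:R^-1 :> R by rewrite invr_gt0.
  apply: filterS (filterI ih (one i _ p0)) => k /= [h1 h2] n.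
  by rewrite ltnS leq_eqVlt => /predU1P[->//|]; exact: h1.
have pick (q : nat * nat) : exists k, (q.2 < k)%N /\
    forall n, (n <= q.1)%N -> cabs (u k n - h n) < q.1.+1%:R^-1.
  have inf : U [set k | (q.2 < k)%N] by apply: sU; exists q.2.+1.
  by have [k [/= k1 k2]] := filter_ex (filterI inf (many q.1)); exists k.
have [f hf] := choice pick.
pose phi := fix phi j := if j is j'.+1 then f (j, phi j') else f (0%N, 0%N).
exists phi, h; split.
  apply: (homo_ltn ltn_trans) => j.
  by have [] := hf (j.+1, phi j).
by case=> [|j]; [have [] := hf (0%N, 0%N)|have [] := hf (j.+1, phi j)].
Qed.

End Diagonal.

Section HilbertNorm.
Variables (R : realType) (w : nat -> R).
Hypothesis w_gt0 : forall n, (0 < n)%N -> 0 < w n.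

Lemma weighted_sqr_ge0 (a : nat -> CC R) n : (0 < n)%N -> 0 <= cabs (a n) ^+ 2 / w n.
Proof. by move=> n0; rewrite divr_ge0 ?sqr_ge0// ltW// w_gt0. Qed.

Lemma H2_of_bound (a : nat -> CC R) (S : R) :
  (forall N, \sum_(1 <= n < N) cabs (a n) ^+ 2 / w n <= S) ->
  in_H2 w a /\ H2_norm w a <= Num.sqrt S.
Proof.
move=> hS.
have le : (H2_sqnorm w a <= S%:E)%E.
  apply: lime_le.
    by apply: is_cvg_nneseries => n n0 _; rewrite lee_fin weighted_sqr_ge0.
  by near=> N; rewrite sumEFin lee_fin.
have ge : (0 <= H2_sqnorm w a)%E.
  by apply: nneseries_ge0 => n n0 _; rewrite lee_fin weighted_sqr_ge0.
have fin : H2_sqnorm w a \is a fin_num.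
  by rewrite ge0_fin_numE//; apply: (le_lt_trans le); rewrite ltry.
split; first by rewrite /in_H2 (le_lt_trans le)// ltry.
by rewrite /H2_norm ler_wsqrtr// -lee_fin fineK.
Unshelve. all: by end_near. Qed.

Lemma H2_bound (a : nat -> CC R) : in_H2 w a ->
  forall N, \sum_(1 <= n < N) cabs (a n) ^+ 2 / w n <= H2_norm w a ^+ 2.
Proof.
move=> fa N.
have ge : (0 <= H2_sqnorm w a)%E.
  by apply: nneseries_ge0 => n n0 _; rewrite lee_fin weighted_sqr_ge0.
rewrite sqr_sqrtr ?fine_ge0// -lee_fin fineK ?ge0_fin_numE// -sumEFin.
by apply: nneseries_lim_ge => n n0 _; rewrite lee_fin weighted_sqr_ge0.
Qed.

(** The subsequence provided by the bounded coordinates converges in norm: the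
    first X coordinates converge, and the tails of all images are small. *)
Lemma compact_of_tails (T : (nat -> CC R) -> (nat -> CC R)) (C : R) :
  0 <= C ->
  (forall c a a' n, T (fun k => c * a k + a' k) n = c * T a n + T a' n) ->
  (forall a Y, \sum_(1 <= n < Y) cabs (T a n) ^+ 2 / w n <=
     C * \sum_(1 <= k < Y) cabs (a k) ^+ 2 / w k) ->
  (forall eta, 0 < eta -> exists2 X, (0 < X)%N & forall a Y,
     \sum_(X <= n < Y) cabs (T a n) ^+ 2 / w n <=
     eta * \sum_(1 <= k < Y) cabs (a k) ^+ 2 / w k) ->
  compact_operator w T.
Proof.
move=> C0 lin bnd tail; split=> // [a fa|F [M hM]].
  apply: (H2_of_bound (S := C * H2_norm w a ^+ 2) _).1 => N.
  by apply: (le_trans (bnd a N)); rewrite ler_wpM2l// H2_bound.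
have FM k Y : \sum_(1 <= n < Y) cabs (F k n) ^+ 2 / w n <= M ^+ 2.
  have [fk hk] := hM k; apply: (le_trans (H2_bound fk Y)).
  have n0 : 0 <= H2_norm w (F k) by exact: sqrtr_ge0.
  by apply: lerXn2r; rewrite ?nnegrE// (le_trans n0).
have M0 : 0 <= M ^+ 2 by exact: sqr_ge0.
pose u k n : CC R := if n == 0%N then 0 else T (F k) n.
have [|phi [h [phi_incr hphi]]] := @bounded_coordinates_subsequence R u
    (fun n => Num.sqrt (C * M ^+ 2 * w n)).
  move=> k [|n]; first by rewrite [leLHS](_ : _ = 0) ?sqrtr_ge0//; exact: cabs0.
  rewrite /u /= -[leLHS]ger0_norm ?cabs_ge0// -sqrtr_sqr ler_wsqrtr//.
  rewrite -ler_pdivrMr ?w_gt0//.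
  apply: (@le_trans _ _ (\sum_(1 <= m < n.+2) cabs (T (F k) m) ^+ 2 / w m)).
    rewrite big_nat_recr//= lerDr big_nat sumr_ge0// => m /andP[m0 _].
    exact: weighted_sqr_ge0.
  by apply: (le_trans (bnd _ _)); rewrite ler_wpM2l.
exists phi, h.
have {}hphi j n : (0 < n)%N -> (n <= j)%N -> cabs (T (F (phi j)) n - h n) ^+ 2 <= j.+1%:R^-1.
  case: n => // n _ nj; have := hphi j n.+1 nj; rewrite {1}/u /= => /ltW hh.
  have i1 : j.+1%:R^-1 <= 1 :> R by rewrite invf_le1// ler1n.
  apply: (@le_trans _ _ (j.+1%:R^-1 ^+ 2)).
    by apply: lerXn2r; rewrite ?nnegrE ?cabs_ge0.
  by rewrite expr2 ler_piMl.
have w_inv n : (0 < n)%N -> 0 <= (w n)^-1 by move=> n0; rewrite invr_ge0 ltW// w_gt0.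
pose W X := \sum_(1 <= n < X) (w n)^-1.
have W0 X : 0 <= W X.
  by rewrite /W big_nat sumr_ge0// => n /andP[n0 _]; exact: w_inv.
(* h is close to a later T (F (phi i)) on [X, Y[, so the tails of h are as small
   as those of the images *)
have diff_tail eta X j Y : (0 < X)%N ->
    (forall a Y, \sum_(X <= n < Y) cabs (T a n) ^+ 2 / w n <=
       eta * \sum_(1 <= k < Y) cabs (a k) ^+ 2 / w k) -> 0 <= eta ->
    \sum_(X <= n < Y) cabs (T (F (phi j)) n - h n) ^+ 2 / w n <= 6 * eta * M ^+ 2.
  move=> X0 hX eta0; apply: (@small_of_linear_nat R _ _ (3 * W Y)) => J.
  pose i := maxn Y J.
  have GM k : \sum_(X <= n < Y) cabs (T (F k) n) ^+ 2 / w n <= eta * M ^+ 2.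
    by apply: (le_trans (hX _ _)); rewrite ler_wpM2l.
  have i0 : 0 < i.+1%:R :> R by [].
  have Ji : J%:R / i.+1%:R <= 1 :> R.
    by rewrite ler_pdivrMr// mul1r ler_nat (leq_trans (leq_maxr Y J)).
  have main : \sum_(X <= n < Y) cabs (T (F (phi j)) n - h n) ^+ 2 / w n <=
      \sum_(X <= n < Y) (3 * (cabs (T (F (phi j)) n) ^+ 2 / w n) +
        3 * (cabs (T (F (phi i)) n) ^+ 2 / w n) + 3 * (w n)^-1 * i.+1%:R^-1).
    apply: ler_sum_nat => n /andP[Xn nY].
    have n0 : (0 < n)%N := leq_trans X0 Xn.
    have ni : (n <= i)%N by rewrite (leq_trans (ltnW nY))// leq_maxl.
    have := hphi i n n0 ni; set p := cabs (T (F (phi i)) n - h n) => hp.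
    set q := cabs (T (F (phi j)) n); set r := cabs (T (F (phi i)) n).
    have tri : cabs (T (F (phi j)) n - h n) <= q + r + p.
      rewrite (_ : _ - _ = T (F (phi j)) n - T (F (phi i)) n + (T (F (phi i)) n - h n)); last by ring.
      by apply: (le_trans (cabsD _ _)); rewrite lerD2r cabsB.
    have sq : cabs (T (F (phi j)) n - h n) ^+ 2 <= 3 * q ^+ 2 + 3 * r ^+ 2 + 3 * i.+1%:R^-1.
      apply: (@le_trans _ _ ((q + r + p) ^+ 2)).
        by apply: lerXn2r; rewrite ?nnegrE ?cabs_ge0// !addr_ge0 ?cabs_ge0.
      apply: (@le_trans _ _ (3 * q ^+ 2 + 3 * r ^+ 2 + 3 * p ^+ 2)); last first.
        by rewrite lerD2l ler_wpM2l.
      have := sqr_ge0 (q - r); have := sqr_ge0 (q - p); have := sqr_ge0 (r - p); nra.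
    rewrite [leRHS](_ : _ = (3 * q ^+ 2 + 3 * r ^+ 2 + 3 * i.+1%:R^-1) * (w n)^-1); last by ring.
    by rewrite ler_wpM2r// w_inv.
  rewrite !big_split/= -!mulr_sumr -mulr_suml -mulr_sumr in main.
  have WY : \sum_(X <= n < Y) (w n)^-1 <= W Y.
    by apply: ler_sum_subrange => // n /andP[n0 _]; exact: w_inv.
  apply: (@le_trans _ _ (J%:R * (6 * eta * M ^+ 2 + 3 * W Y * i.+1%:R^-1))).
    rewrite ler_wpM2l//; apply: (le_trans main).
    rewrite [leRHS](_ : _ = 3 * (eta * M ^+ 2) + 3 * (eta * M ^+ 2) + 3 * W Y * i.+1%:R^-1); last by ring.
    apply: lerD; first by apply: lerD; rewrite ler_wpM2l.
    by rewrite ler_wpM2r ?ler_wpM2l// invr_ge0.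
  rewrite mulrDr lerD2l [leLHS](_ : _ = 3 * W Y * (J%:R / i.+1%:R)); last by ring.
  by rewrite ler_piMr// mulr_ge0.
have diff_bound eta X j Y : (0 < X)%N ->
    (forall a Y, \sum_(X <= n < Y) cabs (T a n) ^+ 2 / w n <=
       eta * \sum_(1 <= k < Y) cabs (a k) ^+ 2 / w k) -> 0 <= eta -> (X <= j)%N ->
    \sum_(1 <= n < Y) cabs (T (F (phi j)) n - h n) ^+ 2 / w n <=
    W X * j.+1%:R^-1 + 6 * eta * M ^+ 2.
  move=> X0 hX eta0 Xj.
  have t0 n : (0 < n)%N -> 0 <= cabs (T (F (phi j)) n - h n) ^+ 2 / w n.
    by move=> n0; rewrite mulr_ge0 ?sqr_ge0 ?w_inv.
  apply: (@le_trans _ _ (\sum_(1 <= n < maxn X Y) cabs (T (F (phi j)) n - h n) ^+ 2 / w n)).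
    by apply: ler_sum_subrange; rewrite ?leq_maxr// => n /andP[n0 _]; exact: t0.
  rewrite (@big_cat_nat _ _ _ X)//=; last by rewrite leq_maxl.
  apply: lerD; last exact: diff_tail.
  rewrite /W mulr_suml; apply: ler_sum_nat => n /andP[n0 nX].
  rewrite mulrC ler_wpM2l ?w_inv//; apply: hphi => //.
  by rewrite (leq_trans (ltnW nX)).
have C1 : 0 < C + 1 by rewrite ltr_wpDl.
split => //.
  have hb : forall Y, \sum_(1 <= n < Y) cabs (T (F (phi 1%N)) n - h n) ^+ 2 / w n <=
      W 1%N * 2%:R^-1 + 6 * C * M ^+ 2 by move=> Y; exact: diff_bound.
  apply: (H2_of_bound (S := 2 * (W 1%N * 2%:R^-1 + 6 * C * M ^+ 2) + 2 * (C * M ^+ 2)) _).1 => N.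
  apply: (@le_trans _ _ (\sum_(1 <= n < N) (2 * (cabs (T (F (phi 1%N)) n - h n) ^+ 2 / w n) +
      2 * (cabs (T (F (phi 1%N)) n) ^+ 2 / w n)))).
    apply: ler_sum_nat1 => n n0.
    set p := cabs (_ - h n); set q := cabs (T _ n).
    have tri : cabs (h n) <= p + q.
      rewrite (_ : h n = - (T (F (phi 1%N)) n - h n) + T (F (phi 1%N)) n); last by ring.
      by apply: (le_trans (cabsD _ _)); rewrite cabsN.
    rewrite !mulrA -mulrDl ler_wpM2r ?w_inv//.
    apply: (@le_trans _ _ ((p + q) ^+ 2)).
      by apply: lerXn2r; rewrite ?nnegrE ?cabs_ge0// addr_ge0 ?cabs_ge0.
    have := sqr_ge0 (p - q); nra.
  rewrite big_split/= -!mulr_sumr; apply: lerD; rewrite ler_wpM2l//.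
  by apply: (le_trans (bnd _ _)); rewrite ler_wpM2l.
apply/cvgrPdist_lt => e e0.
pose e1 := (e / 2) ^+ 2; have e10 : 0 < e1 by rewrite exprn_gt0// divr_gt0.
pose eta := e1 / (2 * (6 * M ^+ 2 + 1)).
have D0 : 0 < 2 * (6 * M ^+ 2 + 1) by rewrite mulr_gt0// ltr_wpDl// mulr_ge0.
have eta0 : 0 < eta by rewrite divr_gt0.
have [X X0 hX] := tail eta eta0.
pose J := (Num.truncn (W X / (e1 / 2))).+1.
have hJ : W X / (e1 / 2) < J%:R by exact: truncnS_gt.
near=> j.
have Xj : (X <= j)%N by near: j; exact: nbhs_infty_ge.
have Jj : (J <= j)%N by near: j; exact: nbhs_infty_ge.
have [_ hn] := H2_of_bound (fun Y => diff_bound eta X j Y X0 hX (ltW eta0) Xj).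
rewrite sub0r normrN ger0_norm ?sqrtr_ge0//; apply: (le_lt_trans hn).
apply: (@le_lt_trans _ _ (Num.sqrt e1)); last first.
  by rewrite sqrtr_sqr ger0_norm ?divr_ge0 ?ltW// ltr_pdivrMr// ltr_pMr// ltr1n.
rewrite ler_wsqrtr//.
have j0 : 0 < j.+1%:R :> R by [].
have h1 : W X * j.+1%:R^-1 <= e1 / 2.
  rewrite ler_pdivrMr// mulrC -ler_pdivrMr ?divr_gt0// ltW// (lt_le_trans hJ)//.
  by rewrite ler_nat (leq_trans Jj).
have h2 : 6 * eta * M ^+ 2 <= e1 / 2.
  rewrite /eta [leLHS](_ : _ = e1 * (6 * M ^+ 2) / (2 * (6 * M ^+ 2 + 1))); last by ring.
  rewrite ler_pdivrMr// [leRHS](_ : _ = e1 * (6 * M ^+ 2) + e1); last by field.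
  by rewrite lerDl ltW.
by rewrite [leRHS]splitr lerD.
Unshelve. all: by end_near. Qed.

End HilbertNorm.

(** * Boundedness and compactness of T_g *)

(** Cauchy-Schwarz against the weights. *)
Lemma dsummable_H2 (R : realType) (w : nat -> R) (a : nat -> CC R) (x : R) :
  (forall n, (0 < n)%N -> 0 < w n) ->
  (forall y : R, 1 < y -> exists S : R,
     forall N, \sum_(1 <= n < N) w n * n%:R `^ (- y) <= S) ->
  in_H2 w a -> 2^-1 < x -> dsummable a x.
Proof.
move=> w0 hw fa x2.
have [|S hS] := hw (x + x); first by rewrite [ltLHS]splitr mul1r ltrD.
exists (H2_norm w a ^+ 2 + S) => N.
apply: le_trans (lerD (H2_bound w0 fa N) (hS N)).
rewrite -big_split/=; apply: ler_sum_nat1 => n n0.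
have wn := w0 n n0; have wi : 0 <= (w n)^-1 by rewrite invr_ge0 ltW.
rewrite opprD powRD ?pnatr_eq0 -?lt0n ?n0 ?implybT//.
set p := cabs (a n); set q := n%:R `^ (- x).
have p0 : 0 <= p by exact: cabs_ge0.
have q0 : 0 <= q by exact: powR_ge0.
have : 0 <= (p - w n * q) ^+ 2 / w n by rewrite mulr_ge0// sqr_ge0.
rewrite [X in 0 <= X](_ : _ = p ^+ 2 / w n + w n * (q * q) - 2 * (p * q)); last by field; rewrite gt_eqF.
by have := mulr_ge0 p0 q0; rewrite subr_ge0; lra.
Qed.

Section VolterraOperator.
Variables (R : realType) (w : nat -> R) (delta : R) (P : seq nat).
Variables (g : CC R -> CC R) (B : nat -> CC R) (M : R).
Hypothesis w_gt0 : forall n, (0 < n)%N -> 0 < w n.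
Hypothesis delta_gt0 : 0 < delta.
Hypothesis w_grows : forall n p, (0 < n)%N -> prime p ->
  w n * ((logn p n).+2%:R / (logn p n).+1%:R) `^ delta <= w (n * p)%N.
Hypothesis B_smooth : forall n, (0 < n)%N -> B n != 0 -> smooth P n.
Hypothesis B0 : forall n, (n <= 1)%N -> B n = 0.
Hypothesis B_summable : forall x : R, 0 < x -> dsummable B x.
Hypothesis gE : forall s, 0 < complex.Re s -> 'D_1 g s = - dirichlet B s.
Hypothesis M_gt0 : 0 < M.
Hypothesis g_bloch : forall s, 0 < complex.Re s -> complex.Re s * cabs ('D_1 g s) <= M.
Hypothesis g_bloch0 : forall eps : R, 0 < eps -> exists2 rho : R, 0 < rho &
  forall s, 0 < complex.Re s < rho -> complex.Re s * cabs ('D_1 g s) <= eps.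

Let line_bound (K : R) l t : (let s := cpt (2 ^+ l)^-1 t in
    complex.Re s * cabs ('D_1 g s) <= K) ->
  cabs (dirichlet B (cpt (2 ^+ l)^-1 t)) <= K * 2 ^+ l.
Proof.
by rewrite /= gE/= ?invr_gt0 ?exprn_gt0// cabsN mulrC ler_pdivrMr ?exprn_gt0.
Qed.

Let ln_block n l : (0 < n)%N -> block P n = l -> (1 < smooth_part P n)%N ->
  2 ^+ l * ln 2 <= ln n%:R :> R.
Proof.
move=> n0 <- s1; apply: le_trans (block_lower R s1) _.
by apply: ln_nat_le; rewrite ?smooth_part_gt0 ?smooth_part_leq.
Qed.

Let C := 16 * block_const P delta.

Let C_ge0 : 0 <= C.
Proof. by rewrite mulr_ge0// block_const_ge0. Qed.

Lemma volterra_coef_bounded (a : nat -> CC R) (Y : nat) :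
  \sum_(1 <= n < Y) cabs (volterra_coef B a n) ^+ 2 / w n <=
  C * (M / ln 2) ^+ 2 * \sum_(1 <= k < Y) cabs (a k) ^+ 2 / w k.
Proof.
apply: (tail_bound delta_gt0 w_gt0 w_grows B_smooth (B0 (leqnn 1)) B_summable) => //.
  exact: sqr_ge0.
have l2 := ln2_gt0 R.
move=> l; exists (M * 2 ^+ l); split; first by rewrite mulr_gt0// exprn_gt0.
  by move=> t; apply: line_bound; apply: g_bloch; rewrite /= invr_gt0 exprn_gt0.
move=> n n0 nl s1; rewrite -exprMn; apply: lerXn2r.
- by rewrite nnegrE mulr_ge0 ?exprn_ge0// ltW.
- by rewrite nnegrE mulr_ge0 ?divr_ge0 ?ln_nat_ge0// ltW.
- rewrite [leLHS](_ : _ = M / ln 2 * (2 ^+ l * ln 2)); last by field; rewrite gt_eqF.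
  by rewrite ler_wpM2l ?ln_block// divr_ge0// ltW.
Qed.

(** In a late block log n is at least 2 ^ l log 2 while the supremum on the line
    of abscissa 2 ^ -l is o(2 ^ l); in the finitely many remaining blocks the
    suprema are bounded, so it is enough that n is large. *)
Lemma volterra_coef_small_tail (eta : R) : 0 < eta ->
  exists2 X, (0 < X)%N & forall (a : nat -> CC R) Y,
    \sum_(X <= n < Y) cabs (volterra_coef B a n) ^+ 2 / w n <=
    eta * \sum_(1 <= k < Y) cabs (a k) ^+ 2 / w k.
Proof.
move=> eta0; have l2 := ln2_gt0 R.
have C1 : 0 < C + 1 by rewrite ltr_wpDl.
pose r := Num.sqrt (eta / (C + 1)).
have r0 : 0 < r by rewrite sqrtr_gt0 divr_gt0.
have r2 : r ^+ 2 = eta / (C + 1) by rewrite sqr_sqrtr// divr_ge0 ?ltW.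
have e0 : 0 < r * ln 2 by rewrite mulr_gt0.
have [rho rho0 hrho] := g_bloch0 e0.
pose L := (Num.truncn rho^-1).+1.
have hL l : (L <= l)%N -> (2 ^+ l)^-1 < rho.
  move=> Ll; rewrite invf_plt ?posrE ?exprn_gt0//.
  apply: lt_le_trans (truncnS_gt rho^-1) _; rewrite -natrX ler_nat.
  by rewrite (leq_trans Ll)// ltnW// ltn_expl.
pose X := (Num.truncn (expR (M * 2 ^+ L / r))).+1.
have hX n : (X <= n)%N -> M * 2 ^+ L <= r * ln n%:R.
  move=> Xn; rewrite [leRHS]mulrC -ler_pdivrMr// -ler_expR.
  have n0 : 0 < n%:R :> R by rewrite ltr0n (leq_trans _ Xn).
  by rewrite lnK ?posrE// ltW// (lt_le_trans (truncnS_gt _))// ler_nat.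
exists X => // a Y.
apply: (@le_trans _ _ (C * r ^+ 2 * \sum_(1 <= k < Y) cabs (a k) ^+ 2 / w k)); last first.
  rewrite ler_wpM2r//.
    by rewrite big_nat sumr_ge0// => n /andP[n0 _]; exact: weighted_sqr_ge0.
  by rewrite r2 mulrCA ler_piMr ?(ltW eta0)// ler_pdivrMr// mul1r lerDl.
apply: (tail_bound delta_gt0 w_gt0 w_grows B_smooth (B0 (leqnn 1)) B_summable) => //.
  exact: sqr_ge0.
move=> l; have [Ll|lL] := leqP L l.
  exists (r * ln 2 * 2 ^+ l); split; first by rewrite mulr_gt0// exprn_gt0.
    move=> t; apply: line_bound; apply: hrho.
    by rewrite /= invr_gt0 exprn_gt0//= hL.
  move=> n Xn nl s1; have n0 : (0 < n)%N := leq_trans (ltn0Sn _) Xn.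
  rewrite -exprMn; apply: lerXn2r.
  - by rewrite nnegrE mulr_ge0 ?exprn_ge0// ltW.
  - by rewrite nnegrE mulr_ge0 ?ln_nat_ge0// ltW.
  - by rewrite -mulrA ler_wpM2l 1?mulrC ?ln_block// ltW.
exists (M * 2 ^+ l); split; first by rewrite mulr_gt0// exprn_gt0.
  by move=> t; apply: line_bound; apply: g_bloch; rewrite /= invr_gt0 exprn_gt0.
move=> n Xn nl s1; rewrite -exprMn; apply: lerXn2r.
- by rewrite nnegrE mulr_ge0 ?exprn_ge0// ltW.
- by rewrite nnegrE mulr_ge0 ?ln_nat_ge0// ltW.
- apply: le_trans (hX n Xn); rewrite (ler_wpM2l (ltW M_gt0))//.
  by rewrite ler_weXn2l ?ler1n// ltnW.
Qed.

Lemma volterra_coef_linear c a a' n :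
  volterra_coef B (fun k => c * a k + a' k) n =
  c * volterra_coef B a n + volterra_coef B a' n.
Proof.
rewrite /volterra_coef /dconv.
rewrite (eq_bigr (fun k => c * (a k * B (n %/ k)) + a' k * B (n %/ k))); last first.
  by move=> k _; ring.
by rewrite big_split/= -mulr_sumr; ring.
Qed.

Lemma volterra_coef_compact : compact_operator w (volterra_coef B).
Proof.
apply: (compact_of_tails w_gt0 (C := C * (M / ln 2) ^+ 2)).
- by rewrite mulr_ge0// sqr_ge0.
- exact: volterra_coef_linear.
- exact: volterra_coef_bounded.
- exact: volterra_coef_small_tail.
Qed.

End VolterraOperator.

Theorem theorem2 (R : realType) (w : nat -> R) (d : nat) (g : CC R -> CC R)
  (hw : weight_class w) (hd : (1 <= d)%N)
  (hbloch : bloch0 0 g) (hDd : in_Dd d g) :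
  exists T : (nat -> CC R) -> (nat -> CC R),
    is_volterra_operator w g T /\ compact_operator w T.
Proof.
have [w_gt0 [delta delta0 w_grows] w_sum] := weight_class_properties hw.
have [[hol [M0 hM0]] small] := hbloch.
have [b [theta [b_smooth b_series]]] := hDd.
have [Bd hBd] := among_first_primes_bounded d.
pose P := [seq p <- iota 0 Bd | among_first_primes d p].
have pP : all prime P.
  by apply/allP => p; rewrite mem_filter => /andP[/andP[]].
have bloch_g s : 0 < complex.Re s -> complex.Re s * cabs ('D_1 g s) <= M0.
  by move=> s0; have := hM0 s s0; rewrite subr0.
have hol_g s : 0 < complex.Re s -> derivable g s 1 by exact: hol.
have sb n : (0 < n)%N -> b n != 0 -> smooth P n.
  move=> n0 bn; apply/allP => p; rewrite mem_primes => /and3P[pp _ pn].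
  have hp := b_smooth n p n0 bn pp pn.
  by rewrite mem_filter hp mem_iota/= hBd.
have hb s : theta < complex.Re s -> is_dirichlet b s (g s) by exact: b_series.
have b_sum := summable_everywhere pP hol_g bloch_g sb hb.
have gE := derive_identity pP hol_g bloch_g sb hb.
pose B := dlog b.
have B0 n : (n <= 1)%N -> B n = 0.
  by case: n => [|[|//]] _; rewrite /B /dlog ?ln1 ?(@ln0 R) ?mul0r.
have B_smooth n : (0 < n)%N -> B n != 0 -> smooth P n.
  move=> n0 Bn; apply: sb => //; apply: contraNneq Bn => bn.
  by rewrite /B /dlog bn mulr0.
have B_sum (x : R) : 0 < x -> dsummable B x.
  move=> x0; apply: (@dsummable_log _ _ (x / 2)); last by apply: b_sum; rewrite divr_gt0.
  by rewrite ltr_pdivrMr// ltr_pMr// ltr1n.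
have M0ge := M_ge0 bloch_g.
have M1 : 0 < M0 + 1 by rewrite ltr_wpDl.
have bloch1 s : 0 < complex.Re s -> complex.Re s * cabs ('D_1 g s) <= M0 + 1.
  by move=> s0; rewrite (le_trans (bloch_g s s0))// lerDl.
have small1 (eps : R) : 0 < eps -> exists2 rho : R, 0 < rho &
    forall s, 0 < complex.Re s < rho -> complex.Re s * cabs ('D_1 g s) <= eps.
  move=> e0; have [rho rho0 h] := small eps e0; exists rho => // s.
  by rewrite -[rho]add0r => /h; rewrite subr0 => /ltW.
have comp := volterra_coef_compact w_gt0 delta0 w_grows B_smooth B0 B_sum gE M1 bloch1 small1.
exists (volterra_coef B); split=> // a fa; split; first by case: comp => h _ _; exact: h.
move=> s s2; have s0 : 0 < complex.Re s by apply: lt_trans s2; rewrite invr_gt0.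
apply: volterra_identity => //.
- exact: dsummable_H2 w_gt0 w_sum fa s2.
- exact: B_sum.
- by move=> z sz; apply: gE; exact: lt_le_trans sz.
Qed.
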